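(* Let $(M,g)$ be a pseudo-Riemannian manifold of dimension $n\ge 3$. Let $P_{2N}$ denote the GJMS operators of $g$, let $\mathcal{M}_{2N}$ denote the second-order differential operators on $M$ defined from the Poincaré metric of $g$, and let $m_I$ be the constants, all as defined in the context. Then for every integer $N\ge 1$ (and $N\le n/2$ if $n$ is even), $$P_{2N}=-\sum_{\substack{|I|=N\\ I\ne (N)}} m_I\,P_{2I}+\mathcal{M}_{2N},$$ where the sum is over all compositions $I$ of $N$ other than the one-term composition $(N)$.
   Context: Setting. $g$ is a pseudo-Riemannian metric of signature $(p,q)$, $p+q=n\ge 3$, on an $n$-dimensional manifold $M$. A Poincaré metric in normal form relative to $g$ is a metric on $M\times(0,\epsilon)$ of the form $g_+=r^{-2}(dr^2+h_r)$, where $h_r$ is a smooth 1-parameter family of metrics on $M$ with $h_0=g$, for which $\mathrm{Ric}(g_+)+ng_+=0$ asymptotically at $r=0$: if $n$ is odd, $\mathrm{Ric}(g_+)+ng_+=O(r^\infty)$; if $n$ is even, $\mathrm{Ric}(g_+)+ng_+=O(r^{n-2})$ and the tangential trace of $r^{2-n}(\mathrm{Ric}(g_+)+ng_+)$ vanishes at $r=0$. The family $h_r$ is even in $r$, in the sense that $h_r=g_\rho$ with $\rho=-r^2/2$ for a smooth 1-parameter family $g_\rho$ of metrics on $M$, $\rho\in(-\epsilon,\epsilon)$, $g_0=g$. The quantities defined below are independent of the remaining choices. Operators $\mathcal{M}_{2N}$. Set $V(r)=\sqrt{\det h_r/\det h_0}$ and $W(r)=\sqrt{V(r)}$. Let $\delta\varphi=\nabla_i\varphi^i$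 be the divergence on vector fields with respect to $g$, so $\delta(h_r^{-1}df)=\nabla_i(h_r^{ij}\partial_j f)$. Define $$\mathcal{M}(r)=\delta(h_r^{-1}d)-U(r),\qquad U(r)=\frac{[\partial_r^2-(n-1)r^{-1}\partial_r+\delta(h_r^{-1}d)]W(r)}{W(r)},$$ where $U(r)$ acts as a zeroth order (multiplication) term. The operators $\mathcal{M}_{2N}$ on $M$, for $N\ge1$ (and $N\le n/2$ if $n$ is even), are defined by the Taylor expansion at $r=0$ $$\mathcal{M}(r)=\sum_{N\ge1}\mathcal{M}_{2N}\frac{1}{(N-1)!^2}\left(\frac{r^2}{4}\right)^{N-1}.$$ GJMS operators. Let $\widetilde g=2\rho\,dt^2+2t\,dt\,d\rho+t^2g_\rho$ on $\mathbb{R}_+\times M\times(-\epsilon,\epsilon)$ (coordinates $t,x,\rho$), with Laplacian $\widetilde\Delta$ (sign: trace of the Hessian). For $N\ge1$ (and $N\le n/2$ if $n$ is even), $P_{2N}f=\widetilde\Delta^N(t^{N-n/2}\widetilde f)|_{\rho=0,\,t=1}$, where $f\in C^\infty(M)$ and $\widetilde f\in C^\infty(M\times(-\epsilon,\epsilon))$ is any function with $\widetilde f(x,0)=f(x)$; the result is independent of the choice of $\widetilde f$. With this convention $P_{2N}=\Delta^N+\cdots$, where $\Delta=\delta(g^{-1}d)$. Compositions and constants. A composition is an ordered list $I=(I_1,\ldots,I_r)$ of positive integers, with $|I|=I_1+\cdots+I_r$. Set $P_{2I}=P_{2I_1}\circ\cdots\circ P_{2I_r}$ and $$m_I=(-1)^{r+1}|I|!\,(|I|-1)!\prod_{j=1}^r\frac{1}{I_j!\,(I_j-1)!}\prod_{j=1}^{r-1}\frac{1}{I_j+I_{j+1}}.$$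 Empty products equal 1. Notation: $k!^2=(k!)^2$. *)

(* Defs.v *)
From HB Require Import structures.
From mathcomp Require Import all_boot all_order all_algebra.
From mathcomp Require Import all_classical all_reals all_analysis.

Set Implicit Arguments.
Unset Strict Implicit.
Unset Printing Implicit Defensive.

Import Order.TTheory GRing.Theory Num.Theory.
Import numFieldNormedType.Exports.

Local Open Scope classical_set_scope.
Local Open Scope ring_scope.

Section Coordinates.
Variables (R : realType) (m : nat).
Implicit Types (u : 'rV[R]_m -> R) (x : 'rV[R]_m) (G : 'rV[R]_m -> 'M[R]_m).

Definition partial (i : 'I_m) u : 'rV[R]_m -> R :=
  fun x => 'D_(delta_mx 0 i) u x.

(* C^oo on an open set U: every iterated partial derivative is (Frechet)
   differentiable, hence continuous, at every point of U. *)
Definition smooth_on (U : set 'rV[R]_m) u :=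
  forall (s : seq 'I_m) x, U x -> differentiable (foldr partial u s) x.

Definition christoffel G (k i j : 'I_m) x : R :=
  2^-1 * \sum_(l < m) invmx (G x) k l *
    (partial i (fun y => G y j l) x + partial j (fun y => G y i l) x
     - partial l (fun y => G y i j) x).

(* The sign is such that round spheres have positive Ricci curvature. *)
Definition ricci G (i j : 'I_m) x : R :=
  \sum_(k < m) (partial k (christoffel G k i j) x
                - partial j (christoffel G k i k) x)
  + \sum_(k < m) \sum_(l < m)
      (christoffel G k k l x * christoffel G l i j x
       - christoffel G k j l x * christoffel G l i k x).

Definition divergence G (X : 'I_m -> 'rV[R]_m -> R) x : R :=
  \sum_(i < m) (partial i (X i) x
                + \sum_(k < m) christoffel G i i k x * X k x).

(* Trace of the Hessian. *)
Definition laplacian G u x : R :=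
  \sum_(i < m) \sum_(j < m) invmx (G x) i j *
    (partial i (partial j u) x
     - \sum_(k < m) christoffel G k i j x * partial k u x).

Definition has_signature (p q : nat) (A : 'M[R]_m) :=
  (p + q)%N = m /\
  exists2 B : 'M[R]_m, B \in unitmx &
    B *m A *m B^T = diag_mx (\row_(i < m) (if (i < p)%N then 1 else -1)).

End Coordinates.

Record manifold (R : realType) (n : nat) := Manifold {
  carrier :> topologicalType;
  hausdorff_carrier : hausdorff_space carrier;
  second_countable_carrier : @second_countable carrier;
  chart_index : Type;
  dom : chart_index -> set carrier;
  chart : chart_index -> carrier -> 'rV[R]_n;
  (* only meaningful on the image of the chart *)
  chart_inv : chart_index -> 'rV[R]_n -> carrier;
  chart_cover : forall x, exists a, dom a x;
  open_dom : forall a, open (dom a);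
  open_cod : forall a, open (chart a @` dom a);
  chartK : forall a x, dom a x -> chart_inv a (chart a x) = x;
  chart_continuous : forall a x, dom a x -> {for x, continuous (chart a)};
  chart_inv_continuous : forall a x, dom a x ->
    {for chart a x, continuous (chart_inv a)};
  chart_compatible : forall a b (k : 'I_n),
    smooth_on (chart a @` (dom a `&` dom b))
              (fun y => chart b (chart_inv a y) 0 k) }.

Section Metrics.
Variables (R : realType) (n : nat) (M : manifold R n).

Definition cod (a : chart_index M) : set 'rV[R]_n := chart a @` dom a.

Definition smooth (f : M -> R) :=
  forall a, smooth_on (cod a) (fun y => f (chart_inv a y)).

(* A point (y, s) of R^n x R is encoded as the row vector row_mx y s%:M. *)
Definition cyl_x (z : 'rV[R]_(n + 1)) : 'rV[R]_n := lsubmx z.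
Definition cyl_s (z : 'rV[R]_(n + 1)) : R := rsubmx z 0 0.

Definition cylinder (a : chart_index M) (eps : R) : set 'rV[R]_(n + 1) :=
  [set z | cod a (cyl_x z) /\ - eps < cyl_s z < eps].

Definition smooth_cyl (eps : R) (F : M -> R -> R) :=
  forall a, smooth_on (cylinder a eps)
    (fun z => F (chart_inv a (cyl_x z)) (cyl_s z)).

(* A symmetric 2-tensor on M is given by its component matrices in all the
   charts; the Jacobian matrix is 'J f y i k = d f_k / d y_i. *)
Definition is_metric (p q : nat) (g : chart_index M -> 'rV[R]_n -> 'M[R]_n) :=
  [/\ forall a y, cod a y -> has_signature p q (g a y),
      forall a i j, smooth_on (cod a) (fun y => g a y i j)
    & forall a b x, dom a x -> dom b x ->
        let J := jacobian (chart b \o chart_inv a) (chart a x) in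
        g a (chart a x) = J *m g b (chart b x) *m J^T].

End Metrics.

Section Poincare.
Variables (R : realType) (n : nat).

(* Local coordinate expressions: gr rho y is the matrix of g_rho at y. *)
Implicit Type gr : R -> 'rV[R]_n -> 'M[R]_n.

Definition hr gr (r : R) : 'rV[R]_n -> 'M[R]_n := gr (- (r ^+ 2 / 2)).

(* g_+ = r^-2 (dr^2 + h_r) in the coordinates (y, r) *)
Definition poincare_metric gr (z : 'rV[R]_(n + 1)) : 'M[R]_(n + 1) :=
  let r := cyl_s z in
  r ^- 2 *: block_mx (hr gr r (cyl_x z)) 0 0 1%:M.

Definition einstein_defect gr (y : 'rV[R]_n) (r : R) (i j : 'I_(n + 1)) : R :=
  let z := row_mx y r%:M in
  ricci (poincare_metric gr) i j z + n%:R * poincare_metric gr z i j.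

(* Stated at each y separately: r^2 times the defect is smooth up to r = 0, so
   its vanishing order at every y is the same as locally uniform vanishing. *)
Definition asymptotically_einstein gr (y : 'rV[R]_n) :=
  if odd n then
    forall (k : nat) i j,
      (fun r : R => einstein_defect gr y r i j) =O_ (0^'+) (fun r : R => r ^+ k)
  else
    (forall i j,
      (fun r : R => einstein_defect gr y r i j)
        =O_ (0^'+) (fun r : R => r ^+ (n - 2))) /\
    (fun r : R => \sum_(i < n) \sum_(j < n) invmx (gr 0 y) i j *
       (r ^- (n - 2) * einstein_defect gr y r (lshift 1 i) (lshift 1 j)))
      @ 0^'+ --> (0 : R).

(* h_r = g_rho, rho = - r^2 / 2, for a smooth family of metrics g_rho with
   g_0 = g, such that g_+ is a Poincare metric in normal form relative to g. *)
Definition is_poincare_family (M : manifold R n) (p q : nat)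
    (g : chart_index M -> 'rV[R]_n -> 'M[R]_n) (eps : R)
    (gr : chart_index M -> R -> 'rV[R]_n -> 'M[R]_n) :=
  [/\ forall rho, - eps < rho < eps -> is_metric p q (fun a => gr a rho),
      forall a i j, smooth_on (cylinder a eps)
        (fun z => gr a (cyl_s z) (cyl_x z) i j),
      forall a y, cod a y -> gr a 0 y = g a y
    & forall a y, cod a y -> asymptotically_einstein (gr a) y].

End Poincare.

(* N >= 1, and N <= n/2 if n is even *)
Definition admissible (n N : nat) : bool :=
  (0 < N)%N && (~~ odd n ==> (N <= n./2)%N).

Section Operators.
Variables (R : realType) (n : nat).
Implicit Type gr : R -> 'rV[R]_n -> 'M[R]_n.

(* Ambient coordinates (t, y, rho) *)
Definition amb_t (Z : 'rV[R]_(1 + (n + 1))) : R := lsubmx Z 0 0.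
Definition amb_x (Z : 'rV[R]_(1 + (n + 1))) : 'rV[R]_n := cyl_x (rsubmx Z).
Definition amb_rho (Z : 'rV[R]_(1 + (n + 1))) : R := cyl_s (rsubmx Z).
Definition amb_point (t : R) (y : 'rV[R]_n) (rho : R) : 'rV[R]_(1 + (n + 1)) :=
  row_mx t%:M (row_mx y rho%:M).

(* 2 rho dt^2 + 2 t dt drho + t^2 g_rho *)
Definition ambient_metric gr (Z : 'rV[R]_(1 + (n + 1))) :
    'M[R]_(1 + (n + 1)) :=
  let t := amb_t Z in let rho := amb_rho Z in
  block_mx (2 * rho)%:M         (row_mx 0 t%:M)
           (col_mx 0 t%:M)      (block_mx (t ^+ 2 *: gr rho (amb_x Z)) 0
                                          0                            0).

(* P is P_2N. The requirement is imposed for every smooth extension F of f and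
   in every chart, on whose choice the right-hand side does not depend. *)
Definition is_gjms (M : manifold R n) (eps : R)
    (gr : chart_index M -> R -> 'rV[R]_n -> 'M[R]_n)
    (N : nat) (P : (M -> R) -> (M -> R)) :=
  forall (f : M -> R) (F : M -> R -> R),
    smooth f -> smooth_cyl eps F -> (forall x, F x 0 = f x) ->
    forall (a : chart_index M) (x : M), dom a x ->
      P f x =
      iter N (laplacian (ambient_metric (gr a)))
        (fun Z => amb_t Z `^ (N%:R - n%:R / 2)
                  * F (chart_inv a (amb_x Z)) (amb_rho Z))
        (amb_point 1 (chart a x) 0).

(* delta (h^-1 du), where delta is the divergence of g *)
Definition div_grad (g h : 'rV[R]_n -> 'M[R]_n) (u : 'rV[R]_n -> R) :
    'rV[R]_n -> R :=
  divergence g (fun i y => \sum_(j < n) invmx (h y) i j * partial j u y).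

Definition Vfun gr (r : R) (y : 'rV[R]_n) : R :=
  Num.sqrt (\det (hr gr r y) / \det (hr gr 0 y)).

Definition Wfun gr (r : R) (y : 'rV[R]_n) : R := Num.sqrt (Vfun gr r y).

Definition Ufun (g : 'rV[R]_n -> 'M[R]_n) gr (r : R) (y : 'rV[R]_n) : R :=
  (derive1n 2 (Wfun gr ^~ y) r
   - (n%:R - 1) * r^-1 * derive1 (Wfun gr ^~ y) r
   + div_grad g (hr gr r) (Wfun gr r) y) / Wfun gr r y.

Definition calM (g : 'rV[R]_n -> 'M[R]_n) gr (r : R) (u : 'rV[R]_n -> R)
    (y : 'rV[R]_n) : R :=
  div_grad g (hr gr r) u y - Ufun g gr r y * u y.

(* Mop N is M_2N. Since M(r) is only defined for r > 0, its Taylor expansion at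
   r = 0 is the asymptotic one as r -> 0+, to every order at which the M_2N
   are defined. *)
Definition is_calM_coefficients (M : manifold R n)
    (g : chart_index M -> 'rV[R]_n -> 'M[R]_n)
    (gr : chart_index M -> R -> 'rV[R]_n -> 'M[R]_n)
    (Mop : nat -> (M -> R) -> (M -> R)) :=
  forall f : M -> R, smooth f ->
  forall (a : chart_index M) (x : M), dom a x ->
  forall K : nat, admissible n K ->
    (fun r : R => calM (g a) (gr a) r (fun y => f (chart_inv a y)) (chart a x)
       - \sum_(1 <= N < K.+1)
           Mop N f x * ((N.-1)`!%:R ^+ 2)^-1 * (r ^+ 2 / 4) ^+ N.-1)
    =o_ (0^'+) (fun r : R => r ^+ (2 * K.-1)).

End Operators.

(* All the compositions of N are found among the l-tuples of elements of
   'I_N.+1 with l <= N. *)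
Definition is_composition (N : nat) (I : seq nat) : bool :=
  all (leq 1) I && (sumn I == N).

Definition m_coef (R : realType) (I : seq nat) : R :=
  (-1) ^+ (size I).+1 * (sumn I)`!%:R * ((sumn I).-1)`!%:R
  * (\prod_(k <- I) (k`!%:R * (k.-1)`!%:R)^-1)
  * \prod_(j < (size I).-1) (nth 0%N I j + nth 0%N I j.+1)%:R^-1.

(* op_comp P [:: I_1; ...; I_r] = P I_1 \o ... \o P I_r *)
Definition op_comp (A : Type) (P : nat -> A -> A) (I : seq nat) : A -> A :=
  foldr (fun k Q => P k \o Q) id I.

(* Main.v *)
(* Put [rho = - r^2 / 2], [s = - rho / 2 = r^2 / 4] and [w = (det g_rho / det g_0)^(1/4)].
   Conjugating by [w], the ambient Laplacian maps [t^gam F(x, rho)] to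
   [t^(gam - 2) D F], where
     [D = - 2 rho d_rho^2 + (2 gam + n - 2) d_rho + M(r)]
   and [M(r)] is the operator whose expansion is [sum_a mu_a s^(a - 1)] with
   [mu_a = M_2a / (a - 1)!^2]; the point of [w] is that the zeroth order term does not
   depend on [gam]. For [gam = k - n / 2], compute [P_2k f] with the extension
   [w^-1 sum_(j < k) F_j s^j], where [F_0 = f] and
     [j (lam - j) F_j = sum_(1 <= a <= j) mu_a F_(j - a)]   at [lam = k].
   The first factor [D] maps [sum_j F_j s^j] to a function vanishing to order [k - 1] in
   [s], each of the other [k - 1] factors lowers the order by one and multiplies the
   leading coefficient by a constant, and the result is
     [P_2k = (k - 1)!^2 pi_k],   [pi_k = sum_(1 <= a <= k) mu_a F_(k - a)(lam = k)].
   To express [mu_N] through the [pi_k], view [F_j = F_j(lam)] as a rational function of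
   [lam]. It has simple poles at [lam = 1, ..., j]. The residues at [lam = k] form a
   solution of the recursion at [lam = k] starting with [s^k], and dividing by [s^k] turns
   it into a solution at [lam = - k]; hence for [j > 0]
     [F_j(lam) = sum_(1 <= k <= j) F_(j - k)(- k) (pi_k / k) / (lam - k)].
   Letting [lam] tend to infinity gives [mu_N = N sum_k F_(N - k)(- k) (pi_k / k)], and
   iterating the partial fraction expansion at [lam = - k] produces the sum over
   compositions, each step contributing a factor [- 1 / (I_j + I_(j + 1))]. *)

Require Import Defs.
From mathcomp Require Import all_boot all_order all_algebra.
From mathcomp Require Import all_classical all_reals all_analysis.
From mathcomp Require Import ring lra zify.

Set Implicit Arguments.
Unset Strict Implicit.
Unset Printing Implicit Defensive.

Import Order.TTheory GRing.Theory Num.Theory.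
Import numFieldNormedType.Exports.

Local Open Scope classical_set_scope.
Local Open Scope ring_scope.

(** * Smooth functions on open subsets *)

(** One and the same [w] serves all the factors [D], although their weights [gam] differ. With
    [theta = d_rho log sqrt |det g_rho|], the ambient Laplacian contains
    [- 2 rho theta d_rho + gam theta], and [d_rho log w = theta / 2] is exactly what removes both
    terms at once.

    The [M_2a] are given only pointwise, chart by chart, as coefficients of an expansion for
    [r -> 0+]. Their smoothness and linearity are read off from Taylor coefficients of an operator
    on the cylinder that is smooth across [rho = 0]; hence everything is done on smooth functions
    and for indices up to [N].

    No rational function of [lam] appears. The partial fraction expansion, at points off the poles,
    and the formula for [mu_j] are proved together by induction on [j]. Instead of a limit at
    infinity, the expansion is inserted in [pi_j] at [lam = j], where only [F_i] with [i < j] occur,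
    which are regular there. The [mu_a] need not commute: each expansion step splits off the
    operator that acts first, that is, the last part of a composition. *)

Lemma near_eq_differentiable (R : realType) (V W : normedModType R)
    (f g : V -> W) (x : V) :
  (\near x, f x = g x) -> differentiable f x -> differentiable g x.
Proof.
move=> fg df.
have fgx : f x = g x := nbhs_singleton fg.
have cd := diff_continuous df.
have gE : g \o shift x = cst (g x) + 'd f x +o_ 0 id.
  apply/eqaddoP => _/posnumP[e].
  have := diff_locally df; move=> /eqaddoP /(_ e%:num (gt0 e)) H.
  have fg' : \forall h \near (0 : V), f (h + x) = g (h + x).
    by move: fg; rewrite (near_shift 0) /= subr0; apply: filterS => h; rewrite /= /shift.
  apply: filterS2 fg' H => h fgh.
  by rewrite !fctE /= /shift /= fgh fgx.
by apply/diff_locallyP; rewrite (diff_unique cd gE).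
Qed.

Section SmoothOn.
Variables (R : realType) (m : nat).
Implicit Types (U : set 'rV[R]_m) (u v : 'rV[R]_m -> R) (x : 'rV[R]_m).

Lemma partial_ext U u v i x : open U -> (forall y, U y -> u y = v y) -> U x ->
  partial i u x = partial i v x.
Proof.
move=> oU uv Ux; apply: near_eq_derive.
by apply: filterS (open_nbhs_nbhs (conj oU Ux)) => y /uv.
Qed.

(** Smoothness up to a finite order. [smooth_on] offers nothing to induct on, whereas one derivative
    of a product, an inverse or a square root is built from functions needed at one order less; so
    each closure property is an induction on [k]. *)
Definition smooth_upto (k : nat) U u := forall s : seq 'I_m, (size s <= k)%N ->
  forall x, U x -> differentiable (foldr (@partial R m) u s) x.

Lemma smooth_uptoP U u : smooth_on U u <-> forall k, smooth_upto k U u.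
Proof.
split=> [us k s _ x|us s x]; first exact: us.
exact: us (size s) s (leqnn _) x.
Qed.

(** The derivative split off is the innermost one, last in the list, because the rest is then a
    statement of lower order about [partial i u]. *)
Lemma smooth_uptoS k U u : smooth_upto k.+1 U u <->
  (forall x, U x -> differentiable u x) /\ forall i, smooth_upto k U (partial i u).
Proof.
split=> [us|[u0 us] s].
  split=> [x|i s sk x Ux]; first exact: (us [::]).
  by have := us (rcons s i); rewrite size_rcons foldr_rcons; apply.
case/lastP: s => [_ x|s i]; first exact: u0.
by rewrite size_rcons foldr_rcons => sk x; apply: us.
Qed.

Lemma smooth_upto0 U u : smooth_upto 0 U u <-> (forall x, U x -> differentiable u x).
Proof. by split=> [us|us [|//] _]; [exact: (us [::])|exact: us]. Qed.

Lemma smooth_upto_diff k U u : smooth_upto k U u -> forall x, U x -> differentiable u x.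
Proof. by move=> /(_ [::]); apply. Qed.

Lemma smooth_uptoW k U u : smooth_upto k.+1 U u -> smooth_upto k U u.
Proof. by move=> us s sk; apply: us; apply: leqW. Qed.

Lemma smooth_upto_ext k U u v : open U -> (forall y, U y -> u y = v y) ->
  smooth_upto k U u -> smooth_upto k U v.
Proof.
move=> oU; elim: k u v => [|k IH] u v uv.
  move=> /smooth_upto0 us; apply/smooth_upto0 => x Ux.
  apply: near_eq_differentiable (us _ Ux).
  by apply: filterS (open_nbhs_nbhs (conj oU Ux)) => y /uv.
move=> /smooth_uptoS [us us']; apply/smooth_uptoS; split=> [x Ux|i].
  apply: near_eq_differentiable (us _ Ux).
  by apply: filterS (open_nbhs_nbhs (conj oU Ux)) => y /uv.
by apply: IH (us' i) => y Uy; apply: partial_ext uv Uy.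
Qed.

Lemma smooth_on_ext U u v : open U -> (forall y, U y -> u y = v y) ->
  smooth_on U u -> smooth_on U v.
Proof. by move=> oU uv /smooth_uptoP us; apply/smooth_uptoP => k; apply: smooth_upto_ext (us k). Qed.

Lemma smooth_on_sub U U' u : U' `<=` U -> smooth_on U u -> smooth_on U' u.
Proof. by move=> UU us s x /UU; apply: us. Qed.

Lemma smooth_diff U u x : smooth_on U u -> U x -> differentiable u x.
Proof. by move=> us; apply: (us [::]). Qed.

Lemma smooth_partial U u i : smooth_on U u -> smooth_on U (partial i u).
Proof. by move=> us s x Ux; rewrite -foldr_rcons; apply: us. Qed.

Section Pointwise.
Variables (u v : 'rV[R]_m -> R) (x : 'rV[R]_m) (i : 'I_m).
Hypotheses (du : differentiable u x) (dv : differentiable v x).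

Lemma dpartialD : partial i (fun y => u y + v y) x = partial i u x + partial i v x.
Proof. exact: (deriveD (diff_derivable du) (diff_derivable dv)). Qed.

Lemma dpartialB : partial i (fun y => u y - v y) x = partial i u x - partial i v x.
Proof. exact: (deriveB (diff_derivable du) (diff_derivable dv)). Qed.

Lemma dpartialN : partial i (fun y => - u y) x = - partial i u x.
Proof. exact: (deriveN (diff_derivable du)). Qed.

Lemma dpartialM :
  partial i (fun y => u y * v y) x = partial i u x * v x + u x * partial i v x.
Proof.
rewrite /partial (deriveM (diff_derivable du) (diff_derivable dv)) addrC.
by rewrite [X in X + _]mulrC.
Qed.

Lemma dpartialV : u x != 0 ->
  partial i (fun y => (u y)^-1) x = - (partial i u x * ((u x)^-1 * (u x)^-1)).
Proof.
move=> ux; rewrite /partial (deriveV ux (diff_derivable du)).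
by rewrite scaleNr expr2 invfM [X in - X]mulrC.
Qed.

Lemma dpartial_comp (h : R -> R) : derivable h (u x) 1 ->
  differentiable (fun y => h (u y)) x /\
  partial i (fun y => h (u y)) x = derive1 h (u x) * partial i u x.
Proof.
move=> /derivable1_diffP dh.
have dhu : differentiable (h \o u) x by apply: differentiable_comp.
split=> //; rewrite /partial -[fun y => _]/(h \o u) (deriveE _ dhu).
have -> : 'd (h \o u) x = 'd h (u x) \o 'd u x :> (_ -> _) by apply: diff_comp.
rewrite /= (deriveE _ du) (derive1E' dh).
by rewrite -[X in 'd h _ X]mulr1 [LHS]linearZ /= mulrC.
Qed.

End Pointwise.

Lemma partial_cst c i x : partial i (fun _ => c) x = 0.
Proof. exact: derive_cst. Qed.

Lemma smooth_upto_cst k U c : smooth_upto k U (fun _ => c).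
Proof.
elim: k c => [|k IH] c; first by apply/smooth_upto0 => x _; exact: differentiable_cst.
apply/smooth_uptoS; split=> [x _|i]; first exact: differentiable_cst.
have -> : partial i (fun=> c) = fun _ : 'rV_m => 0; last exact: IH.
by apply/funext => x; exact: partial_cst.
Qed.

Lemma partial_coord i j x : partial i (fun y => y 0 j) x = (i == j)%:R.
Proof.
rewrite /partial /derive.
have -> : (fun h : R => h^-1 *: (((fun y : 'rV[R]_m => y 0 j) \o shift x)
   (h *: delta_mx 0 i) - x 0 j)) = fun h : R => h^-1 * h * (i == j)%:R.
  apply/funext => h /=; rewrite /shift /= !mxE eqxx /= [j == i]eq_sym addrK.
  by rewrite [LHS]mulrA.
apply/cvg_lim => //; apply: cvg_near_cst.
near=> h; rewrite mulVf ?mul1r //; near: h.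
exact: nbhs_dnbhs_neq.
Unshelve. all: by end_near. Qed.

Lemma smooth_upto_coord k U j : smooth_upto k U (fun y => y 0 j).
Proof.
case: k => [|k]; first by apply/smooth_upto0 => x _; exact: differentiable_coord.
apply/smooth_uptoS; split=> [x _|i]; first exact: differentiable_coord.
have -> : partial i (fun y => y 0 j) = fun _ => (i == j)%:R :> R; last exact: smooth_upto_cst.
by apply/funext => x; exact: partial_coord.
Qed.

Section Open.
Variable U : set 'rV[R]_m.
Hypothesis oU : open U.

Lemma smooth_uptoD k u v : smooth_upto k U u -> smooth_upto k U v -> smooth_upto k U (fun y => u y + v y).
Proof.
have D0 u1 v1 : (forall x, U x -> differentiable u1 x) ->
    (forall x, U x -> differentiable v1 x) ->
    (forall x, U x -> differentiable (fun y => u1 y + v1 y) x).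
  by move=> a b x Ux; exact: (differentiableD (a x Ux) (b x Ux)).
elim: k u v => [|k IH] u v; first by move=> /smooth_upto0 a /smooth_upto0 b; apply/smooth_upto0; exact: D0.
move=> /smooth_uptoS [a a'] /smooth_uptoS [b b']; apply/smooth_uptoS; split; first exact: D0.
move=> i; apply: smooth_upto_ext (IH _ _ (a' i) (b' i)) => // y Uy.
by rewrite dpartialD //; [apply: a|apply: b].
Qed.

Lemma smooth_uptoM k u v : smooth_upto k U u -> smooth_upto k U v -> smooth_upto k U (fun y => u y * v y).
Proof.
have D0 u1 v1 : (forall x, U x -> differentiable u1 x) ->
    (forall x, U x -> differentiable v1 x) ->
    (forall x, U x -> differentiable (fun y => u1 y * v1 y) x).
  by move=> a b x Ux; exact: (differentiableM (a x Ux) (b x Ux)).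
elim: k u v => [|k IH] u v; first by move=> /smooth_upto0 a /smooth_upto0 b; apply/smooth_upto0; exact: D0.
move=> us vs; have /smooth_uptoS [a a'] := us; have /smooth_uptoS [b b'] := vs.
apply/smooth_uptoS; split; first exact: D0.
move=> i; apply: smooth_upto_ext
  (smooth_uptoD (IH _ _ (a' i) (smooth_uptoW vs)) (IH _ _ (smooth_uptoW us) (b' i))) => // y Uy.
by rewrite dpartialM //; [apply: a|apply: b].
Qed.

Lemma smooth_uptoN k u : smooth_upto k U u -> smooth_upto k U (fun y => - u y).
Proof.
move=> us; apply: smooth_upto_ext (smooth_uptoM (smooth_upto_cst (k:=k) (U:=U) (-1)) us) => // y _.
by rewrite mulN1r.
Qed.

(** The derivative of [1 / u] is [- partial i u / u ^ 2], where [1 / u] is needed only at the lower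
    order supplied by the induction; the square root below works alike. *)
Lemma smooth_uptoV k u : (forall x, U x -> u x != 0) ->
  smooth_upto k U u -> smooth_upto k U (fun y => (u y)^-1).
Proof.
move=> u0; have D0 : (forall x, U x -> differentiable u x) ->
    (forall x, U x -> differentiable (fun y => (u y)^-1) x).
  by move=> a x Ux; exact: (differentiableV (a x Ux) (u0 x Ux)).
elim: k => [|k IH]; first by move=> /smooth_upto0 a; apply/smooth_upto0; exact: D0.
move=> us; have /smooth_uptoS [a a'] := us; apply/smooth_uptoS; split; first exact: D0.
have IH' := IH (smooth_uptoW us).
move=> i; apply: smooth_upto_ext (smooth_uptoN (smooth_uptoM (a' i) (smooth_uptoM IH' IH'))) => // y Uy.
by rewrite dpartialV //; [exact: a|exact: u0].
Qed.

Lemma smooth_upto_sqrt k u : (forall x, U x -> 0 < u x) ->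
  smooth_upto k U u -> smooth_upto k U (fun y => Num.sqrt (u y)).
Proof.
move=> u0 us.
have dS x : U x -> differentiable (fun y => Num.sqrt (u y)) x /\ forall i,
   partial i (fun y => Num.sqrt (u y)) x = (2 * Num.sqrt (u x))^-1 * partial i u x.
  move=> Ux; have du := smooth_upto_diff us Ux.
  have ds : is_derive (u x) 1 Num.sqrt (2 * Num.sqrt (u x))^-1.
    exact: is_derive1_sqrt (u0 _ Ux).
  have dsv : derivable Num.sqrt (u x) 1 by exact: (@ex_derive _ _ _ _ _ _ _ ds).
  split; first exact: (differentiable_comp du (proj1 (derivable1_diffP _ _) dsv)).
  move=> i; rewrite (dpartial_comp i du dsv).2 derive1E.
  by rewrite (@derive_val _ _ _ _ _ _ _ ds).
elim: k us => [|k IH] us; first by apply/smooth_upto0 => x Ux; have [] := dS x Ux.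
apply/smooth_uptoS; split=> [x Ux|i]; first by have [] := dS x Ux.
have /smooth_uptoS [_ a'] := us.
have IH' := IH (smooth_uptoW us).
have s0 x : U x -> 2 * Num.sqrt (u x) != 0.
  by move=> Ux; rewrite mulf_neq0 ?pnatr_eq0// gt_eqF // sqrtr_gt0 u0.
apply: smooth_upto_ext (smooth_uptoM (smooth_uptoV s0 (smooth_uptoM (smooth_upto_cst (k:=k) (U:=U) 2) IH')) (a' i)) => // y Uy.
by rewrite (dS y Uy).2.
Qed.

Lemma smooth_cst c : smooth_on U (fun _ => c).
Proof. by apply/smooth_uptoP => k; exact: smooth_upto_cst. Qed.

Lemma smooth_coord j : smooth_on U (fun y => y 0 j).
Proof. by apply/smooth_uptoP => k; exact: smooth_upto_coord. Qed.

Lemma smoothD u v : smooth_on U u -> smooth_on U v ->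
  smooth_on U (fun y => u y + v y).
Proof.
by move=> /smooth_uptoP us /smooth_uptoP vs; apply/smooth_uptoP => k; apply: smooth_uptoD.
Qed.

Lemma smoothM u v : smooth_on U u -> smooth_on U v ->
  smooth_on U (fun y => u y * v y).
Proof.
by move=> /smooth_uptoP us /smooth_uptoP vs; apply/smooth_uptoP => k; apply: smooth_uptoM.
Qed.

Lemma smoothN u : smooth_on U u -> smooth_on U (fun y => - u y).
Proof. by move=> /smooth_uptoP us; apply/smooth_uptoP => k; apply: smooth_uptoN. Qed.

Lemma smoothB u v : smooth_on U u -> smooth_on U v ->
  smooth_on U (fun y => u y - v y).
Proof. by move=> us vs; apply: smoothD => //; apply: smoothN. Qed.

Lemma smoothV u : (forall x, U x -> u x != 0) ->
  smooth_on U u -> smooth_on U (fun y => (u y)^-1).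
Proof. by move=> u0 /smooth_uptoP us; apply/smooth_uptoP => k; apply: smooth_uptoV. Qed.

Lemma smooth_sqrt u : (forall x, U x -> 0 < u x) ->
  smooth_on U u -> smooth_on U (fun y => Num.sqrt (u y)).
Proof. by move=> u0 /smooth_uptoP us; apply/smooth_uptoP => k; apply: smooth_upto_sqrt. Qed.

Lemma smooth_sum (I : Type) (r : seq I) (P : pred I) (F : I -> 'rV[R]_m -> R) :
  (forall k, P k -> smooth_on U (F k)) ->
  smooth_on U (fun y => \sum_(k <- r | P k) F k y).
Proof.
move=> Fs; elim: r => [|k r IH].
  rewrite (_ : (fun y => _) = fun _ : 'rV[R]_m => 0 : R); first exact: smooth_cst.
  by apply/funext => y; rewrite big_nil.
rewrite (_ : (fun y => _) = fun y => if P k then F k y + \sum_(k <- r | P k) F k y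
                               else \sum_(k <- r | P k) F k y).
  by case: (P k) (@Fs k) => // Fk; apply: smoothD => //; exact: Fk.
by apply/funext => y; rewrite big_cons.
Qed.

Lemma smooth_prod (I : Type) (r : seq I) (P : pred I) (F : I -> 'rV[R]_m -> R) :
  (forall k, P k -> smooth_on U (F k)) ->
  smooth_on U (fun y => \prod_(k <- r | P k) F k y).
Proof.
move=> Fs; elim: r => [|k r IH].
  rewrite (_ : (fun y => _) = fun _ : 'rV[R]_m => 1 : R); first exact: smooth_cst.
  by apply/funext => y; rewrite big_nil.
rewrite (_ : (fun y => _) = fun y => if P k then F k y * \prod_(k <- r | P k) F k y
                               else \prod_(k <- r | P k) F k y).
  by case: (P k) (@Fs k) => // Fk; apply: smoothM => //; exact: Fk.
by apply/funext => y; rewrite big_cons.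
Qed.

Lemma smoothX u j : smooth_on U u -> smooth_on U (fun y => u y ^+ j).
Proof.
move=> us; elim: j => [|j IH]; first exact: smooth_cst.
by rewrite (_ : (fun y => _) = fun y => u y * u y ^+ j); [exact: smoothM|apply/funext => y; rewrite exprS].
Qed.

Section Rules.
Variables (u v : 'rV[R]_m -> R) (x : 'rV[R]_m) (i : 'I_m).
Hypotheses (us : smooth_on U u) (vs : smooth_on U v) (Ux : U x).

Lemma partialD : partial i (fun y => u y + v y) x = partial i u x + partial i v x.
Proof. by rewrite dpartialD //; apply: smooth_diff Ux. Qed.

Lemma partialB : partial i (fun y => u y - v y) x = partial i u x - partial i v x.
Proof. by rewrite dpartialB //; apply: smooth_diff Ux. Qed.

Lemma partialN : partial i (fun y => - u y) x = - partial i u x.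
Proof. by rewrite dpartialN //; apply: smooth_diff Ux. Qed.

Lemma partialM :
  partial i (fun y => u y * v y) x = partial i u x * v x + u x * partial i v x.
Proof. by rewrite dpartialM //; apply: smooth_diff Ux. Qed.

Lemma partialZ c : partial i (fun y => c * u y) x = c * partial i u x.
Proof.
rewrite dpartialM ?partial_cst ?mul0r ?add0r //; exact: smooth_diff us Ux.
Qed.

Lemma partialV : u x != 0 ->
  partial i (fun y => (u y)^-1) x = - (partial i u x * ((u x)^-1 * (u x)^-1)).
Proof. by move=> u0; rewrite dpartialV //; apply: smooth_diff Ux. Qed.

Lemma partial_sqrt : 0 < u x ->
  partial i (fun y => Num.sqrt (u y)) x = (2 * Num.sqrt (u x))^-1 * partial i u x.
Proof.
move=> u0; have ds : is_derive (u x) 1 Num.sqrt (2 * Num.sqrt (u x))^-1.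
  exact: is_derive1_sqrt.
have dsv : derivable Num.sqrt (u x) 1 by exact: (@ex_derive _ _ _ _ _ _ _ ds).
rewrite (dpartial_comp i (smooth_diff us Ux) dsv).2 derive1E.
by rewrite (@derive_val _ _ _ _ _ _ _ ds).
Qed.

End Rules.

Lemma partial_sum (I : Type) (r : seq I) (P : pred I) (F : I -> 'rV[R]_m -> R) i x :
  (forall k, P k -> smooth_on U (F k)) -> U x ->
  partial i (fun y => \sum_(k <- r | P k) F k y) x = \sum_(k <- r | P k) partial i (F k) x.
Proof.
move=> Fs Ux; elim: r => [|k r IH].
  rewrite (_ : (fun y => _) = fun _ : 'rV[R]_m => 0 : R) ?big_nil; first exact: partial_cst.
  by apply/funext => y; rewrite big_nil.
rewrite big_cons (_ : (fun y => _) = fun y => if P k then F k y + \sum_(k <- r | P k) F k y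
                               else \sum_(k <- r | P k) F k y); last first.
  by apply/funext => y; rewrite big_cons.
by case: (P k) (@Fs k) => // Fk; rewrite partialD ?IH //; [exact: Fk|exact: smooth_sum].
Qed.

End Open.

End SmoothOn.

(** * Pullback along maps that carry coordinate lines to coordinate lines or to points *)

Section Pullback.
Variables (R : realType) (m m' : nat).
Variables (A : 'rV[R]_m' -> 'rV[R]_m) (sigma : 'I_m' -> option 'I_m).
Hypothesis dA : forall z, differentiable A z.
Hypothesis AE : forall i h z, A (h *: delta_mx 0 i + z) =
  (if sigma i is Some j then h *: delta_mx 0 j else 0) + A z.

(** In direction [i] the map [A] moves at unit speed along direction [sigma i], or not at all, so
    the difference quotient of the pullback is one of [u], or zero. Projections, slices and
    translations are all of this kind. *)
Lemma partial_pullback u i z : partial i (fun z => u (A z)) z =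
  if sigma i is Some j then partial j u (A z) else 0.
Proof.
rewrite /partial /derive.
have -> : (fun h : R => h^-1 *: (((fun z => u (A z)) \o shift z)
   (h *: delta_mx 0 i) - u (A z))) = fun h : R => h^-1 *:
     (u ((if sigma i is Some j then h *: delta_mx 0 j else 0) + A z) - u (A z)).
  by apply/funext => h /=; rewrite /shift /= AE.
case: (sigma i) => [j //|].
apply/cvg_lim => //; apply: cvg_near_cst.
by near=> h; rewrite add0r subrr scaler0.
Unshelve. all: by end_near. Qed.

Lemma smooth_upto_pullback k U u : smooth_upto k U u -> smooth_upto k (A @^-1` U) (fun z => u (A z)).
Proof.
elim: k u => [|k IH] u.
  move=> /smooth_upto0 us; apply/smooth_upto0 => z Uz.
  exact: (differentiable_comp (dA z) (us _ Uz)).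
move=> /smooth_uptoS [us us']; apply/smooth_uptoS; split=> [z Uz|i].
  exact: (differentiable_comp (dA z) (us _ Uz)).
have -> : partial i (fun z => u (A z)) =
    fun z => if sigma i is Some j then partial j u (A z) else 0.
  by apply/funext => z; exact: partial_pullback.
by case: (sigma i) => [j|]; [exact: IH|exact: smooth_upto_cst].
Qed.

Lemma smooth_pullback U u :
  smooth_on U u -> smooth_on (A @^-1` U) (fun z => u (A z)).
Proof. by move=> /smooth_uptoP us; apply/smooth_uptoP => k; apply: smooth_upto_pullback. Qed.

End Pullback.

(** * Coordinates [(x, rho)] on the cylinder *)

Section Cylinder.
Variables (R : realType) (n : nat).
Implicit Types (z : 'rV[R]_(n + 1)) (y : 'rV[R]_n) (s : R).

Definition cpt y s : 'rV[R]_(n + 1) := row_mx y s%:M.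

Definition ix (i : 'I_n) : 'I_(n + 1) := lshift 1 i.
Definition irho : 'I_(n + 1) := rshift n ord0.

Lemma cyl_xE y s : cyl_x (cpt y s) = y.
Proof. exact: row_mxKl. Qed.

Lemma cyl_sE y s : cyl_s (cpt y s) = s.
Proof. by rewrite /cyl_s row_mxKr mxE eqxx. Qed.

Lemma cptE z : cpt (cyl_x z) (cyl_s z) = z.
Proof.
rewrite -[RHS]hsubmxK /cpt; congr row_mx.
by apply/matrixP => i j; rewrite !ord1 mxE eqxx.
Qed.

Lemma cyl_s_coord z : cyl_s z = z 0 irho.
Proof. by rewrite /cyl_s mxE. Qed.

Lemma delta_ix i : delta_mx 0 (ix i) = row_mx (delta_mx 0 i) 0 :> 'rV[R]_(n + 1).
Proof.
apply/matrixP => k j; rewrite ord1 {k}; case: (split_ordP j) => j' ->.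
  by rewrite row_mxEl !mxE eqxx /=; congr (nat_of_bool _)%:R; rewrite (inj_eq (@lshift_inj _ _)).
by rewrite row_mxEr !mxE eqxx /=; rewrite /ix eq_rlshift.
Qed.

Lemma delta_irho : delta_mx 0 irho = row_mx 0 1%:M :> 'rV[R]_(n + 1).
Proof.
apply/matrixP => k j; rewrite ord1 {k}; case: (split_ordP j) => j' ->.
  by rewrite row_mxEl !mxE eqxx /= /irho eq_lrshift.
by rewrite row_mxEr !ord1 !mxE !eqxx.
Qed.

Definition sig_x (i : 'I_(n + 1)) : option 'I_n :=
  if fintype.split i is inl j then Some j else None.

Lemma sig_ix i : sig_x (ix i) = Some i.
Proof. by rewrite /sig_x /ix -[lshift _ _]/(unsplit (inl i)) unsplitK. Qed.

Lemma sig_irho : sig_x irho = None.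
Proof. by rewrite /sig_x /irho -[rshift _ _]/(unsplit (inr ord0)) unsplitK. Qed.

Lemma cyl_x_affine i h z : cyl_x (h *: delta_mx 0 i + z) =
  (if sig_x i is Some j then h *: delta_mx 0 j else 0) + cyl_x z.
Proof.
rewrite /cyl_x raddfD /= linearZ /=; congr (_ + _).
case: (split_ordP i) => j ->.
  by rewrite -/(ix j) sig_ix delta_ix row_mxKl.
by rewrite ord1 -/irho sig_irho delta_irho row_mxKl scaler0.
Qed.

Lemma diff_cyl_x z : differentiable (@cyl_x R n) z.
Proof. exact: differentiable_lsubmx. Qed.

Lemma partial_cyl_x u i z :
  partial (ix i) (fun z => u (cyl_x z)) z = partial i u (cyl_x z).
Proof.
by rewrite (partial_pullback cyl_x_affine) sig_ix.
Qed.

Lemma partial_cyl_rho u z : partial irho (fun z => u (cyl_x z)) z = 0.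
Proof.
by rewrite (partial_pullback cyl_x_affine) sig_irho.
Qed.

Lemma smooth_cyl_x U u : smooth_on U u ->
  smooth_on (@cyl_x R n @^-1` U) (fun z => u (cyl_x z)).
Proof. exact: (smooth_pullback diff_cyl_x cyl_x_affine). Qed.

Lemma slice_affine s i h y : cpt (h *: delta_mx 0 i + y) s =
  h *: delta_mx 0 (ix i) + cpt y s.
Proof. by rewrite delta_ix scale_row_mx add_row_mx scaler0 add0r. Qed.

Lemma diff_slice s y : differentiable (fun y => cpt y s) y.
Proof.
have -> : (fun y => cpt y s) = fun y => row_mx y 0 + cpt 0 s.
  by apply/funext => y'; rewrite add_row_mx add0r addr0.
apply: differentiableD; last exact: differentiable_cst.
have @f : {linear 'rV[R]_n -> 'rV[R]_(n + 1)}.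
  exists (fun y => row_mx y 0).
  do 2![eexists]; do ?[constructor].
  - by rewrite row_mx0.
  - move=> u v; by rewrite add_row_mx addr0.
  - move=> a u; by rewrite scale_row_mx scaler0.
rewrite (_ : (fun _ => _) = f) //; apply/linear_differentiable => u A.
move=> /nbhs_ballP[e /= e0 eA].
apply/nbhs_ballP; exists e => //= v [_ uv]; apply: eA; split => // i j.
case: (split_ordP j) => j' ->; rewrite ?row_mxEl ?row_mxEr; first exact: uv.
exact: ballxx.
Qed.

Lemma is_derive_rho F y s : differentiable F (cpt y s) ->
  is_derive s 1 (fun s => F (cpt y s)) (partial irho F (cpt y s)).
Proof.
move=> dF.
have E : (fun h : R => h^-1 *: (((fun s => F (cpt y s)) \o shift s) (h *: 1) - F (cpt y s))) =
   fun h : R => h^-1 *: ((F \o shift (cpt y s)) (h *: delta_mx 0 irho) - F (cpt y s)).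
  apply/funext => h /=; congr (_ *: (F _ - _)).
  rewrite /shift /= /cpt delta_irho scale_row_mx add_row_mx scaler0 add0r.
  by rewrite scale_scalar_mx -raddfD.
split; rewrite /derivable /derive E //; exact: diff_derivable.
Qed.

Lemma partial_slice F s i y :
  partial i (fun y => F (cpt y s)) y = partial (ix i) F (cpt y s).
Proof.
by rewrite (partial_pullback (A := fun y => cpt y s) (sigma := fun i => Some (ix i)) (slice_affine s)).
Qed.

Lemma smooth_slice s U F : smooth_on U F ->
  smooth_on [set y | U (cpt y s)] (fun y => F (cpt y s)).
Proof.
exact: (smooth_pullback (A := fun y => cpt y s) (sigma := fun i => Some (ix i)) (diff_slice s) (slice_affine s)).
Qed.

End Cylinder.

(** * Symmetry of second partial derivatives *)

Section Schwarz.
Variables (R : realType) (m : nat).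
Implicit Types (U : set 'rV[R]_m) (u v : 'rV[R]_m -> R) (x : 'rV[R]_m).

Lemma normr_delta (i : 'I_m) : `|delta_mx 0 i : 'rV[R]_m| <= 1.
Proof.
rewrite [leLHS]/Num.Def.normr/= mx_normrE; apply: bigmax_le => // k _.
by rewrite mxE; case: (_ && _); rewrite ?normr1 ?normr0.
Qed.

Lemma is_derive_line u x (i : 'I_m) (a : R) :
  differentiable u (a *: delta_mx 0 i + x) ->
  is_derive a 1 (fun a => u (a *: delta_mx 0 i + x))
    (partial i u (a *: delta_mx 0 i + x)).
Proof.
move=> du; set z := a *: _ + x.
have E : (fun h : R => h^-1 *: (((fun a => u (a *: delta_mx 0 i + x)) \o shift a) (h *: 1)
     - u (a *: delta_mx 0 i + x))) =
   fun h : R => h^-1 *: ((u \o shift z) (h *: delta_mx 0 i) - u z).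
  apply/funext => h /=; congr (_ *: (u _ - _)).
  by rewrite /shift /= /z scalerDl addrA [h *: 1]mulr1.
split; rewrite /derivable /derive E //; exact: diff_derivable.
Qed.

Lemma mvt_line u x (i : 'I_m) (h : R) : 0 < h ->
  (forall a : R, 0 <= a <= h -> differentiable u (a *: delta_mx 0 i + x)) ->
  exists2 a : R, 0 < a < h & u (h *: delta_mx 0 i + x) - u x =
    h * partial i u (a *: delta_mx 0 i + x).
Proof.
move=> h0 du.
have H a : a \in `]0, h[%R -> is_derive a 1 (fun a => u (a *: delta_mx 0 i + x))
    (partial i u (a *: delta_mx 0 i + x)).
  by move=> /itvP ah; apply: is_derive_line; apply: du; rewrite !ah.
have [|a ah] := MVT h0 H.
  apply: derivable_within_continuous => a /itvP ah.
  by have := @is_derive_line u x i a; move=> /(_ (du a _)) [] //; rewrite !ah.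
rewrite scale0r add0r subr0 mulrC => E.
by exists a; rewrite // !(itvP ah).
Qed.

Lemma smooth_shift U u c : smooth_on U u ->
  smooth_on [set y | U (c + y)] (fun y => u (c + y)).
Proof.
apply: (@smooth_pullback _ _ _ (fun y => c + y) Some) => [z|i h z].
  exact: (differentiableD (differentiable_cst _ _)).
by rewrite addrCA.
Qed.

Lemma partial_shift u c i x : partial i (fun y => u (c + y)) x = partial i u (c + x).
Proof.
by rewrite (@partial_pullback _ _ _ (fun y => c + y) Some) // => j h z; rewrite addrCA.
Qed.

(** The mean value theorem is used in direction [i] on the increment of [u] by [h] in direction [j],
    then in direction [j] on [partial i u]. *)
Lemma second_difference U u x (i j : 'I_m) (h : R) : 0 < h -> smooth_on U u ->
  (forall a b : R, 0 <= a <= h -> 0 <= b <= h ->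
    U (b *: delta_mx 0 j + (a *: delta_mx 0 i + x))) ->
  exists a b : R, [/\ 0 < a < h, 0 < b < h &
   u (h *: delta_mx 0 j + (h *: delta_mx 0 i + x)) - u (h *: delta_mx 0 i + x)
   - (u (h *: delta_mx 0 j + x) - u x) =
    h * (h * partial j (partial i u) (b *: delta_mx 0 j + (a *: delta_mx 0 i + x)))].
Proof.
move=> h0 us HU.
have h00 : (0 : R) <= 0 <= h by rewrite lexx ltW.
have hh : 0 <= h <= h by rewrite lexx ltW.
pose c : 'rV[R]_m := h *: delta_mx 0 j.
have us' := smooth_shift (c := c) us.
have du (a : R) : 0 <= a <= h -> differentiable u (a *: delta_mx 0 i + x).
  by move=> ah; apply: smooth_diff us _; have := HU _ _ ah h00; rewrite scale0r add0r.
have duc (a : R) : 0 <= a <= h -> differentiable (fun y => u (c + y)) (a *: delta_mx 0 i + x).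
  by move=> ah; apply: smooth_diff us' _; exact: HU.
have [|a ah E] := @mvt_line (fun y => u (c + y) - u y) x i h h0.
  by move=> a ah; exact: (differentiableB (duc a ah) (du a ah)).
have ah' : 0 <= a <= h by case/andP: ah => *; rewrite !ltW.
have [|b bh E'] := @mvt_line (partial i u) (a *: delta_mx 0 i + x) j h h0.
  by move=> b bh; apply: smooth_diff (smooth_partial i us) _; exact: HU.
exists a, b; split=> //; rewrite -/c E.
by rewrite dpartialB ?partial_shift ?E' //; [exact: duc|exact: du].
Qed.

Lemma second_difference_inj (h a b c d p q : R) : h != 0 ->
  a - b - (c - d) = h * (h * p) -> a - c - (b - d) = h * (h * q) -> p = q.
Proof.
move=> hn E E'; apply: (mulfI hn); apply: (mulfI hn); rewrite -E -E'; ring.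
Qed.

Lemma dist_half (a b c e : R) : `|a - c| < e / 2 -> `|b - c| < e / 2 -> `|a - b| <= e.
Proof.
move=> ac bc; rewrite -(subrKA c) [leRHS]splitr.
by apply: le_trans (ler_normD _ _) _; apply: lerD; apply: ltW; rewrite // distrC.
Qed.

(** The second difference over a square of side [h] is symmetric in [i] and [j]. So the two mixed
    derivatives agree in value at two points of the square, and continuity brings both points to
    [x]. *)
Lemma schwarz U u x (i j : 'I_m) : open U -> smooth_on U u -> U x ->
  partial i (partial j u) x = partial j (partial i u) x.
Proof.
move=> oU us Ux; apply/eqP; rewrite -subr_eq0 -normr_le0.
apply/ler_addgt0Pr => e e0; rewrite add0r.
have cts k l : {for x, continuous (partial k (partial l u))}.
  apply: differentiable_continuous; apply: smooth_diff Ux.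
  by do 2 apply: smooth_partial.
have e2 : 0 < e / 2 by rewrite divr_gt0.
have C k l : \forall y \near x, `|partial k (partial l u) x - partial k (partial l u) y| < e / 2.
  by move/cvgrPdist_lt: (cts k l) => /(_ _ e2).
have UU : \forall y \near x, U y by exact: (open_nbhs_nbhs (conj oU Ux)).
have /nbhs_ballP [d /= d0 dH] : nbhs x [set y | U y /\
    (`|partial i (partial j u) x - partial i (partial j u) y| < e / 2 /\
     `|partial j (partial i u) x - partial j (partial i u) y| < e / 2)].
  exact: (filterI UU (filterI (C i j) (C j i))).
pose h := d / 3; have h0 : 0 < h by rewrite divr_gt0.
have B (k l : 'I_m) (a b : R) : 0 <= a <= h -> 0 <= b <= h ->
    ball x d (b *: delta_mx 0 k + (a *: delta_mx 0 l + x)).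
  move=> /andP[a0 ah] /andP[b0 bh].
  rewrite -ball_normE /= addrA opprD addrCA subrr addr0 normrN.
  apply: le_lt_trans (ler_normD _ _) _; rewrite !normrZ !ger0_norm //.
  apply: (@le_lt_trans _ _ (h + h)); last by rewrite /h; lra.
  apply: lerD; rewrite -[leRHS]mulr1; apply: ler_pM => //; exact: normr_delta.
have [|a [b [/andP[a0 ah] /andP[b0 bh] E]]] := @second_difference U u x i j h h0 us.
  by move=> a b ah bh; case: (dH _ (B j i _ _ ah bh)).
have [|a' [b' [/andP[a0' ah'] /andP[b0' bh'] E']]] := @second_difference U u x j i h h0 us.
  by move=> a1 b1 ah1 bh1; case: (dH _ (B i j _ _ ah1 bh1)).
move: E E'; set p := b *: _ + _; set q := b' *: _ + _ => E E'.
have ball_a (c : R) : 0 < c -> c < h -> 0 <= c <= h by move=> c0 ch; rewrite !ltW.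
have [_ [_ Hp]] := dH _ (B j i a b (ball_a a a0 ah) (ball_a b b0 bh)).
have [_ [Hq _]] := dH _ (B i j a' b' (ball_a a' a0' ah') (ball_a b' b0' bh')).
have pq : partial j (partial i u) p = partial i (partial j u) q.
  move: E'; rewrite (addrCA (h *: delta_mx 0 i)) => E'.
  exact: (second_difference_inj (lt0r_neq0 h0) E E').
move: Hp Hq; rewrite -/p -/q pq => Hp Hq.
exact: dist_half Hq Hp.
Qed.

End Schwarz.

(** * Determinants and Christoffel symbols *)

Section SmoothMatrix.
Variables (R : realType) (m k : nat) (U : set 'rV[R]_m).
Hypothesis oU : open U.

Lemma smooth_det p (G : 'rV[R]_m -> 'M[R]_p) :
  (forall i j, smooth_on U (fun y => G y i j)) -> smooth_on U (fun y => \det (G y)).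
Proof.
move=> Gs; rewrite /determinant; apply: smooth_sum => // s _.
apply: smoothM => //; first exact: smooth_cst.
by apply: smooth_prod.
Qed.

Variable G : 'rV[R]_m -> 'M[R]_k.
Hypothesis Gs : forall i j, smooth_on U (fun y => G y i j).

Lemma smooth_cofactor i j : smooth_on U (fun y => cofactor (G y) i j).
Proof.
rewrite /cofactor; apply: smoothM => //; first exact: smooth_cst.
apply: smooth_det => i' j'.
rewrite (_ : (fun y => _) = fun y => G y (lift i i') (lift j j')) //.
by apply/funext => y; rewrite !mxE.
Qed.

Lemma smooth_invmx i j : (forall x, U x -> G x \in unitmx) ->
  smooth_on U (fun y => invmx (G y) i j).
Proof.
move=> Gu; apply: (@smooth_on_ext _ _ U (fun y => (\det (G y))^-1 * cofactor (G y) j i)) => //.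
  by move=> y Uy; rewrite /invmx Gu // !mxE.
apply: smoothM => //; last exact: smooth_cofactor.
apply: smoothV => //; last exact: smooth_det.
by move=> x /Gu; rewrite unitmxE unitfE.
Qed.

Lemma partial_prod (I : eqType) (r : seq I) (F : I -> 'rV[R]_m -> R) l x : uniq r ->
  (forall i, smooth_on U (F i)) -> U x ->
  partial l (fun y => \prod_(i <- r) F i y) x =
  \sum_(i <- r) partial l (F i) x * \prod_(j <- r | j != i) F j x.
Proof.
move=> + Fs Ux; elim: r => [|i r IH].
  rewrite big_nil (_ : (fun y => _) = fun _ : 'rV[R]_m => 1 : R) ?partial_cst //.
  by apply/funext => y; rewrite big_nil.
move=> /= /andP[ir ur].
rewrite (_ : (fun y => _) = fun y => F i y * \prod_(i <- r) F i y); last first.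
  by apply/funext => y; rewrite big_cons.
rewrite (partialM _ _ _ Ux) //; last by apply: smooth_prod.
rewrite IH // big_cons; congr (_ * _ + _).
  rewrite big_cons eqxx /= [LHS]big_seq_cond [RHS]big_seq_cond; apply: eq_bigl => j.
  by rewrite andbT; have [jr|//] := boolP (j \in r); rewrite (memPn ir).
rewrite mulr_sumr [LHS]big_seq [RHS]big_seq; apply: eq_bigr => j jr.
by rewrite big_cons (eq_sym i) (memPn ir) // mulrCA.
Qed.

(** Jacobi's formula: the Leibniz expansion is differentiated one row at a time. *)
Lemma partial_det l x : U x -> G x \in unitmx ->
  partial l (fun y => \det (G y)) x =
  \det (G x) * \sum_i \sum_j invmx (G x) j i * partial l (fun y => G y i j) x.
Proof.
move=> Ux Gu.
transitivity (\sum_i \sum_j partial l (fun y => G y i j) x * cofactor (G x) i j).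
  rewrite /determinant (partial_sum oU _ _ _ Ux); last first.
    move=> s _; apply: smoothM => //; first exact: smooth_cst.
    exact: smooth_prod.
  (* [N i] is [G x] with row [i] replaced by its derivative; expansion along that row yields the
     cofactors of [G x]. *)
  pose N i := \matrix_(a, b) if a == i then partial l (fun y => G y i b) x else G x a b.
  transitivity (\sum_i \det (N i)).
    rewrite /determinant exchange_big /=; apply: eq_bigr => s _.
    rewrite (partialZ _ _ Ux); last exact: smooth_prod.
    rewrite (partial_prod _ _ _ Ux) ?index_enum_uniq // mulr_sumr; apply: eq_bigr => i _.
    congr (_ * _); rewrite [RHS](bigD1 i) //= mxE eqxx; congr (_ * _).
    by apply: eq_bigr => j /negPf ji; rewrite mxE ji.
  apply: eq_bigr => i _; rewrite (expand_det_row _ i); apply: eq_bigr => j _.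
  rewrite mxE eqxx /cofactor; congr (_ * (_ * \det _)).
  by apply/matrixP => a b; rewrite !mxE eq_sym (negPf (neq_lift _ _)).
rewrite mulr_sumr; apply: eq_bigr => i _; rewrite mulr_sumr; apply: eq_bigr => j _.
rewrite /invmx Gu !mxE mulrC !mulrA mulfV ?mul1r //.
by move: Gu; rewrite unitmxE unitfE.
Qed.

End SmoothMatrix.

Section Contraction.
Variables (R : realType) (m : nat) (G : 'rV[R]_m -> 'M[R]_m) (x : 'rV[R]_m).
Local Notation d l i j := (partial l (fun y => G y i j) x).
Local Notation A := (invmx (G x)).

(** Half the trace of [G^-1 d_l G], that is [d_l log sqrt |det G|]. *)
Definition tau (l : 'I_m) : R := 2^-1 * \sum_i \sum_j A i j * d l i j.

(** The contracted Christoffel symbol [G^ij Gamma^k_ij] with its index lowered. *)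
Definition bvec (l : 'I_m) : R := \sum_i \sum_j A i j * d i j l - tau l.

Lemma invmx_sym p (B : 'M[R]_p) : B^T = B -> (invmx B)^T = invmx B.
Proof. by move=> BT; rewrite trmx_inv BT. Qed.

Hypothesis AT : A^T = A.
Let As i j : A i j = A j i. Proof. by rewrite -[in LHS]AT mxE. Qed.

(** Only contracted Christoffel symbols enter, so for the ambient metric, whose inverse is sparse,
    no individual symbol has to be computed. *)
Lemma laplacianE u : laplacian G u x =
  \sum_i \sum_j A i j * partial i (partial j u) x
  - \sum_k \sum_l A k l * (bvec l * partial k u x).
Proof.
transitivity (\sum_i \sum_j A i j * partial i (partial j u) x
  - \sum_i \sum_j \sum_k A i j * (christoffel G k i j x * partial k u x)).
  rewrite -sumrB; apply: eq_bigr => i _; rewrite -sumrB; apply: eq_bigr => j _.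
  by rewrite mulrBr mulr_sumr.
congr (_ - _).
under eq_bigr => i _ do rewrite exchange_big /=.
rewrite exchange_big /=; apply: eq_bigr => k _.
transitivity ((\sum_l A k l * bvec l) * partial k u x); last first.
  by rewrite mulr_suml; apply: eq_bigr => l _; rewrite mulrA.
under eq_bigr => i _ do under eq_bigr => j _ do rewrite mulrA.
under eq_bigr => i _ do rewrite -mulr_suml.
rewrite -mulr_suml; congr (_ * _).
transitivity (\sum_l A k l * (2^-1 * \sum_i \sum_j A i j * (d i j l + d j i l - d l i j))).
  under eq_bigr => i _ do under eq_bigr => j _ do rewrite /christoffel mulrCA mulr_sumr mulr_sumr.
  under eq_bigr => i _ do rewrite exchange_big /=.
  rewrite exchange_big /=; apply: eq_bigr => l _.
  rewrite !mulr_sumr; apply: eq_bigr => i _; rewrite !mulr_sumr; apply: eq_bigr => j _.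
  by rewrite [RHS]mulrCA; congr (_ * _); rewrite mulrCA.
apply: eq_bigr => l _; congr (_ * _); rewrite /bvec /tau.
have -> : \sum_i \sum_j A i j * (d i j l + d j i l - d l i j) =
   (\sum_i \sum_j A i j * d i j l) + (\sum_i \sum_j A i j * d j i l) - \sum_i \sum_j A i j * d l i j.
  rewrite -big_split -sumrB; apply: eq_bigr => i _; rewrite -big_split -sumrB /=.
  by apply: eq_bigr => j _; rewrite mulrBr mulrDr.
have -> : \sum_i \sum_j A i j * d j i l = \sum_i \sum_j A i j * d i j l.
  by rewrite exchange_big /=; apply: eq_bigr => i _; apply: eq_bigr => j _; rewrite As.
by field.
Qed.

Hypothesis dT : forall l i j, d l i j = d l j i.

(** Two of the three terms are exchanged by transposition, with opposite signs, and cancel. *)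
Lemma christoffel_trace k : \sum_i christoffel G i i k x = tau k.
Proof.
rewrite /christoffel -mulr_sumr /tau; congr (_ * _).
transitivity (\sum_i \sum_j (A i j * d k i j) + (\sum_i \sum_j A i j * d i k j
   - \sum_i \sum_j A i j * d j i k)).
  rewrite -sumrB -big_split; apply: eq_bigr => i _; rewrite -sumrB -big_split /=.
  by apply: eq_bigr => j _; ring.
rewrite [X in _ + (_ - X)]exchange_big /=.
rewrite [X in _ + (_ - X)](_ : _ = \sum_i \sum_j A i j * d i k j) ?subrr ?addr0 //.
by apply: eq_bigr => i _; apply: eq_bigr => j _; rewrite As dT.
Qed.

Lemma divergenceE X : divergence G X x =
  \sum_i partial i (X i) x + \sum_k tau k * X k x.
Proof.
rewrite /divergence big_split /=; congr (_ + _).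
rewrite exchange_big /=; apply: eq_bigr => k _.
by rewrite -mulr_suml christoffel_trace.
Qed.

End Contraction.

(** * The ambient Laplacian *)

Section AmbientCoordinates.
Variables (R : realType) (n : nat).
Implicit Types (Z : 'rV[R]_(1 + (n + 1))) (F : 'rV[R]_(n + 1) -> R).

Definition it : 'I_(1 + (n + 1)) := lshift (n + 1) ord0.
Definition jx (i : 'I_n) : 'I_(1 + (n + 1)) := rshift 1 (ix i).
Definition jr : 'I_(1 + (n + 1)) := rshift 1 (irho n).

Lemma sum_amb (F : 'I_(1 + (n + 1)) -> R) :
  \sum_I F I = F it + (\sum_i F (jx i) + F jr).
Proof. by rewrite big_split_ord big_ord1 /= big_split_ord /= big_ord1. Qed.

Lemma sum_amb2 (F : 'I_(1 + (n + 1)) -> 'I_(1 + (n + 1)) -> R) :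
  \sum_I \sum_J F I J = (F it it + (\sum_i F it (jx i) + F it jr))
   + (\sum_i (F (jx i) it + (\sum_j F (jx i) (jx j) + F (jx i) jr))
   + (F jr it + (\sum_i F jr (jx i) + F jr jr))).
Proof.
rewrite sum_amb; congr (_ + (_ + _)); [exact: sum_amb | | exact: sum_amb].
by apply: eq_bigr => i _; exact: sum_amb.
Qed.

Definition apt (t : R) (z : 'rV[R]_(n + 1)) : 'rV[R]_(1 + (n + 1)) := row_mx t%:M z.

Lemma amb_tE t z : amb_t (apt t z) = t.
Proof. by rewrite /amb_t row_mxKl mxE eqxx. Qed.

Lemma amb_zE t z : rsubmx (apt t z) = z.
Proof. exact: row_mxKr. Qed.

Lemma aptE Z : apt (amb_t Z) (rsubmx Z) = Z.
Proof.
rewrite -[RHS]hsubmxK /apt; congr row_mx.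
by apply/matrixP => i j; rewrite !ord1 mxE eqxx.
Qed.

Lemma apt_t (t h : R) z : h *: delta_mx 0 it + apt t z = apt (h + t) z.
Proof.
rewrite /apt (_ : delta_mx 0 it = row_mx 1%:M 0).
  by rewrite scale_row_mx add_row_mx scaler0 add0r scale_scalar_mx mulr1 -raddfD.
apply/matrixP => k j; rewrite ord1 {k}; case: (split_ordP j) => j' ->.
  by rewrite row_mxEl !ord1 !mxE !eqxx.
by rewrite row_mxEr !mxE /it eq_rlshift andbF.
Qed.

Lemma apt_z (t h : R) z k : h *: delta_mx 0 (rshift 1 k) + apt t z = apt t (h *: delta_mx 0 k + z).
Proof.
rewrite /apt (_ : delta_mx 0 _ = row_mx 0 (delta_mx 0 k)).
  by rewrite scale_row_mx add_row_mx scaler0 add0r.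
apply/matrixP => i j; rewrite ord1 {i}; case: (split_ordP j) => j' ->.
  by rewrite row_mxEl !ord1 !mxE eq_lrshift andbF.
by rewrite row_mxEr !mxE (inj_eq (@rshift_inj _ _)).
Qed.

Variables (phi : R -> R) (dphi : R) (F : 'rV[R]_(n + 1) -> R) (t : R) (z : 'rV[R]_(n + 1)).

(** Entries of the ambient metric and homogeneous functions all have the form [phi t * F (x, rho)];
    this rule and the next one differentiate them one factor at a time. *)
Lemma partial_amb_t : is_derive t 1 phi dphi ->
  partial it (fun Z => phi (amb_t Z) * F (rsubmx Z)) (apt t z) = dphi * F z.
Proof.
move=> dp; rewrite /partial /derive.
have -> : (fun h : R => h^-1 *: (((fun Z => phi (amb_t Z) * F (rsubmx Z)) \o shift (apt t z))
   (h *: delta_mx 0 it) - phi (amb_t (apt t z)) * F (rsubmx (apt t z)))) = fun h : R => h^-1 *: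
     (((fun a => phi a * F z) \o shift t) (h *: 1) - phi t * F z).
  apply/funext => h; rewrite /= /shift /= apt_t !amb_tE !amb_zE.
  by rewrite [h *: 1]mulr1.
have dF : is_derive t 1 (fun a => phi a * F z) (F z * dphi).
  have := is_deriveM dp (is_derive_cst (F z) t 1).
  by rewrite scaler0 add0r.
by rewrite -[LHS]/('D_1 (fun a => phi a * F z) t) derive_val mulrC.
Qed.

Lemma partial_amb_z k : differentiable F z ->
  partial (rshift 1 k) (fun Z => phi (amb_t Z) * F (rsubmx Z)) (apt t z) = phi t * partial k F z.
Proof.
move=> dF; transitivity (partial k (fun z => phi t * F z) z).
  rewrite /partial /derive.
  have -> : (fun h : R => h^-1 *: (((fun Z => phi (amb_t Z) * F (rsubmx Z)) \o shift (apt t z))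
     (h *: delta_mx 0 (rshift 1 k)) - phi (amb_t (apt t z)) * F (rsubmx (apt t z)))) = fun h : R => h^-1 *:
     (((fun z => phi t * F z) \o shift z) (h *: delta_mx 0 k) - phi t * F z).
    by apply/funext => h; rewrite /= /shift /= apt_z !amb_tE !amb_zE.
  by [].
rewrite dpartialM //.
by rewrite partial_cst mul0r add0r.
Qed.

Lemma partial_ambE_t u : (forall Z, u Z = phi (amb_t Z) * F (rsubmx Z)) ->
  is_derive t 1 phi dphi -> partial it u (apt t z) = dphi * F z.
Proof. by move=> /funext ->; exact: partial_amb_t. Qed.

Lemma partial_ambE_z u k : (forall Z, u Z = phi (amb_t Z) * F (rsubmx Z)) ->
  differentiable F z -> partial (rshift 1 k) u (apt t z) = phi t * partial k F z.
Proof. by move=> /funext ->; exact: partial_amb_z. Qed.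

End AmbientCoordinates.
Arguments it {n}.
Arguments jr {n}.

(** * Inverse, contracted Christoffel symbols and Laplacian of the ambient metric *)

Section AmbientMetric.
Variables (R : realType) (n : nat) (gr : R -> 'rV[R]_n -> 'M[R]_n).
Variable (U : set 'rV[R]_(n + 1)).
Hypothesis oU : open U.
Definition cylG (z : 'rV[R]_(n + 1)) := gr (cyl_s z) (cyl_x z).
Hypothesis Gs : forall i j, smooth_on U (fun z => cylG z i j).
Hypothesis Gu : forall z, U z -> cylG z \in unitmx.
Hypothesis GT : forall z, U z -> (cylG z)^T = cylG z.

Local Notation amb := (ambient_metric gr).

Lemma ambE Z I J : amb Z I J =
  block_mx (2 * cyl_s (rsubmx Z))%:M (row_mx 0 (amb_t Z)%:M)
    (col_mx 0 (amb_t Z)%:M) (block_mx (amb_t Z ^+ 2 *: cylG (rsubmx Z)) 0 0 0) I J.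
Proof. by []. Qed.

(** The factors 1 in these entries exhibit each as a function of [t] times a function of [(x, rho)],
    the shape expected by [partial_ambE_t] and [partial_ambE_z]. *)
Lemma amb_tt Z : amb Z it it = 1 * (2 * cyl_s (rsubmx Z)).
Proof. by rewrite ambE block_mxEul !mxE eqxx mul1r. Qed.
Lemma amb_tr Z : amb Z it jr = amb_t Z * 1.
Proof. by rewrite ambE block_mxEur row_mxEr !mxE eqxx mulr1. Qed.
Lemma amb_rt Z : amb Z jr it = amb_t Z * 1.
Proof. by rewrite ambE block_mxEdl col_mxEd !mxE eqxx mulr1. Qed.
Lemma amb_rr Z : amb Z jr jr = 0.
Proof. by rewrite ambE block_mxEdr block_mxEdr mxE. Qed.
Lemma amb_tx Z i : amb Z it (jx i) = 0.
Proof. by rewrite ambE block_mxEur row_mxEl mxE. Qed.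
Lemma amb_xt Z i : amb Z (jx i) it = 0.
Proof. by rewrite ambE block_mxEdl col_mxEu mxE. Qed.
Lemma amb_xr Z i : amb Z (jx i) jr = 0.
Proof. by rewrite ambE block_mxEdr block_mxEur mxE. Qed.
Lemma amb_rx Z i : amb Z jr (jx i) = 0.
Proof. by rewrite ambE block_mxEdr block_mxEdl mxE. Qed.
Lemma amb_xx Z i j : amb Z (jx i) (jx j) = amb_t Z ^+ 2 * cylG (rsubmx Z) i j.
Proof. by rewrite ambE block_mxEdr block_mxEul mxE. Qed.

Section AtPoint.
Variables (t : R) (z : 'rV[R]_(n + 1)).
Hypotheses (t0 : 0 < t) (Uz : U z).
Local Notation B := (invmx (cylG z)).
Local Notation Z := (apt t z).

Lemma amb_inv : invmx (amb Z) =
  block_mx 0 (row_mx 0 (t^-1)%:M)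
    (col_mx 0 (t^-1)%:M) (block_mx (t ^- 2 *: B) 0 0 (- (2 * cyl_s z) * t ^- 2)%:M).
Proof.
have tn : t != 0 by rewrite gt_eqF.
set N := block_mx _ _ _ _.
have H : amb Z *m N = 1%:M.
  rewrite /ambient_metric -/(cylG _) amb_zE amb_tE /N.
  rewrite mulmx_block !mul_row_col !mulmx_block !mulmx0 !mul0mx !add0r !addr0.
  rewrite -!scalar_mxM !mul_scalar_mx !scale_row_mx !scaler0 add_row_mx addr0.
  rewrite mul_col_row mul_block_col add_block_mx !mul0mx !mulmx0 !addr0 !add0r.
  rewrite !scale_scalar_mx -raddfD /= -scalar_mxM -scalemxAl -scalemxAr scalerA mulmxV ?Gu //.
  rewrite !divff ?expf_neq0 // scale1r.
  have -> : 2 * amb_rho Z * t^-1 + t * (- (2 * cyl_s z) / t ^+ 2) = 0.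
    by rewrite /amb_rho amb_zE; field.
  by rewrite raddf0 row_mx0 col_mx0 -!scalar_mx_block.
have Au : amb Z \in unitmx by case: (mulmx1_unit H).
by rewrite -[N]mul1mx -(mulVmx Au) -mulmxA H mulmx1.
Qed.

(** The inverse metric has entries only in the [t rho], [rho t], [rho rho] and [x x] positions. As
    there is no [t t] entry, second derivatives in [t] never occur in the Laplacian. *)
Lemma amb_contract (f : 'I_(1 + (n + 1)) -> 'I_(1 + (n + 1)) -> R) :
  \sum_I \sum_J invmx (amb Z) I J * f I J =
  t^-1 * (f it jr + f jr it) - 2 * cyl_s z * t ^- 2 * f jr jr
  + t ^- 2 * \sum_i \sum_j B i j * f (jx i) (jx j).
Proof.
have Ett : invmx (amb Z) it it = 0 by rewrite amb_inv block_mxEul mxE.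
have Etr : invmx (amb Z) it jr = t^-1.
  by rewrite amb_inv block_mxEur row_mxEr !mxE eqxx.
have Ert : invmx (amb Z) jr it = t^-1.
  by rewrite amb_inv block_mxEdl col_mxEd !mxE eqxx.
have Err : invmx (amb Z) jr jr = - (2 * cyl_s z) * t ^- 2.
  by rewrite amb_inv block_mxEdr block_mxEdr mxE eqxx.
have Etx i : invmx (amb Z) it (jx i) = 0.
  by rewrite amb_inv block_mxEur row_mxEl mxE.
have Ext i : invmx (amb Z) (jx i) it = 0.
  by rewrite amb_inv block_mxEdl col_mxEu mxE.
have Exr i : invmx (amb Z) (jx i) jr = 0.
  by rewrite amb_inv block_mxEdr block_mxEur mxE.
have Erx i : invmx (amb Z) jr (jx i) = 0.
  by rewrite amb_inv block_mxEdr block_mxEdl mxE.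
have Exx i j : invmx (amb Z) (jx i) (jx j) = t ^- 2 * B i j.
  by rewrite amb_inv block_mxEdr block_mxEul mxE.
rewrite sum_amb2 Ett Etr Ert Err.
rewrite big1 => [|i _]; last by rewrite Etx mul0r.
rewrite [X in _ + (_ + (_ + (X + _)))]big1 => [|i _]; last by rewrite Erx mul0r.
have -> : \sum_i (invmx (amb Z) (jx i) it * f (jx i) it +
     (\sum_j invmx (amb Z) (jx i) (jx j) * f (jx i) (jx j) +
      invmx (amb Z) (jx i) jr * f (jx i) jr)) =
   t ^- 2 * \sum_i \sum_j B i j * f (jx i) (jx j).
  rewrite mulr_sumr; apply: eq_bigr => i _; rewrite Ext Exr !mul0r add0r addr0.
  by rewrite mulr_sumr; apply: eq_bigr => j _; rewrite Exx mulrA.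
ring.
Qed.

Lemma inv_amb_sym : (invmx (amb Z))^T = invmx (amb Z).
Proof.
apply: invmx_sym; rewrite /ambient_metric tr_block_mx tr_row_mx tr_col_mx tr_block_mx.
by rewrite !tr_scalar_mx !trmx0 linearZ /= -/(cylG _) amb_zE GT.
Qed.

Local Notation G := cylG.
(** [theta] is [d_rho log sqrt |det g_rho|]; [tauc] and [bvecc] are [tau] and [bvec] of [g_rho] at
    fixed [rho], written with derivatives on the cylinder. *)
Definition theta : R := 2^-1 * \sum_i \sum_j B i j * partial (irho n) (fun z => G z i j) z.
Definition tauc (l : 'I_n) : R :=
  2^-1 * \sum_i \sum_j B i j * partial (ix l) (fun z => G z i j) z.
Definition bvecc (l : 'I_n) : R :=
  \sum_i \sum_j B i j * partial (ix i) (fun z => G z j l) z - tauc l.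

Local Notation d L I J := (partial L (fun Z => amb Z I J) Z).

Lemma is_derive_sqr : is_derive t 1 (fun t => t ^+ 2) (2 * t).
Proof.
have H := is_deriveX 2 (is_derive_id t 1).
by apply: is_derive_eq H _; rewrite [LHS]mulr1 expr1.
Qed.

Let Gd i j : differentiable (fun z => G z i j) z.
Proof. exact: smooth_diff (Gs i j) Uz. Qed.

Lemma d_rr L : d L jr jr = 0.
Proof. by rewrite (_ : (fun Z => _) = fun=> 0) ?partial_cst //; apply/funext => ?; exact: amb_rr. Qed.
Lemma d_tx L i : d L it (jx i) = 0.
Proof. by rewrite (_ : (fun Z => _) = fun=> 0) ?partial_cst //; apply/funext => ?; exact: amb_tx. Qed.
Lemma d_rx L i : d L jr (jx i) = 0.
Proof. by rewrite (_ : (fun Z => _) = fun=> 0) ?partial_cst //; apply/funext => ?; exact: amb_rx. Qed.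
Lemma d_xr L i : d L (jx i) jr = 0.
Proof. by rewrite (_ : (fun Z => _) = fun=> 0) ?partial_cst //; apply/funext => ?; exact: amb_xr. Qed.
Lemma d_xt L i : d L (jx i) it = 0.
Proof. by rewrite (_ : (fun Z => _) = fun=> 0) ?partial_cst //; apply/funext => ?; exact: amb_xt. Qed.
Lemma d_t_tr : d it it jr = 1.
Proof.
by rewrite (partial_ambE_t (phi := id) (F := fun=> 1) (dphi := 1)) ?mulr1 //;
  move=> Z'; rewrite amb_tr.
Qed.
Lemma d_z_tr k : d (rshift 1 k) it jr = 0.
Proof.
rewrite (partial_ambE_z (phi := id) (F := fun=> 1)) ?partial_cst ?mulr0 //.
by move=> Z'; rewrite amb_tr.
Qed.
Lemma d_rt L : d L jr it = d L it jr.
Proof. by congr (partial _ _ _); apply/funext => Z; rewrite amb_rt amb_tr. Qed.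
Lemma partial_cyl_s k : partial k (@cyl_s R n) z = (k == irho n)%:R.
Proof.
rewrite (_ : @cyl_s R n = fun z => z 0 (irho n)) ?partial_coord //.
by apply/funext => y; exact: cyl_s_coord.
Qed.

Lemma diff_cyl_s : differentiable (@cyl_s R n) z.
Proof.
rewrite (_ : @cyl_s R n = fun z => z 0 (irho n)); first exact: differentiable_coord.
by apply/funext => y; exact: cyl_s_coord.
Qed.

Lemma d_z_tt k : d (rshift 1 k) it it = 2 * (k == irho n)%:R.
Proof.
have dc : differentiable (fun _ : 'rV[R]_(n + 1) => 2 : R) z by exact: differentiable_cst.
rewrite (partial_ambE_z (phi := fun=> 1) (F := fun z => 2 * cyl_s z)).
- by rewrite mul1r (dpartialM _ dc diff_cyl_s) partial_cst mul0r add0r partial_cyl_s.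
- by move=> Z'; rewrite amb_tt.
- exact: (differentiableM dc diff_cyl_s).
Qed.
Lemma d_t_xx i j : d it (jx i) (jx j) = 2 * t * G z i j.
Proof.
apply: (partial_ambE_t (phi := fun t => t ^+ 2) (F := fun z => G z i j)).
  by move=> Z'; rewrite amb_xx.
exact: is_derive_sqr.
Qed.
Lemma d_z_xx k i j : d (rshift 1 k) (jx i) (jx j) = t ^+ 2 * partial k (fun z => G z i j) z.
Proof.
rewrite (partial_ambE_z (phi := fun t => t ^+ 2) (F := fun z => G z i j)) //.
by move=> Z'; rewrite amb_xx.
Qed.

Let tn : t != 0. Proof. by rewrite gt_eqF. Qed.

Lemma tau_r : tau amb Z jr = theta.
Proof.
rewrite /tau amb_contract d_rt d_rr d_z_tr.
under eq_bigr => i _ do under eq_bigr => j _ do rewrite d_z_xx mulrCA.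
under eq_bigr => i _ do rewrite -mulr_sumr.
rewrite -mulr_sumr /theta; set S := \sum_i _; by field.
Qed.

Lemma tau_x l : tau amb Z (jx l) = tauc l.
Proof.
rewrite /tau amb_contract d_rt d_rr d_z_tr.
under eq_bigr => i _ do under eq_bigr => j _ do rewrite d_z_xx mulrCA.
under eq_bigr => i _ do rewrite -mulr_sumr.
rewrite -mulr_sumr /tauc; set S := \sum_i _; by field.
Qed.

Lemma tau_t : tau amb Z it = (n%:R + 1) * t^-1.
Proof.
rewrite /tau amb_contract d_rt d_rr d_t_tr.
have -> : \sum_i \sum_j B i j * d it (jx i) (jx j) = 2 * t * n%:R.
  have -> : n%:R = \sum_i (B *m G z) i i.
    rewrite mulVmx ?Gu // (eq_bigr (fun=> 1)) => [|i _]; last by rewrite mxE eqxx.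
    by rewrite sumr_const card_ord.
  rewrite mulr_sumr; apply: eq_bigr => i _; rewrite mxE mulr_sumr; apply: eq_bigr => j _.
  rewrite d_t_xx mulrCA; congr (_ * (_ * _)); by rewrite -[in LHS](GT Uz) mxE.
by field.
Qed.

Lemma bvec_r : bvec amb Z jr = - theta.
Proof.
rewrite /bvec tau_r amb_contract d_rr d_z_tr d_rr.
rewrite big1 => [|i _]; last by rewrite big1 // => j _; rewrite d_xr mulr0.
by ring.
Qed.

Lemma bvec_x l : bvec amb Z (jx l) = bvecc l.
Proof.
rewrite /bvec tau_x amb_contract d_rx d_tx d_rx.
under eq_bigr => i _ do under eq_bigr => j _ do rewrite d_z_xx mulrCA.
under eq_bigr => i _ do rewrite -mulr_sumr.
rewrite -mulr_sumr /bvecc; set S := \sum_i _; by field.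
Qed.

Lemma bvec_t : bvec amb Z it = (2 - n%:R) * t^-1.
Proof.
rewrite /bvec tau_t amb_contract d_rt d_t_tr d_z_tt d_rt d_z_tr eqxx.
rewrite big1 => [|i _]; last by rewrite big1 // => j _; rewrite d_xt mulr0.
by rewrite /=; field.
Qed.

End AtPoint.

(** What the ambient Laplacian induces on [F] when it acts on [t^gam F]; the last two sums are the
    Laplacian of [g_rho] at fixed [rho]. *)
Definition LapC (gam : R) (F : 'rV[R]_(n + 1) -> R) (z : 'rV[R]_(n + 1)) : R :=
  - (2 * cyl_s z) * partial (irho n) (partial (irho n) F) z
  + (2 * gam + n%:R - 2 - 2 * cyl_s z * theta z) * partial (irho n) F z
  + gam * theta z * F z
  + (\sum_i \sum_j invmx (cylG z) i j * partial (ix i) (partial (ix j) F) z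
     - \sum_k \sum_l invmx (cylG z) k l * (bvecc z l * partial (ix k) F z)).

Definition ambdom : set 'rV[R]_(1 + (n + 1)) :=
  [set Z | 0 < amb_t Z /\ U (rsubmx Z)].

Lemma open_ambdom : open ambdom.
Proof.
rewrite (_ : ambdom = (fun Z : 'rV[R]_(1 + (n + 1)) => Z 0 it) @^-1` [set t : R | 0 < t] `&` rsubmx @^-1` U).
  apply: openI.
    by apply: open_comp (@open_gt R 0) => Z _; exact: coord_continuous.
  by apply: open_comp oU => Z _; exact: continuous_rsubmx.
by apply/seteqP; split=> Z /=; rewrite /ambdom /= /amb_t mxE.
Qed.

Lemma is_derive_powR (a t : R) : 0 < t ->
  is_derive t 1 (fun t => t `^ a) (a * t `^ (a - 1)).
Proof. exact: is_derive1_powR. Qed.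

Lemma amb_laplacian_alg (gam p s th n' a1 a2 a3 S1 S2 t : R) : t != 0 ->
  t^-1 * (gam * (p * t^-1) * a2 + gam * (p * t^-1) * a2)
  - 2 * s * t ^- 2 * (p * a1) + t ^- 2 * (p * S1)
  - (t^-1 * (- th * (gam * (p * t^-1) * a3) + (2 - n') * t^-1 * (p * a2))
     - 2 * s * t ^- 2 * (- th * (p * a2)) + t ^- 2 * (p * S2)) =
  p * t ^- 2 * (- (2 * s) * a1 + (2 * gam + n' - 2 - 2 * s * th) * a2
     + gam * th * a3 + (S1 - S2)).
Proof. by move=> tn; field. Qed.

Lemma amb_laplacian (gam : R) (F : 'rV[R]_(n + 1) -> R) Z : smooth_on U F -> ambdom Z ->
  laplacian amb (fun Z => amb_t Z `^ gam * F (rsubmx Z)) Z =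
  amb_t Z `^ (gam - 2) * LapC gam F (rsubmx Z).
Proof.
move=> Fs; rewrite -(aptE Z); set t := amb_t Z; set z := rsubmx Z => -[].
rewrite amb_tE amb_zE => t0 Uz.
have tn : t != 0 by rewrite gt_eqF.
set u := fun Z => _.
(* The first derivatives are computed on the whole open set [ambdom], so that the formulas can be
   differentiated again. *)
have dt Z' : ambdom Z' -> partial it u Z' = (gam * amb_t Z' `^ (gam - 1)) * F (rsubmx Z').
  move=> [t0' _]; rewrite -{1}(aptE Z').
  by apply: (partial_ambE_t (phi := fun t => t `^ gam) (F := F)) => //; exact: is_derive_powR.
have dz k Z' : ambdom Z' -> partial (rshift 1 k) u Z' = amb_t Z' `^ gam * partial k F (rsubmx Z').
  move=> [_ Uz']; rewrite -{1}(aptE Z').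
  by apply: (partial_ambE_z (phi := fun t => t `^ gam) (F := F)) => //; exact: smooth_diff Fs _.
have Oz : ambdom (apt t z) by rewrite /ambdom /= amb_tE amb_zE.
have dtz k : partial it (partial (rshift 1 k) u) (apt t z) = gam * t `^ (gam - 1) * partial k F z.
  rewrite (partial_ext _ open_ambdom (@dz k) Oz).
  by apply: (partial_ambE_t (phi := fun t => t `^ gam) (F := partial k F)) => //; exact: is_derive_powR.
have dzt k : partial (rshift 1 k) (partial it u) (apt t z) = gam * t `^ (gam - 1) * partial k F z.
  rewrite (partial_ext _ open_ambdom dt Oz).
  apply: (partial_ambE_z (phi := fun t => gam * t `^ (gam - 1)) (F := F)) => //; exact: smooth_diff Fs _.
have dzz k l : partial (rshift 1 k) (partial (rshift 1 l) u) (apt t z) =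
    t `^ gam * partial k (partial l F) z.
  rewrite (partial_ext _ open_ambdom (@dz l) Oz).
  apply: (partial_ambE_z (phi := fun t => t `^ gam) (F := partial l F)) => //.
  exact: smooth_diff (smooth_partial l Fs) _.
rewrite laplacianE; last exact: inv_amb_sym.
rewrite !amb_contract // dtz dzt dzz (dt _ Oz) (dz _ _ Oz) amb_tE amb_zE bvec_t // bvec_r //.
under eq_bigr => i _ do under eq_bigr => j _ do rewrite dzz mulrCA.
under eq_bigr => i _ do rewrite -mulr_sumr.
rewrite -mulr_sumr.
have -> : \sum_i \sum_j invmx (cylG z) i j *
      (bvec amb (apt t z) (jx j) * partial (rshift 1 (ix i)) u (apt t z)) =
    t `^ gam * \sum_i \sum_j invmx (cylG z) i j * (bvecc z j * partial (ix i) F z).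
  rewrite mulr_sumr; apply: eq_bigr => i _; rewrite mulr_sumr; apply: eq_bigr => j _.
  rewrite bvec_x // (dz _ _ Oz) amb_tE amb_zE [RHS]mulrCA; congr (_ * _).
  by rewrite mulrCA.
have -> : t `^ (gam - 1) = t `^ gam * t^-1.
  by rewrite powRD ?powR_inv1 ?ltW ?tn ?implybT.
have -> : t `^ (gam - 2) = t `^ gam * t ^- 2.
  by rewrite powRD ?tn ?implybT // powRN powR_mulrn ?ltW.
rewrite /LapC.
exact: (amb_laplacian_alg gam _ (cyl_s z) (theta z) n%:R (partial (irho n) (partial (irho n) F) z)
  (partial (irho n) F z) (F z) _ _ tn).
Qed.

Lemma laplacian_ext m (G : 'rV[R]_m -> 'M[R]_m) O u v x : open O ->
  (forall y, O y -> u y = v y) -> O x -> laplacian G u x = laplacian G v x.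
Proof.
move=> oO uv Ox.
have E1 k : partial k u x = partial k v x := partial_ext k oO uv Ox.
have E2 i j : partial i (partial j u) x = partial i (partial j v) x.
  apply: (@partial_ext _ _ O (partial j u) (partial j v) i x oO _ Ox) => y Oy.
  exact: (partial_ext j oO uv Oy).
rewrite /laplacian; apply: eq_bigr => i _; apply: eq_bigr => j _.
rewrite E2; congr (_ * (_ - _)).
by apply: eq_bigr => k _; rewrite E1.
Qed.

End AmbientMetric.

Opaque partial.

(** * Conjugation by the fourth root of the volume ratio *)

(** A square root halves the logarithmic derivative; it is used twice for the fourth root. *)
Lemma partial_sqrt_log (R : realType) m (U : set 'rV[R]_m) u x i c :
  smooth_on U u -> U x -> 0 < u x -> partial i u x = u x * c ->
  partial i (fun y => Num.sqrt (u y)) x = Num.sqrt (u x) * (c / 2).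
Proof.
move=> us Ux u0 du; rewrite (partial_sqrt _ us Ux u0) du.
have s0 : Num.sqrt (u x) != 0 by rewrite gt_eqF // sqrtr_gt0.
by rewrite -{2}(sqr_sqrtr (ltW u0)); field.
Qed.

Section CylinderDomain.
Variables (R : realType) (n : nat) (U0 : set 'rV[R]_n) (eps : R).
Definition cyldom : set 'rV[R]_(n + 1) :=
  [set z | U0 (cyl_x z) /\ - eps < cyl_s z < eps].

Lemma open_cyldom : open U0 -> open cyldom.
Proof.
move=> oU0.
rewrite (_ : cyldom = @cyl_x R n @^-1` U0 `&`
   (fun z : 'rV[R]_(n + 1) => z 0 (irho n)) @^-1` [set s : R | - eps < s < eps]).
  apply: openI; first by apply: open_comp oU0 => z _; exact: continuous_lsubmx.
  apply: open_comp => [z _|]; first exact: coord_continuous.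
  rewrite (_ : [set s | _] = [set s : R | - eps < s] `&` [set s : R | s < eps]).
    by apply: openI; [exact: open_gt|exact: open_lt].
  by apply/seteqP; split=> s /= => [/andP|[-> ->]].
by apply/seteqP; split=> z; rewrite /cyldom /= cyl_s_coord.
Qed.
Lemma cyldom0 y : 0 < eps -> U0 y -> cyldom (cpt y 0).
Proof. by move=> eps0 Uy; rewrite /cyldom /= cyl_xE cyl_sE oppr_lt0 eps0. Qed.

End CylinderDomain.

(** What the analysis in one chart uses about [g_rho]. Positivity of the determinant ratio, a
    consequence of the common signature, makes its fourth root smooth. *)
Record regular_family (R : realType) (n : nat) (gr : R -> 'rV[R]_n -> 'M[R]_n)
    (g : 'rV[R]_n -> 'M[R]_n) (U0 : set 'rV[R]_n) (eps : R) : Prop := RegularFamily {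
  rf_open : open U0;
  rf_eps : 0 < eps;
  rf_smooth : forall i j, smooth_on (cyldom U0 eps) (fun z => cylG gr z i j);
  rf_unit : forall z, cyldom U0 eps z -> cylG gr z \in unitmx;
  rf_sym : forall z, cyldom U0 eps z -> (cylG gr z)^T = cylG gr z;
  rf_init : forall y, U0 y -> gr 0 y = g y;
  rf_det : forall z, cyldom U0 eps z -> 0 < \det (cylG gr z) / \det (g (cyl_x z));
  rf_smooth0 : forall i j, smooth_on U0 (fun y => g y i j) }.

Section Conjugation.
Variables (R : realType) (n : nat) (gr : R -> 'rV[R]_n -> 'M[R]_n).
Variables (g : 'rV[R]_n -> 'M[R]_n) (U0 : set 'rV[R]_n) (eps : R).
Hypothesis reg : regular_family gr g U0 eps.
Local Notation U := (cyldom U0 eps).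
Local Notation G := (cylG gr).
Local Notation dx i := (partial (ix i)).
Local Notation dr := (partial (irho n)).
Local Notation B z := (invmx (G z)).
Let oU0 := rf_open reg.
Let eps0 := rf_eps reg.
Let Gs := rf_smooth reg.
Let Gu := rf_unit reg.
Let GT := rf_sym reg.
Let gE := rf_init reg.
Let detpos := rf_det reg.
Let gs := rf_smooth0 reg.
Let oU : open U := @open_cyldom _ _ _ eps oU0.

Lemma cylG0 y : G (cpt y 0) = gr 0 y.
Proof. by rewrite /cylG cyl_xE cyl_sE. Qed.

Lemma gu y : U0 y -> g y \in unitmx.
Proof. by move=> Uy; rewrite -gE // -cylG0 Gu //; exact: cyldom0. Qed.

Lemma gT y : U0 y -> (g y)^T = g y.
Proof. by move=> Uy; rewrite -gE // -cylG0 GT //; exact: cyldom0. Qed.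

Lemma smooth_pull u : smooth_on U0 u -> smooth_on U (fun z => u (cyl_x z)).
Proof. by move=> /smooth_cyl_x us; apply: smooth_on_sub us => z []. Qed.

(** The [w] of the overview: [Wfun] as a function of [(x, rho)]. *)
Definition Wcyl (z : 'rV[R]_(n + 1)) : R :=
  Num.sqrt (Num.sqrt (\det (G z) / \det (g (cyl_x z)))).

Lemma smooth_detG : smooth_on U (fun z => \det (G z)).
Proof. exact: (@smooth_det _ _ U oU). Qed.

Lemma smooth_detg : smooth_on U (fun z => \det (g (cyl_x z))).
Proof.
apply: (@smooth_pull (fun y => \det (g y))).
exact: (@smooth_det _ _ U0 oU0).
Qed.

Lemma detg0 z : U z -> \det (g (cyl_x z)) != 0.
Proof. by case=> Uz _; move: (gu Uz); rewrite unitmxE unitfE. Qed.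

Lemma smooth_v : smooth_on U (fun z => \det (G z) / \det (g (cyl_x z))).
Proof.
apply: (smoothM oU smooth_detG); apply: (smoothV oU _ smooth_detg).
exact: detg0.
Qed.

Lemma smooth_Wcyl : smooth_on U Wcyl.
Proof.
apply: (smooth_sqrt oU) => [z Uz|]; first by rewrite sqrtr_gt0 detpos.
by apply: (smooth_sqrt oU detpos); exact: smooth_v.
Qed.

Lemma Wcyl_gt0 z : U z -> 0 < Wcyl z.
Proof. by move=> Uz; rewrite /Wcyl !sqrtr_gt0 detpos. Qed.

Lemma Wcyl_neq0 z : U z -> Wcyl z != 0.
Proof. by move=> /Wcyl_gt0 /gt_eqF ->. Qed.

Lemma w0 y : U0 y -> Wcyl (cpt y 0) = 1.
Proof.
move=> Uy; have := detg0 (cyldom0 eps0 Uy).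
by rewrite /Wcyl cylG0 cyl_xE gE // => d0; rewrite divff // !sqrtr1.
Qed.

Lemma smooth_Wcyl_inv : smooth_on U (fun z => (Wcyl z)^-1).
Proof. by apply: (smoothV oU _ smooth_Wcyl); exact: Wcyl_neq0. Qed.

Lemma smooth_B i j : smooth_on U (fun z => B z i j).
Proof. exact: (smooth_invmx oU). Qed.

Lemma B_sym z i j : U z -> B z i j = B z j i.
Proof. by move=> Uz; rewrite -[in LHS](invmx_sym (GT Uz)) mxE. Qed.

Lemma partial_Wcyl k c c0 z : U z ->
  partial k (fun z => \det (G z)) z = \det (G z) * c ->
  partial k (fun z => \det (g (cyl_x z))) z = \det (g (cyl_x z)) * c0 ->
  partial k Wcyl z = Wcyl z * ((c - c0) / 2 / 2).
Proof.
move=> Uz dc dc0.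
have sv := smooth_v.
apply: (@partial_sqrt_log _ _ U _ _ _ _ (smooth_sqrt oU detpos sv) Uz).
  by rewrite sqrtr_gt0 detpos.
apply: (@partial_sqrt_log _ _ U _ _ _ _ sv Uz); first exact: detpos.
have si : smooth_on U (fun z => (\det (g (cyl_x z)))^-1).
  by apply: (smoothV oU _ smooth_detg); exact: detg0.
rewrite (partialM _ smooth_detG si Uz) (partialV _ smooth_detg Uz (detg0 Uz)) dc dc0.
have := detg0 Uz; set a := \det _; set b := \det _ => b0; by field.
Qed.

Definition tau0 (z : 'rV[R]_(n + 1)) l : R := tau g (cyl_x z) l.

Lemma smooth_tau0 l : smooth_on U (fun z => tau0 z l).
Proof.
apply: (@smooth_pull (fun y => tau g y l)); rewrite /tau.
apply: (smoothM oU0); first exact: smooth_cst.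
apply: (smooth_sum oU0) => i _; apply: (smooth_sum oU0) => j _.
apply: (smoothM oU0); last by apply: smooth_partial.
apply: (smooth_invmx oU0) => //; exact: gu.
Qed.

Lemma dr_Wcyl z : U z -> dr Wcyl z = Wcyl z * (theta gr z / 2).
Proof.
move=> Uz; rewrite (@partial_Wcyl _ (theta gr z * 2) 0) //; first by congr (_ * _); field.
  rewrite (partial_det oU) //; last exact: Gu.
  congr (_ * _); rewrite /theta mulrC mulrA mulfV ?mul1r ?pnatr_eq0 //.
  rewrite exchange_big /=; apply: eq_bigr => i _; apply: eq_bigr => j _.
  congr (_ * _); apply: (partial_ext _ oU _ Uz) => y Uy.
  by rewrite -[in LHS](GT Uy) mxE.
by rewrite (partial_cyl_rho (fun y => \det (g y))) mulr0.
Qed.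

Lemma dx_Wcyl z l : U z -> dx l Wcyl z = Wcyl z * ((tauc gr z l - tau0 z l) / 2).
Proof.
move=> Uz; rewrite (@partial_Wcyl _ (tauc gr z l * 2) (tau0 z l * 2)) //; first by congr (_ * _); field.
  rewrite (partial_det oU) //; last exact: Gu.
  congr (_ * _); rewrite /tauc mulrC mulrA mulfV ?mul1r ?pnatr_eq0 //.
  rewrite exchange_big /=; apply: eq_bigr => i _; apply: eq_bigr => j _.
  congr (_ * _); apply: (partial_ext _ oU _ Uz) => y Uy.
  by rewrite -[in LHS](GT Uy) mxE.
rewrite (partial_cyl_x (fun y => \det (g y))).
have Uz0 : U0 (cyl_x z) by case: Uz.
rewrite (partial_det oU0) //; last exact: gu.
congr (_ * _); rewrite /tau0 /tau mulrC mulrA mulfV ?mul1r ?pnatr_eq0 //.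
rewrite exchange_big /=; apply: eq_bigr => i _; apply: eq_bigr => j _.
congr (_ * _); apply: (partial_ext _ oU0 _ Uz0) => y Uy.
by rewrite -[in LHS](gT Uy) mxE.
Qed.

Definition grad H i (z : 'rV[R]_(n + 1)) : R := \sum_j B z i j * dx j H z.

(** This is [delta (g_rho^-1 d)]: the gradient belongs to [g_rho], the divergence to the fixed
    metric [g], whence [tau0] and not [tauc]. *)
Definition Lop H (z : 'rV[R]_(n + 1)) : R :=
  \sum_i dx i (grad H i) z + \sum_k tau0 z k * grad H k z.

Ltac gen_atoms := repeat match goal with
  | |- context [grad ?H ?i ?z] => generalize (grad H i z); intro
  | |- context [partial ?i ?u ?z] => generalize (partial i u z); intro
  | |- context [tau0 ?z ?k] => generalize (tau0 z k); intro
  | |- context [tauc ?gr ?z ?k] => generalize (tauc gr z k); intro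
  | |- context [invmx ?M ?i ?j] => generalize (invmx M i j); intro
  end.

Definition grad_pair H K z : R := \sum_i dx i H z * grad K i z.

Lemma smooth_grad H i : smooth_on U H -> smooth_on U (grad H i).
Proof.
move=> Hs; apply: (smooth_sum oU) => j _; apply: (smoothM oU); first exact: smooth_B.
exact: smooth_partial.
Qed.

Lemma smooth_Lop H : smooth_on U H -> smooth_on U (Lop H).
Proof.
move=> Hs; apply: (smoothD oU); apply: (smooth_sum oU) => i _.
  by apply: smooth_partial; exact: smooth_grad.
by apply: (smoothM oU); [exact: smooth_tau0|exact: smooth_grad].
Qed.

Lemma grad_pairC H K z : U z -> grad_pair H K z = grad_pair K H z.
Proof.
move=> Uz; rewrite /grad_pair /grad.
under eq_bigr => i _ do rewrite mulr_sumr.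
under [RHS]eq_bigr => i _ do rewrite mulr_sumr.
rewrite exchange_big /=; apply: eq_bigr => i _; apply: eq_bigr => j _.
by rewrite (B_sym _ _ Uz); gen_atoms; ring.
Qed.

Lemma gradM H K i z : smooth_on U H -> smooth_on U K -> U z ->
  grad (fun z => H z * K z) i z = grad H i z * K z + H z * grad K i z.
Proof.
move=> Hs Ks Uz; rewrite /grad mulr_suml mulr_sumr -big_split; apply: eq_bigr => j _ /=.
by rewrite (partialM _ Hs Ks Uz); gen_atoms; ring.
Qed.

Lemma sum_lin2 (a b : 'I_n -> R) x y :
  \sum_i (x * a i + y * b i) = x * (\sum_i a i) + y * (\sum_i b i).
Proof. by rewrite big_split /= !mulr_sumr. Qed.

Lemma sum_lin4 (a b c d : 'I_n -> R) x y :
  \sum_i (x * a i + y * b i + (c i + d i)) =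
  x * (\sum_i a i) + y * (\sum_i b i) + ((\sum_i c i) + \sum_i d i).
Proof. by rewrite big_split /= sum_lin2 big_split. Qed.

Lemma LopM_alg (x y a b c d e f : R) : c = d ->
  x * a + y * b + (c + d) + (x * e + y * f) = y * (b + f) + x * (a + e) + 2 * d.
Proof. by move=> ->; ring. Qed.

Lemma oppB_congr (a b c d : R) : a = c -> b = d -> - a - b = - c - d.
Proof. by move=> -> ->. Qed.

Lemma sum_oppB (a b : 'I_n -> R) :
  \sum_i (- a i - b i) = - (\sum_i a i) - (\sum_i b i).
Proof. by rewrite sumrB sumrN. Qed.

(** [Lop] is of second order without zeroth-order term, so its Leibniz defect is twice the pairing
    of the two differentials. *)
Lemma LopM H K z : smooth_on U H -> smooth_on U K -> U z ->
  Lop (fun z => H z * K z) z = H z * Lop K z + K z * Lop H z + 2 * grad_pair H K z.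
Proof.
move=> Hs Ks Uz; rewrite /Lop.
transitivity (\sum_i (dx i (grad H i) z * K z + grad H i z * dx i K z
   + (dx i H z * grad K i z + H z * dx i (grad K i) z))
   + \sum_k tau0 z k * (grad H k z * K z + H z * grad K k z)).
  congr (_ + _); last by apply: eq_bigr => k _; rewrite gradM.
  apply: eq_bigr => i _; rewrite (partial_ext _ oU (fun y Uy => gradM i Hs Ks Uy) Uz).
  have gH := smooth_grad i Hs; have gK := smooth_grad i Ks.
  by rewrite (partialD _ (smoothM oU gH Ks) (smoothM oU Hs gK) Uz) !(partialM _ _ _ Uz).
transitivity (\sum_i (K z * dx i (grad H i) z + H z * dx i (grad K i) z
   + (dx i K z * grad H i z + dx i H z * grad K i z))
   + \sum_k (K z * (tau0 z k * grad H k z) + H z * (tau0 z k * grad K k z))).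
  by congr (_ + _); apply: eq_bigr => i _; gen_atoms; ring.
rewrite (sum_lin4 (fun i => dx i (grad H i) z) (fun i => dx i (grad K i) z)
  (fun i => dx i K z * grad H i z) (fun i => dx i H z * grad K i z)).
rewrite (sum_lin2 (fun k => tau0 z k * grad H k z) (fun k => tau0 z k * grad K k z)).
exact: LopM_alg (grad_pairC K H Uz).
Qed.

Lemma dG_B i j k z : U z ->
  \sum_l dx i (fun z => G z j l) z * B z l k = - \sum_l G z j l * dx i (fun z => B z l k) z.
Proof.
move=> Uz; apply/eqP; rewrite -addr_eq0 -big_split /=; apply/eqP.
transitivity (dx i (fun z => \sum_l G z j l * B z l k) z).
  rewrite (partial_sum oU _ _ _ Uz) => [|l _].
    by apply: eq_bigr => l _; rewrite (partialM _ (Gs _ _) (smooth_B _ _) Uz).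
  by apply: (smoothM oU); [exact: Gs|exact: smooth_B].
rewrite (partial_ext (v := fun=> (j == k)%:R) _ oU _ Uz) ?partial_cst // => y Uy.
transitivity ((G y *m B y) j k); first by rewrite mxE.
by rewrite mulmxV ?Gu // mxE.
Qed.

(** The classical [g^ij Gamma^k_ij = - d_i g^ik - g^kl tau_l], obtained by differentiating
    [G B = 1]; it brings the Laplacian of [g_rho] into divergence form. *)
Lemma contracted_bvec k z : U z ->
  \sum_l B z k l * bvecc gr z l =
  - \sum_i dx i (fun z => B z i k) z - \sum_l B z k l * tauc gr z l.
Proof.
move=> Uz; rewrite /bvecc.
under eq_bigr => l _ do rewrite mulrBr.
rewrite sumrB; congr (_ - _).
transitivity (\sum_i \sum_j B z i j * \sum_l dx i (fun z => G z j l) z * B z l k).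
  under eq_bigr => l _ do rewrite mulr_sumr.
  rewrite exchange_big /=; apply: eq_bigr => i _.
  under eq_bigr => l _ do rewrite mulr_sumr.
  rewrite exchange_big /=; apply: eq_bigr => j _.
  rewrite mulr_sumr; apply: eq_bigr => l _.
  by rewrite (B_sym l k Uz); gen_atoms; ring.
rewrite -sumrN; apply: eq_bigr => i _.
under eq_bigr => j _ do rewrite dG_B // mulrN mulr_sumr.
rewrite sumrN exchange_big /=; congr (- _).
transitivity (\sum_l (B z *m G z) i l * dx i (fun z => B z l k) z).
  by apply: eq_bigr => l _; rewrite mxE mulr_suml; apply: eq_bigr => j _; rewrite mulrA.
rewrite mulVmx ?Gu // (bigD1 i) //= big1 => [|l /negPf li]; last first.
  by rewrite mxE eq_sym li mul0r.
by rewrite mxE eqxx mul1r addr0.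
Qed.

Definition lapx F z : R :=
  \sum_i \sum_j B z i j * dx i (dx j F) z
     - \sum_k \sum_l B z k l * (bvecc gr z l * dx k F z).

(** The Laplacian of [g_rho] is the divergence of the same gradient for the volume of [g_rho], which
    is [w^2] times that of [g]; the difference is the pairing of [dF] with [d log w^2]. *)
Lemma lapxE F z : smooth_on U F -> U z ->
  lapx F z = Lop F z + 2 * (Wcyl z)^-1 * grad_pair Wcyl F z.
Proof.
move=> Fs Uz; have wn := Wcyl_neq0 Uz; rewrite /lapx /Lop.
have -> : \sum_k \sum_l B z k l * (bvecc gr z l * dx k F z) =
   - (\sum_i \sum_j dx i (fun z => B z i j) z * dx j F z)
   - \sum_k tauc gr z k * grad F k z.
  transitivity (\sum_k (- (\sum_i dx i (fun z => B z i k) z * dx k F z)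
      - \sum_l tauc gr z l * (B z l k * dx k F z))).
    apply: eq_bigr => k _.
    under eq_bigr => l _ do rewrite mulrA.
    rewrite -[LHS]mulr_suml contracted_bvec // mulrBl mulNr; congr (- _ - _).
      by rewrite mulr_suml.
    by rewrite mulr_suml; apply: eq_bigr => l _; rewrite (B_sym k l Uz); gen_atoms; ring.
  rewrite (sum_oppB (fun k => \sum_i dx i (fun z => B z i k) z * dx k F z)
    (fun k => \sum_l tauc gr z l * (B z l k * dx k F z))).
  apply: oppB_congr; first by rewrite exchange_big.
  by rewrite exchange_big /=; apply: eq_bigr => k _; rewrite /grad mulr_sumr.
have -> : \sum_i dx i (grad F i) z = \sum_i \sum_j dx i (fun z => B z i j) z * dx j F z
   + \sum_i \sum_j B z i j * dx i (dx j F) z.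
  rewrite -big_split; apply: eq_bigr => i _ /=; rewrite -big_split /=.
  rewrite (partial_sum oU _ _ _ Uz) => [|j _].
    by apply: eq_bigr => j _; rewrite (partialM _ (smooth_B _ _) (smooth_partial _ Fs) Uz).
  by apply: (smoothM oU); [exact: smooth_B|exact: smooth_partial].
have -> : 2 * (Wcyl z)^-1 * grad_pair Wcyl F z =
    \sum_k tauc gr z k * grad F k z - \sum_k tau0 z k * grad F k z.
  rewrite /grad_pair mulr_sumr -sumrB; apply: eq_bigr => k _; rewrite dx_Wcyl //.
  by field.
ring.
Qed.

(** [U(r)] in the variable [rho]: since [d_r = - r d_rho], the operator [d_r^2 - (n - 1) r^-1 d_r]
    becomes [- 2 rho d_rho^2 + (n - 2) d_rho], which is regular at [rho = 0]. *)
Definition Upot z : R :=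
  (- (2 * cyl_s z) * dr (dr Wcyl) z + (n%:R - 2) * dr Wcyl z + Lop Wcyl z) / Wcyl z.

Definition Mt H z : R := Lop H z - Upot z * H z.

(** The [D] of the overview for [c = 2 gam + n - 2]. *)
Definition Dop (c : R) H z : R :=
  - (2 * cyl_s z) * dr (dr H) z + c * dr H z + Mt H z.

Lemma smooth_cyl_s : smooth_on U (@cyl_s R n).
Proof.
rewrite (_ : @cyl_s R n = fun z => z 0 (irho n)); first exact: smooth_coord.
by apply/funext => z; exact: cyl_s_coord.
Qed.

Lemma smooth_2s : smooth_on U (fun z => - (2 * cyl_s z)).
Proof.
apply: (smoothN oU); apply: (smoothM oU); first exact: smooth_cst.
exact: smooth_cyl_s.
Qed.

Lemma smooth_Upot : smooth_on U Upot.
Proof.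
apply: (smoothM oU); last exact: smooth_Wcyl_inv.
apply: (smoothD oU); last by apply: smooth_Lop; exact: smooth_Wcyl.
apply: (smoothD oU); apply: (smoothM oU).
- exact: smooth_2s.
- by do 2 apply: smooth_partial; exact: smooth_Wcyl.
- exact: smooth_cst.
- by apply: smooth_partial; exact: smooth_Wcyl.
Qed.

Lemma smooth_Mt H : smooth_on U H -> smooth_on U (Mt H).
Proof.
move=> Hs; apply: (smoothB oU); first exact: smooth_Lop.
by apply: (smoothM oU) => //; exact: smooth_Upot.
Qed.

Lemma smooth_Dop c H : smooth_on U H -> smooth_on U (Dop c H).
Proof.
move=> Hs; apply: (smoothD oU); last exact: smooth_Mt.
apply: (smoothD oU); apply: (smoothM oU).
- exact: smooth_2s.
- by do 2 apply: smooth_partial.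
- exact: smooth_cst.
- exact: smooth_partial.
Qed.

(** [W'] and [W''] are the derivatives of [1 / w]. By [w' / w = th / 2] the terms [- 2 s th h'] and
    [gam th h] cancel against those produced by [W'], and the remaining zeroth-order term is free of
    [gam]. *)
Lemma conj_alg_r (s gam n' th Wcyl Wcyl' Wcyl'' h h' h'' : R) : Wcyl != 0 -> Wcyl' = Wcyl * (th / 2) ->
  let W' := - (Wcyl' * (Wcyl^-1 * Wcyl^-1)) in
  let W'' := - (Wcyl'' * (Wcyl^-1 * Wcyl^-1) + Wcyl' * (W' * Wcyl^-1 + Wcyl^-1 * W')) in
  - (2 * s) * (h'' * Wcyl^-1 + h' * W' + (h' * W' + h * W''))
  + (2 * gam + n' - 2 - 2 * s * th) * (h' * Wcyl^-1 + h * W') + gam * th * (h * Wcyl^-1) =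
  Wcyl^-1 * (- (2 * s) * h'' + (2 * gam + n' - 2) * h'
    - (- (2 * s) * Wcyl'' + (n' - 2) * Wcyl') / Wcyl * h).
Proof.
move=> w0 w1 /=; have -> : th = 2 * Wcyl' / Wcyl by rewrite w1; field.
by field.
Qed.

(** The hypothesis is the product rule of [Lop] on [w * w^-1 = 1]; it serves to eliminate
    [Lop (w^-1)]. *)
Lemma conj_alg_x (Wcyl h LW Lh Lw g1 g2 : R) : Wcyl != 0 -> Wcyl * LW + Wcyl^-1 * Lw + 2 * g1 = 0 ->
  h * LW + Wcyl^-1 * Lh + 2 * (- (Wcyl^-1 * Wcyl^-1 * g2)) + 2 * Wcyl^-1 * (Wcyl^-1 * g2 + h * g1) =
  Wcyl^-1 * (Lh - Lw / Wcyl * h).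
Proof.
move=> w0 E.
have -> : LW = Wcyl^-1 * (Wcyl * LW + Wcyl^-1 * Lw + 2 * g1) - Wcyl^-1 * (Wcyl^-1 * Lw + 2 * g1) by field.
by rewrite E; field.
Qed.

Lemma conj_alg_sum (v a b c d e h L Lw : R) :
  v * (a * d + b * e - c * v * h) + v * (L - Lw * v * h) =
  v * (a * d + b * e + (L - (c + Lw) * v * h)).
Proof. ring. Qed.

Lemma conjugation gam H z : smooth_on U H -> U z ->
  LapC gr gam (fun z => H z * (Wcyl z)^-1) z = (Wcyl z)^-1 * Dop (2 * gam + n%:R - 2) H z.
Proof.
move=> Hs Uz; have ws := smooth_Wcyl; have Ws := smooth_Wcyl_inv.
have wn := Wcyl_neq0 Uz.
pose W z := (Wcyl z)^-1.
have dW k y : U y -> partial k W y = - (partial k Wcyl y * (W y * W y)).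
  by move=> Uy; rewrite (partialV _ ws Uy) //; exact: Wcyl_neq0.
have dF k y : U y -> partial k (fun z => H z * W z) y = partial k H y * W y + H y * partial k W y.
  by move=> Uy; rewrite (partialM _ Hs Ws Uy).
have drrW : dr (dr W) z = - (dr (dr Wcyl) z * (W z * W z) + dr Wcyl z * (dr W z * W z + W z * dr W z)).
  rewrite (partial_ext _ oU (dW _) Uz).
  have WWs := smoothM oU Ws Ws; have dws := smooth_partial (irho n) ws.
  by rewrite (partialN _ (smoothM oU dws WWs) Uz) (partialM _ dws WWs Uz) (partialM _ Ws Ws Uz).
have drrF : dr (dr (fun z => H z * W z)) z =
   dr (dr H) z * W z + dr H z * dr W z + (dr H z * dr W z + H z * dr (dr W) z).
  rewrite (partial_ext _ oU (dF _) Uz).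
  have dHs := smooth_partial (irho n) Hs; have dWs := smooth_partial (irho n) Ws.
  rewrite (partialD _ (smoothM oU dHs Ws) (smoothM oU Hs dWs) Uz).
  by rewrite (partialM _ dHs Ws Uz) (partialM _ Hs dWs Uz).
have HWs := smoothM oU Hs Ws.
rewrite /LapC -/(lapx _ z) (lapxE HWs Uz) (LopM Hs Ws Uz) drrF (dF _ _ Uz) drrW (dW _ _ Uz).
have gW K : grad_pair K W z = - (W z * W z * grad_pair K Wcyl z).
  rewrite /grad_pair /grad mulr_sumr -sumrN; apply: eq_bigr => i _.
  rewrite mulrCA -mulrN; congr (_ * _); rewrite mulr_sumr -sumrN.
  by apply: eq_bigr => j _; rewrite (dW _ _ Uz); gen_atoms; ring.
have E1 : Wcyl z * Lop W z + W z * Lop Wcyl z + 2 * grad_pair Wcyl W z = 0.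
  rewrite -(LopM ws Ws Uz).
  have E i y : U y -> grad (fun z => Wcyl z * W z) i y = 0.
    move=> Uy; rewrite /grad big1 // => j _.
    rewrite (partial_ext (v := fun=> 1) _ oU _ Uy) ?partial_cst ?mulr0 // => y' Uy'.
    by rewrite mulfV //; exact: Wcyl_neq0.
  rewrite /Lop big1 => [|i _].
    by rewrite add0r big1 // => i _; rewrite E // mulr0.
  by rewrite (partial_ext (v := fun=> 0) _ oU (E i) Uz) partial_cst.
have E2 : grad_pair Wcyl (fun z => H z * W z) z = W z * grad_pair H Wcyl z + H z * grad_pair Wcyl W z.
  rewrite -(grad_pairC _ _ Uz) [in RHS](grad_pairC Wcyl W Uz) /grad_pair !mulr_sumr -big_split.
  by apply: eq_bigr => i _; rewrite /= (dF _ _ Uz); gen_atoms; ring.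
rewrite E2 (gW H : grad_pair H (fun z => (Wcyl z)^-1) z = _).
have X := conj_alg_x (H z) (Lop H z) (grad_pair H Wcyl z) wn E1.
have Y := conj_alg_r (cyl_s z) gam n%:R (dr (dr Wcyl) z) (H z) (dr H z) (dr (dr H) z) wn (dr_Wcyl Uz).
apply: (etrans (congr2 +%R Y X)); rewrite /Dop /Mt /Upot; exact: conj_alg_sum.
Qed.

End Conjugation.

(** * Taylor coefficients along the cylinder *)

Section TaylorCoefficients.
Variables (R : realType) (n : nat) (U0 : set 'rV[R]_n) (eps : R).
Hypothesis oU0 : open U0.
Hypothesis eps0 : 0 < eps.
Local Notation U := (cyldom U0 eps).
Local Notation dr := (partial (irho n)).
Let oU : open U := @open_cyldom R n U0 eps oU0.
Implicit Types (F H : 'rV[R]_(n + 1) -> R) (y : 'rV[R]_n).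

(* The coefficient of [s^i], [s = - rho / 2], in the expansion of [F (cpt y rho)] at
   [rho = 0]. *)
Definition tcoef i F y : R := iter i dr F (cpt y 0) / (i`!%:R * (- 2^-1) ^+ i).

Lemma tcoef_den i : i`!%:R * (- 2^-1) ^+ i != 0 :> R.
Proof.
rewrite mulf_neq0 ?pnatr_eq0 -?lt0n ?fact_gt0 //.
by rewrite expf_neq0 // oppr_eq0 invr_eq0 pnatr_eq0.
Qed.

Lemma smooth_iter i F : smooth_on U F -> smooth_on U (iter i dr F).
Proof. by move=> Fs; elim: i => //= i; exact: smooth_partial. Qed.

Lemma iter_ext i F H z : (forall z, U z -> F z = H z) -> U z ->
  iter i dr F z = iter i dr H z.
Proof.
move=> FH; elim: i z => [|i IH] z Uz /=; first exact: FH.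
exact: (partial_ext _ oU IH Uz).
Qed.

Lemma iterD i F H z : smooth_on U F -> smooth_on U H -> U z ->
  iter i dr (fun z => F z + H z) z = iter i dr F z + iter i dr H z.
Proof.
move=> Fs Hs; elim: i z => [|i IH] z Uz //=.
rewrite (partial_ext _ oU IH Uz).
by rewrite (partialD _ (smooth_iter i Fs) (smooth_iter i Hs) Uz).
Qed.

Lemma iterZ i c F z : smooth_on U F -> U z ->
  iter i dr (fun z => c * F z) z = c * iter i dr F z.
Proof.
move=> Fs; elim: i z => [|i IH] z Uz //=.
rewrite (partial_ext _ oU IH Uz).
by rewrite (partialZ _ (smooth_iter i Fs) Uz).
Qed.

Lemma tcoef_ext i F H y : (forall z, U z -> F z = H z) -> U0 y -> tcoef i F y = tcoef i H y.
Proof. by move=> FH Uy; rewrite /tcoef (iter_ext _ FH) //; exact: cyldom0. Qed.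

Lemma tcoef0 F y : tcoef 0 F y = F (cpt y 0).
Proof. by rewrite /tcoef fact0 expr0 mulr1 divr1. Qed.

Lemma tcoefD i F H y : smooth_on U F -> smooth_on U H -> U0 y ->
  tcoef i (fun z => F z + H z) y = tcoef i F y + tcoef i H y.
Proof. by move=> Fs Hs Uy; rewrite /tcoef iterD ?mulrDl //; exact: cyldom0. Qed.

Lemma tcoefZ i c F y : smooth_on U F -> U0 y ->
  tcoef i (fun z => c * F z) y = c * tcoef i F y.
Proof. by move=> Fs Uy; rewrite /tcoef iterZ ?mulrA //; exact: cyldom0. Qed.

Lemma tcoefN i F y : smooth_on U F -> U0 y -> tcoef i (fun z => - F z) y = - tcoef i F y.
Proof.
move=> Fs Uy; rewrite -[RHS]mulN1r -(tcoefZ _ _ Fs Uy); apply: tcoef_ext => // z _.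
by rewrite mulN1r.
Qed.

Lemma tcoef_alg1 (i' a b c : R) : (i' == 0) = false -> a != 0 -> b != 0 ->
  c / (a * b) = - (i' / 2) * (c / (i' * a * (- 2^-1 * b))).
Proof. by move=> /negbT i0 a0 b0; field; rewrite i0 a0 b0. Qed.

(** In terms of [s = - rho / 2] the derivative [d_rho] is [- 2^-1 d_s]. *)
Lemma tcoef_drE i F y : tcoef i (dr F) y = - (i.+1%:R / 2) * tcoef i.+1 F y.
Proof.
rewrite /tcoef -iterSr factS natrM exprS.
have := tcoef_den i; rewrite mulf_eq0 negb_or => /andP[a0 b0].
by apply: tcoef_alg1 => //; rewrite pnatr_eq0.
Qed.

Lemma tcoef_cst0 i y : tcoef i (fun=> 0) y = 0.
Proof.
rewrite /tcoef (_ : iter i dr (fun=> 0) = fun=> 0) ?mul0r //.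
elim: i => //= i ->; apply/funext => z; exact: partial_cst.
Qed.

Lemma tcoef_sum i (I : Type) (r : seq I) (F : I -> 'rV[R]_(n + 1) -> R) y :
  (forall k, smooth_on U (F k)) -> U0 y ->
  tcoef i (fun z => \sum_(k <- r) F k z) y = \sum_(k <- r) tcoef i (F k) y.
Proof.
move=> Fs Uy; elim: r => [|k r IH].
  rewrite big_nil -[RHS](tcoef_cst0 i y); apply: tcoef_ext => // z _.
  by rewrite big_nil.
rewrite big_cons -IH -tcoefD //; last by apply: smooth_sum.
by apply: tcoef_ext => // z _; rewrite big_cons.
Qed.

Lemma tcoef_pull i f y : U0 y ->
  tcoef i (fun z => f (cyl_x z)) y = if i is 0%N then f y else 0.
Proof.
case: i => [|i] Uy; first by rewrite tcoef0 cyl_xE.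
rewrite /tcoef iterSr (_ : dr _ = fun=> 0).
  have := tcoef_cst0 i y; rewrite /tcoef => /eqP; rewrite mulf_eq0 invr_eq0 (negPf (tcoef_den i)) orbF.
  by move=> /eqP ->; rewrite mul0r.
by apply/funext => z; exact: partial_cyl_rho.
Qed.

Lemma smooth_s : smooth_on U (fun z => - (cyl_s z / 2)).
Proof.
apply: (smoothN oU); apply: (smoothM oU); last exact: smooth_cst.
rewrite (_ : @cyl_s R n = fun z => z 0 (irho n)); first exact: smooth_coord.
by apply/funext => z; exact: cyl_s_coord.
Qed.

Lemma dr_s z : U z -> dr (fun z => - (cyl_s z / 2)) z = - 2^-1.
Proof.
move=> Uz.
transitivity (dr (fun z : 'rV[R]_(n + 1) => - 2^-1 * z 0 (irho n)) z).
  by apply: (congr1 (fun u => dr u z)); apply/funext => z'; rewrite cyl_s_coord mulNr mulrC.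
by rewrite (partialZ _ (@smooth_coord _ _ U _) Uz) partial_coord eqxx mulr1.
Qed.

Lemma iter_sM i F z : smooth_on U F -> U z ->
  iter i dr (fun z => - (cyl_s z / 2) * F z) z =
  - (cyl_s z / 2) * iter i dr F z - i%:R / 2 * iter i.-1 dr F z.
Proof.
move=> Fs; elim: i z => [|i IH] z Uz; first by rewrite /= !mul0r subr0.
rewrite [LHS]/= (partial_ext _ oU IH Uz).
have Fi := smooth_iter i Fs; have Fi' := smooth_iter i.-1 Fs.
rewrite (partialB _ (smoothM oU smooth_s Fi) _ Uz); last first.
  by apply: (smoothM oU) => //; exact: smooth_cst.
rewrite (partialM _ smooth_s Fi Uz) (partialZ _ Fi' Uz) dr_s //=.
rewrite (_ : i%:R / 2 * dr (iter i.-1 dr F) z = i%:R / 2 * iter i dr F z); last first.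
  by case: (i) => [|i'] //; rewrite !mul0r.
move: (dr _ z) (iter _ _ _ z) => a b; rewrite -natr1; by field.
Qed.

Lemma tcoef_alg2 (i' a b c : R) : (i' == 0) = false -> a != 0 -> b != 0 ->
  - (i' / 2 * c) / (i' * a * (- 2^-1 * b)) = c / (a * b).
Proof. by move=> /negbT i0 a0 b0; field; rewrite i0 a0 b0. Qed.

Lemma tcoef_sM i F y : smooth_on U F -> U0 y ->
  tcoef i (fun z => - (cyl_s z / 2) * F z) y = if i is i'.+1 then tcoef i' F y else 0.
Proof.
move=> Fs Uy; case: i => [|i]; first by rewrite tcoef0 cyl_sE mul0r oppr0 mul0r.
rewrite {1}/tcoef iter_sM //; last exact: cyldom0.
rewrite cyl_sE mul0r oppr0 mul0r add0r /= /tcoef factS natrM exprS.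
have := tcoef_den i; rewrite mulf_eq0 negb_or => /andP[a0 b0].
by apply: tcoef_alg2 => //; rewrite pnatr_eq0.
Qed.

Lemma tcoef_sXM i j F y : smooth_on U F -> U0 y ->
  tcoef i (fun z => (- (cyl_s z / 2)) ^+ j * F z) y =
  if (j <= i)%N then tcoef (i - j) F y else 0.
Proof.
move=> Fs Uy; elim: j i => [|j IH] i.
  by rewrite subn0 leq0n; apply: tcoef_ext => // z _; rewrite expr0 mul1r.
have Fj : smooth_on U (fun z => (- (cyl_s z / 2)) ^+ j * F z).
  by apply: (smoothM oU) => //; apply: (smoothX oU); exact: smooth_s.
transitivity (tcoef i (fun z => - (cyl_s z / 2) * ((- (cyl_s z / 2)) ^+ j * F z)) y).
  by apply: tcoef_ext => // z _; rewrite exprS mulrA.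
by rewrite tcoef_sM //; case: i => [|i] //; rewrite IH ltnS subSS.
Qed.

(** Vanishing is asked at all points of [U0], not at a single one, so that tangential derivatives
    inherit it. *)
Definition vanish K F := forall j, (j < K)%N -> forall y, U0 y -> tcoef j F y = 0.

Lemma vanish_dr K F : vanish K.+1 F -> vanish K (dr F).
Proof. by move=> v j jK y Uy; rewrite tcoef_drE v ?mulr0 // ltnS. Qed.

Lemma vanishW K F : vanish K.+1 F -> vanish K F.
Proof. by move=> v j jK; apply: v; apply: leqW. Qed.

Lemma vanishD K F H : smooth_on U F -> smooth_on U H -> vanish K F -> vanish K H ->
  vanish K (fun z => F z + H z).
Proof. by move=> Fs Hs vF vH j jK y Uy; rewrite tcoefD // vF // vH // addr0. Qed.

(** Coefficient [j + 1] of the product is a multiple of coefficient [j] of its derivative, and the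
    Leibniz rule splits the latter into two products to which the induction applies. *)
Lemma vanishM K a F : smooth_on U a -> smooth_on U F -> vanish K F ->
  vanish K (fun z => a z * F z).
Proof.
elim: K a F => [|K IH] a F as_ Fs vF //.
case=> [|j] jK y Uy; first by rewrite tcoef0 -[F _]tcoef0 vF // mulr0.
have := tcoef_drE j (fun z => a z * F z) y.
have -> : tcoef j (dr (fun z => a z * F z)) y = 0.
  have das := smooth_partial (irho n) as_; have dFs := smooth_partial (irho n) Fs.
  rewrite (tcoef_ext j (fun z Uz => partialM (irho n) as_ Fs Uz) Uy).
  apply: (@vanishD K) => //; try exact: (smoothM oU).
  - by apply: IH => //; exact: vanishW.
  - by apply: IH => //; exact: vanish_dr.
move/esym/eqP; rewrite mulf_eq0 oppr_eq0 mulf_eq0 pnatr_eq0 invr_eq0 pnatr_eq0 /=.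
by move/eqP.
Qed.

Lemma vanish_sum K (I : Type) (r : seq I) (F : I -> 'rV[R]_(n + 1) -> R) :
  (forall k, smooth_on U (F k)) -> (forall k, vanish K (F k)) ->
  vanish K (fun z => \sum_(k <- r) F k z).
Proof. by move=> Fs vF j jK y Uy; rewrite tcoef_sum // big1 // => k _; exact: vF. Qed.

(** This is where mixed derivatives have to commute: it lets tangential derivatives pass to the
    Taylor coefficients in [rho]. *)
Lemma iter_dx i k F z : smooth_on U F -> U z ->
  iter i dr (partial k F) z = partial k (iter i dr F) z.
Proof.
move=> Fs; elim: i z => [|i IH] z Uz //=.
rewrite (partial_ext _ oU IH Uz); apply: (schwarz _ _ oU _ Uz); exact: smooth_iter.
Qed.

Lemma smooth_slice0 F : smooth_on U F -> smooth_on U0 (fun y => F (cpt y 0)).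
Proof.
move=> Fs; apply: (@smooth_on_sub _ _ [set y | U (cpt y 0)]); last exact: smooth_slice.
by move=> y Uy; exact: cyldom0.
Qed.

Lemma tcoef_dx j k F y : smooth_on U F -> U0 y ->
  tcoef j (partial (ix k) F) y = partial k (tcoef j F) y.
Proof.
move=> Fs Uy; rewrite {1}/tcoef iter_dx //; last exact: cyldom0.
rewrite -partial_slice mulrC -(partialZ k (smooth_slice0 (smooth_iter j Fs)) Uy).
by apply: (partial_ext _ oU0 _ Uy) => y' _; rewrite mulrC.
Qed.

Lemma vanish_dx K k F : smooth_on U F -> vanish K F -> vanish K (partial (ix k) F).
Proof.
move=> Fs vF j jK y Uy; rewrite tcoef_dx //.
by rewrite (partial_ext (v := fun=> 0) _ oU0 (vF j jK) Uy) partial_cst.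
Qed.

Lemma smooth_tcoef i F : smooth_on U F -> smooth_on U0 (tcoef i F).
Proof.
move=> Fs; apply: (smoothM oU0); last exact: smooth_cst.
by apply: smooth_slice0; exact: smooth_iter.
Qed.

End TaylorCoefficients.

(** * Action of [D] and of its iterates on Taylor coefficients *)

Section OperatorCoefficients.
Variables (R : realType) (n : nat) (gr : R -> 'rV[R]_n -> 'M[R]_n).
Variables (g : 'rV[R]_n -> 'M[R]_n) (U0 : set 'rV[R]_n) (eps : R).
Hypothesis reg : regular_family gr g U0 eps.
Local Notation U := (cyldom U0 eps).
Local Notation dr := (partial (irho n)).
Local Notation Mt := (Mt gr g).
Local Notation Dop := (Dop gr g).
Let oU0 := rf_open reg.
Let eps0 := rf_eps reg.
Let oU : open U := @open_cyldom _ _ _ eps oU0.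
Local Notation vanish := (vanish U0).

Lemma vanish_ext K F H : (forall z, U z -> F z = H z) -> vanish K F -> vanish K H.
Proof. by move=> FH vF j jK y Uy; rewrite -(tcoef_ext oU0 eps0 _ FH) // vF. Qed.

Lemma vanish_grad K i F : smooth_on U F -> vanish K F -> vanish K (grad gr F i).
Proof.
move=> Fs vF; apply: (vanish_sum oU0 eps0) => j.
  by apply: (smoothM oU); [exact: (smooth_B reg)|exact: smooth_partial].
apply: (vanishM oU0 eps0); [exact: (smooth_B reg)|exact: smooth_partial|].
exact: (vanish_dx oU0 eps0).
Qed.

(** [M(r)] contains tangential derivatives only, and these, unlike [d_rho], preserve the order of
    vanishing. *)
Lemma vanish_Mt K F : smooth_on U F -> vanish K F -> vanish K (Mt F).
Proof.
move=> Fs vF.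
have gs i : smooth_on U (grad gr F i) by exact: (smooth_grad reg).
have dgs i : smooth_on U (partial (ix i) (grad gr F i)) by exact: smooth_partial.
have tgs k : smooth_on U (fun z => tau0 g z k * grad gr F k z).
  by apply: (smoothM oU) => //; exact: (smooth_tau0 reg).
have Us := smooth_Upot reg.
apply: (@vanish_ext _ (fun z => Lop gr g F z + (- Upot gr g z) * F z)).
  by move=> z _; rewrite /Mt mulNr.
apply: (vanishD oU0 eps0).
- exact: (smooth_Lop reg).
- by apply: (smoothM oU) => //; exact: smoothN.
- apply: (vanishD oU0 eps0); [exact: smooth_sum|exact: smooth_sum| |].
    apply: (vanish_sum oU0 eps0) => // i.
    by apply: (vanish_dx oU0 eps0) => //; exact: vanish_grad.
  apply: (vanish_sum oU0 eps0) => // i.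
  by apply: (vanishM oU0 eps0) => //; [exact: (smooth_tau0 reg)|exact: vanish_grad].
- by apply: (vanishM oU0 eps0) => //; exact: smoothN.
Qed.

(** In the variable [s] the operator is [s d_s^2 - (c / 2) d_s + M], with indicial factor
    [(e + 1) (e - c / 2)] on [s^(e + 1)]. *)
Lemma tcoef_Dop e c H y : smooth_on U H -> U0 y ->
  tcoef e (Dop c H) y =
  (e.+1)%:R * (e%:R - c / 2) * tcoef e.+1 H y + tcoef e (Mt H) y.
Proof.
move=> Hs Uy.
have dHs := smooth_partial (irho n) Hs; have ddHs := smooth_partial (irho n) dHs.
have s1 : smooth_on U (fun z => - (cyl_s z / 2) * dr (dr H) z).
  by apply: (smoothM oU) => //; exact: smooth_s.
have s2 : smooth_on U (fun z => c * dr H z).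
  by apply: (smoothM oU) => //; exact: smooth_cst.
have s3 : smooth_on U (fun z => 4 * (- (cyl_s z / 2) * dr (dr H) z)).
  by apply: (smoothM oU) => //; exact: smooth_cst.
transitivity (tcoef e (fun z => (4 * (- (cyl_s z / 2) * dr (dr H) z) + c * dr H z) + Mt H z) y).
  by apply: (tcoef_ext oU0 eps0) => // z _; rewrite /Dop; congr (_ + _ + _); field.
rewrite (tcoefD oU0 eps0) //; [|exact: smoothD|exact: (smooth_Mt reg)].
rewrite (tcoefD oU0 eps0) // !(tcoefZ oU0 eps0) // (tcoef_sM oU0 eps0) // tcoef_drE.
congr (_ + _); case: e => [|e].
  move: (tcoef _ _ _) => a; by field.
rewrite !tcoef_drE.
move: (tcoef _ _ _) => a; rewrite -!natr1; by field.
Qed.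

Lemma vanish_Dop K c H : smooth_on U H -> vanish K.+1 H -> vanish K (Dop c H).
Proof.
move=> Hs vH j jK y Uy; rewrite tcoef_Dop // vH // (vanish_Mt Hs vH) ?mulr0 ?addr0 //.
exact: leqW.
Qed.

Lemma tcoef_Dop_top K c H y : smooth_on U H -> vanish K.+1 H -> U0 y ->
  tcoef K (Dop c H) y = K.+1%:R * (K%:R - c / 2) * tcoef K.+1 H y.
Proof. by move=> Hs vH Uy; rewrite tcoef_Dop // (vanish_Mt Hs vH) ?addr0. Qed.

(** Each ambient Laplacian lowers the weight in [t] by two, so the constant in [D] changes from
    factor to factor. *)
Fixpoint Diter (gam : R) k H :=
  if k is k'.+1 then Dop (2 * (gam - 2 * k'%:R) + n%:R - 2) (Diter gam k' H) else H.

Lemma smooth_Diter gam k H : smooth_on U H -> smooth_on U (Diter gam k H).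
Proof. by move=> Hs; elim: k => //= k IH; exact: (smooth_Dop reg). Qed.

Lemma iter_laplacian gam k u H :
  smooth_on U H ->
  (forall Z, ambdom U Z ->
    u Z = amb_t Z `^ gam * (H (rsubmx Z) * (Wcyl gr g (rsubmx Z))^-1)) ->
  forall Z, ambdom U Z -> iter k (laplacian (ambient_metric gr)) u Z =
    amb_t Z `^ (gam - 2 * k%:R) *
      (Diter gam k H (rsubmx Z) * (Wcyl gr g (rsubmx Z))^-1).
Proof.
move=> Hs uE; elim: k => [|k IH] Z OZ; first by rewrite /= mulr0 subr0 uE.
rewrite iterS (laplacian_ext _ (open_ambdom oU) IH OZ).
have Ds := smooth_Diter gam k Hs.
have DWs : smooth_on U (fun z => Diter gam k H z * (Wcyl gr g z)^-1).
  by apply: (smoothM oU) => //; exact: (smooth_Wcyl_inv reg).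
rewrite (amb_laplacian oU (rf_smooth reg) (rf_unit reg) (rf_sym reg) _ DWs OZ).
rewrite (conjugation reg _ Ds) ?[_^-1 * _]mulrC; last by case: OZ.
congr (_ `^ _ * _); rewrite -natr1; ring.
Qed.

(** On the leading coefficient of a vanishing function only the indicial factor of [D] survives, so
    each application contributes a scalar. *)
Lemma tcoef_Diter gam (N k : nat) H y :
  gam = N%:R - n%:R / 2 -> smooth_on U H -> U0 y -> (k < N)%N ->
  vanish N.-1 (Diter gam 1 H) ->
  vanish (N - k.+1)%N (Diter gam k.+1 H) /\
  tcoef (N - k.+1) (Diter gam k.+1 H) y =
  \prod_(j < k) (j.+1%:R * (N - j.+1)%:R) * tcoef N.-1 (Diter gam 1 H) y.
Proof.
move=> gamE Hs Uy + v1; elim: k => [|k IH] kN.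
  by rewrite subn1 big_ord0 mul1r.
have [vk ek] := IH (ltnW kN).
have Nk : (N - k.+1 = (N - k.+2).+1)%N by rewrite subnSK.
have Ds := smooth_Diter gam k.+1 Hs.
rewrite Nk in vk ek.
split; first exact: (vanish_Dop _ Ds vk).
rewrite big_ord_recr [tcoef _ _ _](tcoef_Dop_top _ Ds vk Uy) ek.
have -> : (N - k.+2)%:R - (2 * (gam - 2 * k.+1%:R) + n%:R - 2) / 2 = k.+1%:R :> R.
  have -> : gam = (N - k.+2)%:R + k.+2%:R - n%:R / 2 by rewrite -natrD subnK.
  by rewrite -!natr1; field.
rewrite -Nk /=; move: (\prod_(i < k) _) (tcoef _ _ _) (_%:R) (_%:R) => a b c d; ring.
Qed.

Lemma tcoef_Diter_top gam N H y :
  gam = N%:R - n%:R / 2 -> smooth_on U H -> U0 y -> (0 < N)%N ->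
  vanish N.-1 (Diter gam 1 H) ->
  Diter gam N H (cpt y 0) =
  (N.-1)`!%:R ^+ 2 * tcoef N.-1 (Diter gam 1 H) y.
Proof.
case: N => // N gamE Hs Uy _ v1.
have [_] := tcoef_Diter gamE Hs Uy (ltnSn N) v1.
rewrite subnn tcoef0 => ->; congr (_ * _).
(* Of the two factors in each scalar, one runs upwards and the other downwards through the same
   integers, so either product is the factorial. *)
rewrite big_split /= expr2; congr (_ * _).
  by rewrite fact_prod natr_prod big_add1 /= big_mkord.
rewrite fact_prod natr_prod big_add1 /= big_mkord (reindex_inj rev_ord_inj) /=.
by apply: eq_bigr => i _; rewrite subSS subKn.
Qed.

End OperatorCoefficients.

(** * Taylor expansion and uniqueness of the asymptotic expansion as [r -> 0+] *)

Section Peano.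
Variables (R : realType) (n : nat) (U0 : set 'rV[R]_n) (eps : R).
Hypothesis oU0 : open U0.
Hypothesis eps0 : 0 < eps.
Local Notation U := (cyldom U0 eps).
Local Notation dr := (partial (irho n)).
Let oU : open U := @open_cyldom R n U0 eps oU0.
Variable y : 'rV[R]_n.
Hypothesis Uy : U0 y.

Lemma cyldom_cpt s : - eps < s < eps -> U (cpt y s).
Proof. by rewrite /cyldom /= cyl_xE cyl_sE. Qed.

(** The estimate for [dr F] at order [K] is integrated once by the mean value theorem. The side
    [s <= 0] is the one on which [rho = - r^2 / 2] lies. *)
Lemma peano K F : smooth_on U F -> (forall j, (j <= K)%N -> tcoef j F y = 0) ->
  forall e, 0 < e -> exists2 d, 0 < d &
    forall s, - d < s <= 0 -> `|F (cpt y s)| <= e * `|s| ^+ K.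
Proof.
elim: K F => [|K IH] F Fs F0 e e0.
  have H := is_derive_rho (smooth_diff Fs (cyldom0 eps0 Uy)).
  have /derivable1_diffP/differentiable_continuous : derivable (fun s => F (cpt y s)) 0 1.
    exact: (@ex_derive _ _ _ _ _ _ _ H).
  move/cvgrPdist_lt => /(_ e e0) /nbhs_ballP [d /= d0 dF].
  exists d => // s /andP[ds s0]; rewrite expr0 mulr1.
  have F00 : F (cpt y 0) = 0 by rewrite -(tcoef0 F y) F0.
  have := dF s; rewrite F00 sub0r normrN => H1; apply/ltW/H1.
  by rewrite /ball /= sub0r normrN ler0_norm //; lra.
have dF0 j : (j <= K)%N -> tcoef j (dr F) y = 0.
  by move=> jK; rewrite tcoef_drE F0 ?mulr0.
have [d d0 dF] := IH _ (smooth_partial (irho n) Fs) dF0 e e0.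
exists (Num.min d eps); first by rewrite lt_min d0 eps0.
move=> s /andP[ds s0].
have [sd se] : - d < s /\ - eps < s.
  by move: ds; rewrite ltrNl lt_min !(ltrNl s) => /andP[].
have F00 : F (cpt y 0) = 0 by rewrite -(tcoef0 F y) F0.
move: s0; rewrite le_eqVlt => /predU1P[->|s0].
  by rewrite F00 normr0 mulr_ge0 ?exprn_ge0 // ltW.
have D c : c \in `[s, 0]%R -> is_derive c 1 (fun s => F (cpt y s)) (dr F (cpt y c)).
  move=> /itvP cs; apply: is_derive_rho; apply: smooth_diff Fs _; apply: cyldom_cpt.
  by rewrite (lt_le_trans se) ?cs // (le_lt_trans _ eps0) ?cs.
have D' c : c \in `]s, 0[%R -> is_derive c 1 (fun s => F (cpt y s)) (dr F (cpt y c)).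
  by move=> cs; apply: D; exact: subset_itv_oo_cc.
have cF : {within `[s, 0], continuous (fun s => F (cpt y s))}.
  apply: derivable_within_continuous => c cs.
  exact: (@ex_derive _ _ _ _ _ _ _ (D c cs)).
have [c cs] := MVT s0 D' cF.
rewrite F00 !sub0r => /eqP; rewrite eqr_oppLR mulrN opprK => /eqP ->.
rewrite normrM exprSr mulrA ler_wpM2r //.
have c0 : s < c < 0 by rewrite !(itvP cs).
case/andP: c0 => sc c0.
apply: (le_trans (dF c _)); first by rewrite (lt_trans sd sc) ltW.
apply: ler_wpM2l; first exact: ltW.
apply: lerXn2r; rewrite ?nnegrE //.
by rewrite !ltr0_norm // lerN2 ltW.
Qed.

Lemma taylor K m : smooth_on U m ->
  forall e, 0 < e -> exists2 d, 0 < d & forall s, - d < s <= 0 ->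
   `|m (cpt y s) - \sum_(i < K.+1) tcoef i m y * (- (s / 2)) ^+ i| <= e * `|s| ^+ K.
Proof.
move=> ms e e0.
pose T i (z : 'rV[R]_(n + 1)) : R := tcoef i m y * ((- (cyl_s z / 2)) ^+ i * 1).
have ps i : smooth_on U (fun z => (- (cyl_s z / 2)) ^+ i * 1).
  apply: (smoothM oU); last exact: smooth_cst.
  by apply: (smoothX oU); exact: smooth_s.
have Ts i : smooth_on U (T i) by apply: (smoothM oU) => //; exact: smooth_cst.
have Ss : smooth_on U (fun z => \sum_(i < K.+1) T i z) by apply: smooth_sum.
have [|j jK|d d0 H] := @peano K (fun z => m z - \sum_(i < K.+1) T i z) _ _ e e0.
- exact: (smoothB oU).
- rewrite (tcoefD oU0 eps0) //; last exact: smoothN.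
  rewrite (tcoefN oU0 eps0) // (tcoef_sum oU0 eps0) //.
  have E i : tcoef j (T i) y = if (i == j)%N then tcoef j m y else 0.
    rewrite (tcoefZ oU0 eps0) // (tcoef_sXM oU0 eps0) //; last exact: smooth_cst.
    have E1 (l : nat) : tcoef l (fun=> 1) y = if l is 0%N then 1 else 0.
      exact: (tcoef_pull l (fun=> 1 : R) Uy).
    rewrite E1.
    case: ltngtP => [ij|ji|->]; first by rewrite -(subnSK ij) mulr0.
      by rewrite mulr0.
    by rewrite subnn mulr1.
  under eq_bigr => i _ do rewrite E.
  by rewrite -big_mkcond (big_pred1 (Ordinal (jK : (j < K.+1)%N))) //= subrr.
exists d => // s ds; have := H s ds.
rewrite /T cyl_sE; under eq_bigr => i _ do rewrite mulr1; exact.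
Qed.

(** The Taylor expansion and the given expansion for [r -> 0+] belong to the same function. Once the
    lower coefficients agree, the difference of the next ones times [(r^2 / 4)^K] is [o(r^(2 K))],
    hence zero. *)
Lemma identify_tcoef K (m : 'rV[R]_(n + 1) -> R) (b : nat -> R) : smooth_on U m ->
  (forall K', (K' < K)%N ->
    (fun r : R => m (cpt y (- (r ^+ 2 / 2))) - \sum_(i < K'.+1) b i * (r ^+ 2 / 4) ^+ i)
    =o_ (0^'+) (fun r : R => r ^+ (2 * K'))) ->
  forall i, (i < K)%N -> tcoef i m y = b i.
Proof.
move=> ms; elim: K => // K IH H i; rewrite ltnS leq_eqVlt => /predU1P[->|]; last first.
  by apply: IH => K' K'K; apply: H; exact: leqW.
have bE j : (j < K)%N -> tcoef j m y = b j by apply: IH => K' K'K; apply: H; exact: leqW.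
apply/eqP; rewrite -subr_eq0 -normr_le0.
apply/ler_addgt0Pr => e e0; rewrite add0r.
(* Either expansion errs by at most [e1 r^(2 K)]; dividing the total [2 e1 r^(2 K)] by [(r^2 / 4)^K]
   gives exactly [e]. *)
pose e1 := e / 2 / 4 ^+ K.
have e10 : 0 < e1 by rewrite !divr_gt0 // exprn_gt0.
have [d d0 HT] := taylor K ms e10.
have /eqoP/(_ e1 e10) Ho := H K (ltnSn K).
near ((0 : R)^'+) => r.
have r0 : 0 < r by near: r; exact: nbhs_right_gt.
have r1 : r < 1 by near: r; apply: nbhs_right_lt.
have rd : r < d by near: r; apply: nbhs_right_lt.
have r2 : 0 <= r ^+ 2 by rewrite exprn_ge0 // ltW.
have rr : r ^+ 2 < r by rewrite expr2 gtr_pMl.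
have A1 : `|m (cpt y (- (r ^+ 2 / 2))) - \sum_(i < K.+1) b i * (r ^+ 2 / 4) ^+ i|
   <= e1 * `|r ^+ (2 * K)| by near: r.
have A2 := HT (- (r ^+ 2 / 2)).
have {}A2 : `|m (cpt y (- (r ^+ 2 / 2))) - \sum_(i < K.+1) tcoef i m y * (r ^+ 2 / 4) ^+ i|
   <= e1 * `|r ^+ (2 * K)|.
  have -> : r ^+ 2 / 4 = - (- (r ^+ 2 / 2) / 2) by field.
  apply: (le_trans (A2 _)); first by apply/andP; split; lra.
  apply: ler_wpM2l; first exact: ltW.
  rewrite exprM [leRHS]normrX; apply: lerXn2r; rewrite ?nnegrE //.
  rewrite normrN ger0_norm; last by lra.
  by rewrite ger0_norm //; lra.
have E : (tcoef K m y - b K) * (r ^+ 2 / 4) ^+ K =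
  (m (cpt y (- (r ^+ 2 / 2))) - \sum_(i < K.+1) b i * (r ^+ 2 / 4) ^+ i) -
  (m (cpt y (- (r ^+ 2 / 2))) - \sum_(i < K.+1) tcoef i m y * (r ^+ 2 / 4) ^+ i).
  rewrite !big_ord_recr /=.
  have -> : \sum_(i < K) tcoef i m y * (r ^+ 2 / 4) ^+ i =
            \sum_(i < K) b i * (r ^+ 2 / 4) ^+ i.
    by apply: eq_bigr => j _; rewrite bE.
  by ring.
have A3 : `|tcoef K m y - b K| * (r ^+ 2 / 4) ^+ K <= 2 * (e1 * r ^+ (2 * K)).
  have p0 : 0 <= (r ^+ 2 / 4) ^+ K by rewrite exprn_ge0 // divr_ge0.
  rewrite -[X in _ * X <= _](ger0_norm p0) -normrM E.
  apply: (le_trans (ler_normB _ _)); rewrite mulr_natl mulr2n.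
  have rn : `|r ^+ (2 * K)| = r ^+ (2 * K) by rewrite ger0_norm // exprn_ge0 // ltW.
  by rewrite rn in A1 A2; exact: lerD.
have rK : 0 < (r ^+ 2) ^+ K by rewrite !exprn_gt0.
have A4 : `|tcoef K m y - b K| * (r ^+ 2) ^+ K <= 2 * (e1 * r ^+ (2 * K)) * 4 ^+ K.
  by rewrite -ler_pdivrMr ?exprn_gt0 // -mulrA -expr_div_n.
move: A4; rewrite exprM.
have -> : 2 * (e1 * (r ^+ 2) ^+ K) * 4 ^+ K = e * (r ^+ 2) ^+ K.
  by rewrite /e1; field; rewrite expf_neq0.
by rewrite ler_pM2r.
Unshelve. all: by end_near. Qed.

End Peano.

(** * Comparison of [M(r)] with its counterpart on the cylinder *)

Section CalM.
Variables (R : realType) (n : nat) (gr : R -> 'rV[R]_n -> 'M[R]_n).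
Variables (g : 'rV[R]_n -> 'M[R]_n) (U0 : set 'rV[R]_n) (eps : R).
Hypothesis reg : regular_family gr g U0 eps.
Local Notation U := (cyldom U0 eps).
Local Notation dr := (partial (irho n)).
Local Notation Wcyl := (Wcyl gr g).
Let oU0 := rf_open reg.
Let eps0 := rf_eps reg.
Let oU : open U := @open_cyldom _ _ _ eps oU0.

Lemma div_grad_slice F s y : U0 y -> 
  div_grad g (gr s) (fun y => F (cpt y s)) y = Lop gr g F (cpt y s).
Proof.
move=> Uy; rewrite /div_grad divergenceE; first last.
- move=> l i j; apply: (partial_ext _ oU0 _ Uy) => y' Uy'.
  by rewrite -[in LHS](gT reg Uy') mxE.
- by apply: invmx_sym; exact: (gT reg Uy).
have gE i : (fun y => \sum_j invmx (gr s y) i j * partial j (fun y => F (cpt y s)) y) =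
    (fun y => grad gr F i (cpt y s)).
  apply/funext => y'; rewrite /grad; apply: eq_bigr => j _.
  by rewrite partial_slice /cylG cyl_xE cyl_sE.
rewrite /Lop; apply: (congr2 +%R); apply: eq_bigr => i _.
  by rewrite (gE i) partial_slice.
rewrite /tau0 cyl_xE; apply: (congr1 ( *%R (tau g y i))).
exact: (congr1 (fun f => f y) (gE i)).
Qed.

Lemma div_grad_ext h u v y : (forall y, U0 y -> u y = v y) -> U0 y ->
  div_grad g h u y = div_grad g h v y.
Proof.
move=> uv Uy; rewrite /div_grad /divergence; apply: eq_bigr => i _.
have E k y' : U0 y' -> \sum_j invmx (h y') k j * partial j u y' =
    \sum_j invmx (h y') k j * partial j v y'.
  by move=> Uy'; apply: eq_bigr => j _; rewrite (partial_ext _ oU0 uv Uy').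
rewrite (partial_ext _ oU0 (E i) Uy); congr (_ + _).
by apply: eq_bigr => k _; rewrite E.
Qed.

Lemma is_derive_path F y r : smooth_on U F -> U (cpt y (- (r ^+ 2 / 2))) ->
  is_derive r 1 (fun r => F (cpt y (- (r ^+ 2 / 2)))) (- r * dr F (cpt y (- (r ^+ 2 / 2)))).
Proof.
move=> Fs Ur.
have H1 : is_derive r 1 (fun r : R => - (r ^+ 2 / 2)) (- r).
  rewrite (_ : (fun r : R => - (r ^+ 2 / 2)) = fun r => (- 2^-1) * r ^+ 2); last first.
    by apply/funext => r'; rewrite mulrC mulNr.
  have H := is_deriveZ (- 2^-1) (is_derive_sqr r).
  by apply: is_derive_eq H _; rewrite /GRing.scale /=; field.
have H2 := is_derive_rho (smooth_diff Fs Ur).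
have d1 : derivable (fun r : R => - (r ^+ 2 / 2)) r 1 by exact: (@ex_derive _ _ _ _ _ _ _ H1).
have d2 : derivable (fun s => F (cpt y s)) (- (r ^+ 2 / 2)) 1 by exact: (@ex_derive _ _ _ _ _ _ _ H2).
split.
  apply/derivable1_diffP.
  exact: (differentiable_comp (proj1 (derivable1_diffP _ _) d1) (proj1 (derivable1_diffP _ _) d2)).
rewrite -derive1E [LHS](derive1_comp d1 d2) !derive1E mulrC.
by rewrite (@derive_val _ _ _ _ _ _ _ H1) (@derive_val _ _ _ _ _ _ _ H2).
Qed.

Lemma WfunE y r : U0 y -> Wfun gr r y = Wcyl (cpt y (- (r ^+ 2 / 2))).
Proof.
move=> Uy; rewrite /Wfun /Vfun /hr /Wcyl /cylG cyl_xE cyl_sE.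
by rewrite expr0n /= mul0r oppr0 (rf_init reg Uy).
Qed.

Lemma path_dom y r : U0 y -> 0 < r -> r ^+ 2 / 2 < eps -> U (cpt y (- (r ^+ 2 / 2))).
Proof.
move=> Uy r0 re; apply: cyldom_cpt => //.
have : 0 < r ^+ 2 by exact: exprn_gt0.
by move=> ?; apply/andP; split; lra.
Qed.

Lemma UfunE y r : U0 y -> 0 < r -> r ^+ 2 / 2 < eps ->
  Ufun g gr r y = Upot gr g (cpt y (- (r ^+ 2 / 2))).
Proof.
move=> Uy r0 re; have ws := smooth_Wcyl reg.
have Ur := path_dom Uy r0 re.
have WE : Wfun gr ^~ y = fun r => Wcyl (cpt y (- (r ^+ 2 / 2))).
  by apply/funext => r'; exact: WfunE.
have D1 r' : 0 < r' -> r' ^+ 2 / 2 < eps ->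
    derive1 (Wfun gr ^~ y) r' = - r' * dr Wcyl (cpt y (- (r' ^+ 2 / 2))).
  move=> r0' re'; rewrite WE derive1E.
  exact: (@derive_val _ _ _ _ _ _ _ (is_derive_path ws (path_dom Uy r0' re'))).
have D2 : derive1n 2 (Wfun gr ^~ y) r =
   - dr Wcyl (cpt y (- (r ^+ 2 / 2))) + r ^+ 2 * dr (dr Wcyl) (cpt y (- (r ^+ 2 / 2))).
  rewrite /derive1n /= derive1E.
  (* The second derivative requires the formula for the first one near [r], where [r] remains
     positive and the path remains in the domain. *)
  have N : \near r, derive1 (Wfun gr ^~ y) r = - r * dr Wcyl (cpt y (- (r ^+ 2 / 2))).
    have : \forall r' \near r, 0 < r' /\ r' ^+ 2 / 2 < eps.
      have c : {for r, continuous (fun r : R => r ^+ 2 / 2)}.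
        apply: differentiable_continuous; apply/derivable1_diffP.
        have H := is_deriveZ (2^-1) (is_derive_sqr r).
        have -> : (fun r : R => r ^+ 2 / 2) = (2^-1 \*: (fun r : R => r ^+ 2)).
          by apply/funext => r'; rewrite mulrC.
        exact: (@ex_derive _ _ _ _ _ _ _ H).
      apply: filterI; first exact: lt_nbhsr.
      exact: (c _ (lt_nbhsl re)).
    by apply: filterS => r' [r0' re']; exact: D1.
  rewrite (near_eq_derive _ N).
  have H2 := is_derive_path (smooth_partial (irho n) ws) Ur.
  have H := is_deriveM (is_deriveN (is_derive_id r 1)) H2.
  rewrite [LHS](@derive_val _ _ _ _ _ _ _ H).
  set a := dr (dr Wcyl) _; set b := dr Wcyl _.
  rewrite (_ : _ + _ = - r * (- r * a) + b * - 1) //; ring.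
rewrite /Ufun D1 // D2 (div_grad_ext (v := fun y => Wcyl (cpt y (- (r ^+ 2 / 2)))) _ _ Uy); last first.
  by move=> y' Uy'; exact: WfunE.
rewrite WfunE // /hr div_grad_slice // /Upot cyl_sE; congr (_ / _); congr (_ + _).
have rn : r != 0 by rewrite gt_eqF.
move: (dr (dr Wcyl) _) (dr Wcyl _) => a b; by field.
Qed.

(** [M(r)], available for [r > 0], becomes the restriction of an operator that is smooth across
    [rho = 0] and therefore has Taylor coefficients. *)
Lemma calME u y r : U0 y -> 0 < r -> r ^+ 2 / 2 < eps ->
  calM g gr r u y = Mt gr g (fun z => u (cyl_x z)) (cpt y (- (r ^+ 2 / 2))).
Proof.
move=> Uy r0 re; rewrite /calM (UfunE Uy r0 re) /Mt cyl_xE.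
rewrite -(div_grad_slice (fun z => u (cyl_x z)) _ Uy).
have -> : (fun y => u (cyl_x (cpt y (- (r ^+ 2 / 2))))) = u.
  by apply/funext => y'; rewrite cyl_xE.
by [].
Qed.

End CalM.

(** * Inversion of the recursion *)

Lemma triangle_exchange (V : nmodType) (j : nat) (f : nat -> nat -> V) :
  \sum_(1 <= a < j) \sum_(1 <= k < (j - a).+1) f a k =
  \sum_(1 <= k < j) \sum_(1 <= a < (j - k).+1) f a k.
Proof.
have E (h : nat -> nat -> V) : \sum_(1 <= a < j) \sum_(1 <= k < (j - a).+1) h a k =
   \sum_(1 <= a < j) \sum_(1 <= k < j | (a + k <= j)%N) h a k.
  rewrite !big_nat; apply: eq_bigr => a /andP[a1 aj].
  rewrite (big_nat_widen _ _ j); last by lia.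
  by apply: eq_bigl => k; rewrite /=; lia.
rewrite E (E (fun k a => f a k)).
rewrite (exchange_big_dep_nat xpredT) //=.
by apply: eq_bigr => k _; apply: eq_bigl => a; rewrite addnC.
Qed.

(** The bracket equals [J (lam - J) / (lam - K)]: dividing by the recursion factor [J (lam - J)]
    leaves the simple pole at [lam = K] with an unchanged residue. *)
Lemma residue_alg (R : realFieldType) (lam J K : R) :
  J != 0 -> lam - J != 0 -> lam - K != 0 ->
  (J * (lam - J))^-1 * (J - J * (J - K) / (lam - K)) = (lam - K)^-1.
Proof. by move=> j0 lj lk; field; rewrite j0 lj lk. Qed.

Section Recursion.
Variables (R : realFieldType) (V : lmodType R) (S : V -> Prop) (N : nat).
Variable mu : nat -> V -> V.
Hypothesis S0 : S 0.
Hypothesis SD : forall u v, S u -> S v -> S (u + v).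
Hypothesis SZ : forall c u, S u -> S (c *: u).
Hypothesis muS : forall a u, (0 < a <= N)%N -> S u -> S (mu a u).
Hypothesis muD : forall a u v, (0 < a <= N)%N -> S u -> S v -> mu a (u + v) = mu a u + mu a v.
Hypothesis muZ : forall a c u, (0 < a <= N)%N -> S u -> mu a (c *: u) = c *: mu a u.

(** [S] stands for smoothness. The operators [mu a] act on all of [V], but they are controlled on
    [S] only and for [a <= N] only, so every step has to check both restrictions. *)
Lemma S_sum (I : eqType) (r : seq I) (P : pred I) (f : I -> V) :
  (forall i, i \in r -> P i -> S (f i)) -> S (\sum_(i <- r | P i) f i).
Proof.
elim: r => [|i r IH] H; first by rewrite big_nil.
have H' : S (\sum_(i <- r | P i) f i) by apply: IH => j jr; apply: H; rewrite inE jr orbT.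
by rewrite big_cons; case: ifP => // Pi; apply: SD => //; apply: H => //; rewrite mem_head.
Qed.

Lemma mu0 a : (0 < a <= N)%N -> mu a 0 = 0.
Proof. by move=> aN; have := muZ 0 aN S0; rewrite !scale0r. Qed.

Lemma mu_sum a (I : eqType) (r : seq I) (P : pred I) (f : I -> V) : (0 < a <= N)%N ->
  (forall i, i \in r -> P i -> S (f i)) ->
  mu a (\sum_(i <- r | P i) f i) = \sum_(i <- r | P i) mu a (f i).
Proof.
move=> aN; elim: r => [|i r IH] H; first by rewrite !big_nil mu0.
have H' j : j \in r -> P j -> S (f j) by move=> jr; apply: H; rewrite inE jr orbT.
rewrite !big_cons; case: ifP => Pi; rewrite -IH // muD //.
  by apply: H => //; rewrite mem_head.
exact: S_sum.
Qed.

(** Course-of-values recursion: the list holds [F_0, ..., F_j]. At [lam = j] the inverse of zero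
    makes [F_j] the default value 0; at a positive integer [lam] only indices below [lam] are put to
    use. *)
Fixpoint Fseq (lam : R) (v : V) (j : nat) : seq V :=
  if j is i.+1 then
    rcons (Fseq lam v i) ((j%:R * (lam - j%:R))^-1 *:
      \sum_(1 <= a < j.+1) mu a (nth 0 (Fseq lam v i) (j - a)))
  else [:: v].

Definition Fsol (lam : R) (j : nat) (v : V) : V := nth 0 (Fseq lam v j) j.

Lemma size_Fseq lam v j : size (Fseq lam v j) = j.+1.
Proof. by elim: j => //= j IH; rewrite size_rcons IH. Qed.

Lemma nth_Fseq lam v i j : (i <= j)%N -> nth 0 (Fseq lam v j) i = Fsol lam i v.
Proof.
elim: j => [|j IH]; first by rewrite leqn0 => /eqP ->.
rewrite leq_eqVlt => /predU1P[-> //|ij]; rewrite /= nth_rcons size_Fseq ij.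
exact: IH.
Qed.

Lemma FsolS lam v j : (0 < j)%N -> Fsol lam j v =
  (j%:R * (lam - j%:R))^-1 *: \sum_(1 <= a < j.+1) mu a (Fsol lam (j - a) v).
Proof.
case: j => // j _; rewrite {1}/Fsol /= nth_rcons size_Fseq ltnn eqxx; congr (_ *: _).
by rewrite !big_nat; apply: eq_bigr => a /andP[a1 aj]; rewrite nth_Fseq //; lia.
Qed.

Lemma S_Fsol lam v j : S v -> (j <= N)%N -> S (Fsol lam j v).
Proof.
move=> Sv; elim/ltn_ind: j => -[|j] IH jN //; rewrite FsolS //.
apply: SZ; apply: S_sum => a; rewrite mem_index_iota => aj _.
by apply: muS; [lia|apply: IH; lia].
Qed.

Lemma FsolZ lam c v j : S v -> (j <= N)%N -> Fsol lam j (c *: v) = c *: Fsol lam j v.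
Proof.
move=> Sv; elim/ltn_ind: j => -[|j] IH jN //; rewrite !FsolS //.
rewrite [RHS]scalerA [in RHS](mulrC c) -[RHS]scalerA; congr (_ *: _); rewrite scaler_sumr !big_nat.
apply: eq_bigr => a aj; rewrite IH; [|lia|lia].
by rewrite muZ //; [lia|apply: S_Fsol => //; lia].
Qed.

Lemma Fsol_rec lam v j : (0 < j)%N -> lam != j%:R ->
  \sum_(1 <= a < j.+1) mu a (Fsol lam (j - a) v) = (j%:R * (lam - j%:R)) *: Fsol lam j v.
Proof.
move=> j0 lj; rewrite FsolS // scalerA mulfV ?scale1r //.
by rewrite mulf_neq0 ?subr_eq0 // pnatr_eq0 -lt0n.
Qed.

(** The right-hand side of the recursion at [lam = j], where the factor [j (lam - j)] vanishes: the
    obstruction to continuing the solution to order [j]. *)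
Definition pi_op (j : nat) (v : V) : V :=
  \sum_(1 <= a < j.+1) mu a (Fsol j%:R (j - a) v).

(** The residue of [F_j] at its newest pole [lam = j]. *)
Definition rho_op (j : nat) (v : V) : V := j%:R^-1 *: pi_op j v.

Lemma S_pi_op j v : S v -> (j <= N)%N -> S (pi_op j v).
Proof.
move=> Sv jN; apply: S_sum => a; rewrite mem_index_iota => aj _.
by apply: muS; [lia|apply: S_Fsol => //; lia].
Qed.

Lemma S_rho j v : S v -> (j <= N)%N -> S (rho_op j v).
Proof. by move=> Sv jN; apply: SZ; exact: S_pi_op. Qed.

Lemma pi_opZ j c v : S v -> (j <= N)%N -> pi_op j (c *: v) = c *: pi_op j v.
Proof.
move=> Sv jN; rewrite /pi_op scaler_sumr !big_nat; apply: eq_bigr => a aj.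
rewrite FsolZ //; last by lia.
by rewrite muZ //; [lia|apply: S_Fsol => //; lia].
Qed.

Lemma rhoZ j c v : S v -> (j <= N)%N -> rho_op j (c *: v) = c *: rho_op j v.
Proof. by move=> Sv jN; rewrite /rho_op pi_opZ // !scalerA mulrC. Qed.

(* The residue at [lam = k] of the rational function [Fsol lam j v] of [lam]. *)
Definition residue_term (j k : nat) (v : V) : V := Fsol (- k%:R) (j - k) (rho_op k v).

(** The constant term is present for [F_0 = v] only: as functions of [lam], the later [F_j] tend to
    zero at infinity. *)
Definition partial_fractions (lam : R) (j : nat) (v : V) : V :=
  (if j == 0%N then v else 0) + \sum_(1 <= k < j.+1) (lam - k%:R)^-1 *: residue_term j k v.

Lemma S_residue_term j k v : S v -> (j <= N)%N -> (k <= j)%N -> S (residue_term j k v).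
Proof. by move=> Sv jN kj; apply: S_Fsol; [apply: S_rho => //; lia|lia]. Qed.

Lemma sum_mu_partial_fractions lam j v : S v -> (0 < j <= N)%N ->
  \sum_(1 <= a < j.+1) mu a (partial_fractions lam (j - a) v) =
  mu j v - \sum_(1 <= k < j) (j%:R * (j%:R - k%:R) / (lam - k%:R)) *: residue_term j k v.
Proof.
move=> Sv /andP[j0 jN]; rewrite big_nat_recr //= subnn {2}/partial_fractions eqxx (@big_geq _ _ _ 1 1) // addr0.
rewrite addrC; congr (_ + _).
transitivity (\sum_(1 <= a < j) \sum_(1 <= k < (j - a).+1)
   (lam - k%:R)^-1 *: mu a (residue_term (j - a) k v)).
  rewrite !big_nat; apply: eq_bigr => a /andP[a1 aj].
  rewrite /partial_fractions (_ : (j - a == 0)%N = false); last by lia.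
  rewrite add0r mu_sum; [|lia|].
    rewrite !big_nat; apply: eq_bigr => k /andP[k1 kj].
    by rewrite muZ //; [lia|apply: S_residue_term => //; lia].
  move=> k; rewrite mem_index_iota => kj _; apply: SZ; apply: S_residue_term => //; lia.
rewrite triangle_exchange -sumrN !big_nat; apply: eq_bigr => k /andP[k1 kj].
rewrite -scaler_sumr -scaleNr.
have -> : \sum_(1 <= a < (j - k).+1) mu a (residue_term (j - a) k v) =
          \sum_(1 <= a < (j - k).+1) mu a (Fsol (- k%:R) ((j - k) - a) (rho_op k v)).
  by rewrite !big_nat; apply: eq_bigr => a aj; rewrite /residue_term subnAC.
(* The recursion at index [j - k] and parameter [- k] has the factor
   [(j - k) (- k - (j - k)) = - j (j - k)]. *)
rewrite Fsol_rec; [|lia|].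
  rewrite scalerA; congr (_ *: _).
  by rewrite natrB ?(ltnW kj) //; ring.
rewrite -subr_eq0 -opprD oppr_eq0 -natrD pnatr_eq0; lia.
Qed.

(** Conditional on the formula for [mu i] up to [j], whose proof in turn uses the expansion at
    smaller indices. *)
Lemma Fsol_partial_fractions j v : S v -> (j <= N)%N ->
  (forall i, (0 < i <= j)%N -> mu i v = i%:R *: \sum_(1 <= k < i.+1) residue_term i k v) ->
  forall lam, (forall i, (0 < i <= j)%N -> lam != i%:R) -> Fsol lam j v = partial_fractions lam j v.
Proof.
move=> Sv; elim/ltn_ind: j => -[|j] IH jN E lam lamj.
  by rewrite /partial_fractions eqxx big_geq // addr0.
rewrite FsolS //.
have -> : \sum_(1 <= a < j.+2) mu a (Fsol lam (j.+1 - a) v) =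
          \sum_(1 <= a < j.+2) mu a (partial_fractions lam (j.+1 - a) v).
  rewrite !big_nat; apply: eq_bigr => a aj; rewrite IH //; first by lia.
  - by lia.
  - by move=> i ij; apply: E; lia.
  - by move=> i ij; apply: lamj; lia.
(* In the formula for [mu j.+1] the term [k = j.+1] supplies the new pole; the other terms combine
   with the old poles by [residue_alg]. *)
rewrite sum_mu_partial_fractions // E ?leqnn // /partial_fractions add0r [in RHS]big_nat_recr //=.
rewrite [X in _ *: (_ *: X - _)]big_nat_recr //= (scalerDr j.+1%:R) addrAC scalerDr.
have lj : lam - j.+1%:R != 0 by rewrite subr_eq0 lamj ?leqnn.
have j0 : j.+1%:R != 0 :> R by rewrite pnatr_eq0.
congr (_ + _); last first.
  by rewrite scalerA; congr (_ *: _); rewrite invfM mulrAC mulVf ?mul1r.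
rewrite scaler_sumr -sumrB scaler_sumr !big_nat; apply: eq_bigr => k /andP[k1 kj].
have lk : lam - k%:R != 0 by rewrite subr_eq0 lamj //; lia.
rewrite -scalerBl scalerA; congr (_ *: _).
exact: residue_alg.
Qed.

(** The formula below [j] validates the expansions of all [F_i] with [i < j]. Inserted in [pi_op j]
    they give [mu j] minus [j] times the residue terms with [k < j], while [pi_op j] itself is [j]
    times the term with [k = j]. *)
Theorem mu_residue j v : S v -> (0 < j <= N)%N ->
  mu j v = j%:R *: \sum_(1 <= k < j.+1) residue_term j k v.
Proof.
move=> Sv; elim/ltn_ind: j => j IH jN; case/andP: (jN) => j0 jN'.
have j0' : j%:R != 0 :> R by rewrite pnatr_eq0 -lt0n.
(* [pi_op j] only involves [Fsol j%:R i] with [i < j], which is regular at [lam = j]. *)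
have : pi_op j v = mu j v - \sum_(1 <= k < j) j%:R *: residue_term j k v.
  transitivity (\sum_(1 <= a < j.+1) mu a (partial_fractions j%:R (j - a) v)).
    rewrite /pi_op !big_nat; apply: eq_bigr => a aj; rewrite Fsol_partial_fractions //; first by lia.
      by move=> i ij; apply: IH; lia.
    by move=> i ij; rewrite eqr_nat; lia.
  (* At [lam = j] the coefficient [j (j - k) / (lam - k)] reduces to [j]. *)
  rewrite sum_mu_partial_fractions //; congr (_ - _); rewrite !big_nat; apply: eq_bigr => k kj.
  by rewrite mulfK // subr_eq0 eqr_nat; lia.
have Gjj : residue_term j j v = rho_op j v by rewrite /residue_term subnn.
rewrite [in X in _ -> X]big_nat_recr //= Gjj /rho_op scalerDr scalerA mulfV // scale1r => ->.
by rewrite scaler_sumr addrC subrK.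
Qed.

(** There is no pole at [lam = - m]. The coefficient [1 / (- m - k)] is the origin of the factors
    [1 / (I_j + I_(j + 1))] and of the alternating sign. *)
Lemma Fsol_neg m j v : S v -> (0 < j <= N)%N ->
  Fsol (- m%:R) j v =
  - \sum_(1 <= k < j.+1) (k + m)%:R^-1 *: Fsol (- k%:R) (j - k) (rho_op k v).
Proof.
move=> Sv jN; rewrite Fsol_partial_fractions //; first last.
- by move=> i ij; rewrite -subr_eq0 -opprD oppr_eq0 -natrD pnatr_eq0; lia.
- by move=> i ij; apply: mu_residue => //; lia.
- by lia.
rewrite /partial_fractions (_ : (j == 0)%N = false); last by lia.
rewrite add0r -sumrN; apply: eq_bigr => k _.
by rewrite -scaleNr -opprD invrN natrD addrC.
Qed.

End Recursion.

(** * Enumeration of compositions *)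

Section Compositions.

(** The last part [k] is chosen before the others, since [rho_op k] is the operator applied first in
    each expansion step. Any [fuel] above [j] gives the same list. *)
Fixpoint comps_rec (fuel j : nat) : seq (seq nat) :=
  if fuel is fuel'.+1 then
    if j == 0%N then [:: [::]]
    else [seq rcons J k | k <- iota 1 j, J <- comps_rec fuel' (j - k)]
  else [::].

Definition comps (j : nat) := comps_rec j.+1 j.

Lemma comps_recE f f' j : (j < f)%N -> (j < f')%N -> comps_rec f j = comps_rec f' j.
Proof.
elim: f f' j => // f IH [//|f'] j jf jf' /=; case: eqP => // /eqP j0.
congr flatten; apply/eq_in_map => k; rewrite mem_iota => kj.
by rewrite (IH f') //; lia.
Qed.

Lemma compsE j : (0 < j)%N ->
  comps j = [seq rcons J k | k <- iota 1 j, J <- comps (j - k)].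
Proof.
move=> j0; rewrite {1}/comps /= (_ : (j == 0)%N = false); last by lia.
congr flatten; apply/eq_in_map => k; rewrite mem_iota => kj; congr map.
by apply: comps_recE; lia.
Qed.

Lemma mem_comps j I : (I \in comps j) = is_composition j I.
Proof.
elim/last_ind: I j => [|I k IH] j.
  rewrite /is_composition /=; case: j => // j; rewrite compsE //.
  by apply/negP => /allpairsPdep [k [I [_ _]]]; case: I.
rewrite /is_composition all_rcons sumn_rcons.
case: (posnP j) => [->|j0].
  rewrite inE; case: I {IH} => //= *; apply/esym/negbTE; lia.
rewrite compsE //; apply/allpairsPdep/idP.
  move=> [k' [I' [kj I'c /rcons_inj[eI ek]]]]; rewrite -{}eI -{}ek in kj I'c.
  move: I'c; rewrite IH /is_composition => /andP[-> /eqP ->].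
  by move: kj; rewrite mem_iota; lia.
move=> /andP[/andP[k1 aI] /eqP sI]; exists k, I; rewrite mem_iota IH /is_composition aI.
split=> //; lia.
Qed.

Lemma uniq_comps j : uniq (comps j).
Proof.
elim/ltn_ind: j => j IH; case: (posnP j) => [->//|j0]; rewrite compsE //.
apply: allpairs_uniq_dep; first exact: iota_uniq.
  by move=> k; rewrite mem_iota => kj; apply: IH; lia.
by move=> [k I] [k' I'] _ _ /= /rcons_inj[-> ->].
Qed.

Lemma leq_sumn_mem k (I : seq nat) : k \in I -> (k <= sumn I)%N.
Proof. by elim: I => //= i I IH; rewrite inE => /predU1P[->|/IH]; lia. Qed.

(** The parts lie between 1 and [N] and there are at most [N] of them, so the tuples of length up to
    [N] over ['I_N.+1] meet every composition exactly once. *)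
Lemma big_tuple_comps (V : nmodType) N (Q : pred (seq nat)) (c : seq nat -> V) :
  \sum_(l < N.+1) \sum_(I : l.-tuple 'I_N.+1 |
      is_composition N (map val I) && Q (map val I)) c (map val I) =
  \sum_(I <- comps N | Q I) c I.
Proof.
transitivity (\sum_(l < N.+1) \sum_(I <- comps N | Q I && (size I == l)) c I).
  apply: eq_bigr => l _; rewrite -[RHS]big_filter.
  pose f (I : l.-tuple 'I_N.+1) := map val I.
  transitivity (\sum_(x <- [seq f t | t in [pred t | is_composition N (f t) && Q (f t)]]) c x).
    by rewrite big_image.
  apply: perm_big; apply: uniq_perm.
  - rewrite map_inj_uniq ?enum_uniq // => t t' /(inj_map val_inj); exact: val_inj.
  - by rewrite filter_uniq // uniq_comps.
  move=> I; rewrite mem_filter mem_comps; apply/idP/idP.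
    case/fintype.imageP => t tP It; rewrite It; move: tP; rewrite inE => /andP[-> ->].
    by rewrite size_map size_tuple eqxx.
  move=> /andP[/andP[QI /eqP sI] cI].
  have [t tI] : exists t : l.-tuple 'I_N.+1, map val t = I.
    rewrite -sI; exists (map_tuple (fun k => inord k) (in_tuple I)).
    rewrite /= -map_comp -[RHS]map_id; apply/eq_in_map => k kI /=.
    rewrite inordK // ltnS; case/andP: cI => _ /eqP <-.
    exact: leq_sumn_mem.
  by apply/fintype.imageP; exists t; rewrite ?inE /f tI // cI QI.
rewrite (exchange_big_dep Q) /=; last by move=> l I _ /andP[].
rewrite big_seq_cond [RHS]big_seq_cond; apply: eq_bigr => I /andP[Ic QI].
have sI : (size I < N.+1)%N.
  move: Ic; rewrite mem_comps => /andP[aI /eqP <-]; rewrite ltnS.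
  elim: I aI {QI} => //= k I IH /andP[k1 /IH]; lia.
rewrite (big_pred1 (Ordinal sI)) // => l /=.
by rewrite QI eq_sym.
Qed.

End Compositions.

(** * The sum over compositions and the constants [m_I] *)

Section Inversion.
Variables (R : realType) (V : lmodType R) (S : V -> Prop) (N : nat).
Variable mu : nat -> V -> V.
Hypothesis S0 : S 0.
Hypothesis SD : forall u v, S u -> S v -> S (u + v).
Hypothesis SZ : forall c u, S u -> S (c *: u).
Hypothesis muS : forall a u, (0 < a <= N)%N -> S u -> S (mu a u).
Hypothesis muD : forall a u v, (0 < a <= N)%N -> S u -> S v -> mu a (u + v) = mu a u + mu a v.
Hypothesis muZ : forall a c u, (0 < a <= N)%N -> S u -> mu a (c *: u) = c *: mu a u.
Local Notation rho := (rho_op mu).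
Local Notation Fsol := (Fsol mu).

Definition adjprod (I : seq nat) : R :=
  \prod_(j < (size I).-1) (nth 0%N I j + nth 0%N I j.+1)%:R^-1.

Lemma adjprod_rcons I k m :
  adjprod (rcons (rcons I k) m) = adjprod (rcons I k) * (k + m)%:R^-1.
Proof.
rewrite /adjprod !size_rcons /= big_ord_recr /=; congr (_ * _).
  apply: eq_bigr => i _; have iI := ltn_ord i.
  by rewrite !(nth_rcons _ (rcons I k)) size_rcons !ifT //; lia.
rewrite !(nth_rcons _ (rcons I k)) size_rcons ltnSn ltnn eqxx.
by rewrite nth_rcons ltnn eqxx.
Qed.

Lemma adjprod1 m : adjprod [:: m] = 1.
Proof. by rewrite /adjprod big_ord0. Qed.

(** Iteration of [Fsol_neg]. The parameter [m] acts as the part that follows the composition, whence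
    [rcons I m] in the product of neighbouring sums. *)
Lemma Fsol_comps m j v : S v -> (j <= N)%N ->
  Fsol (- m%:R) j v =
  \sum_(I <- comps j) ((-1) ^+ size I * adjprod (rcons I m)) *: op_comp rho I v.
Proof.
elim/ltn_ind: j m v => j IH m v Sv jN; case: (posnP j) => [->|j0].
  by rewrite /comps /= big_seq1 /= adjprod1 mulr1 expr0 scale1r.
rewrite (Fsol_neg S0 SD SZ muS muD muZ) //; last by rewrite j0.
rewrite compsE // big_allpairs_dep -sumrN /index_iota subn1 /=.
rewrite big_seq [RHS]big_seq; apply: eq_bigr => k; rewrite mem_iota => kj.
rewrite IH; [|lia| |lia]; last by apply: (S_rho S0 SD SZ muS) => //; lia.
rewrite scaler_sumr -sumrN; apply: eq_bigr => I _.
rewrite -scaleNr scalerA adjprod_rcons size_rcons exprS.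
rewrite (_ : op_comp rho (rcons I k) v = op_comp rho I (rho k v)).
  by congr (_ *: _); ring.
by rewrite /op_comp foldr_rcons; elim: (I) => //= i I' ->.
Qed.

Lemma mu_comps v : S v -> (0 < N)%N ->
  mu N v = N%:R *: \sum_(I <- comps N) ((-1) ^+ (size I).+1 * adjprod I) *: op_comp rho I v.
Proof.
move=> Sv N0; rewrite (mu_residue S0 SD SZ muS muD muZ) // ?N0 ?leqnn //; congr (_ *: _).
rewrite compsE // big_allpairs_dep /index_iota subn1 /=.
rewrite big_seq [RHS]big_seq; apply: eq_bigr => k; rewrite mem_iota => kj.
rewrite /residue_term Fsol_comps; [|by apply: (S_rho S0 SD SZ muS) => //; lia|lia].
apply: eq_bigr => I _; rewrite size_rcons !exprS !mulN1r opprK.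
by congr (_ *: _); rewrite /op_comp foldr_rcons; elim: (I) => //= i I' ->.
Qed.

Variable P : nat -> V -> V.
Hypothesis PE : forall k v, (0 < k <= N)%N -> S v ->
  P k v = (k.-1)`!%:R ^+ 2 *: pi_op mu k v.

(** The source of the factorials in [m_coef]: [rho_op k] is [P k] divided by
    [k (k - 1)!^2 = k! (k - 1)!]. *)
Lemma op_comp_rho I v : S v -> all (fun k => 0 < k <= N)%N I ->
  S (op_comp P I v) /\
  op_comp rho I v = (\prod_(k <- I) (k`!%:R * (k.-1)`!%:R)^-1) *: op_comp P I v.
Proof.
move=> Sv; elim: I => [|k I IH] /=; first by rewrite big_nil scale1r.
move=> /andP[kN /IH [SI E]]; case/andP: (kN) => k0 kN'.
have Spi := S_pi_op S0 SD SZ muS SI kN'.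
split; first by rewrite PE //; exact: SZ.
rewrite [RHS]/= E (rhoZ S0 SD SZ muS muZ _ SI kN') big_cons mulrC -scalerA; congr (_ *: _).
rewrite /rho_op PE // scalerA; congr (_ *: _).
case: k k0 {kN kN' Spi} => // k _; rewrite factS natrM /=.
have k1 : k.+1%:R != 0 :> R by rewrite pnatr_eq0.
have f0 : k`!%:R != 0 :> R by rewrite pnatr_eq0 -lt0n fact_gt0.
by move: (k.+1%:R) (k`!%:R) k1 f0 => a b a0 b0; field; rewrite a0 b0.
Qed.

(** The prefactor [N! (N - 1)!] of [m_coef] is [(N - 1)!^2] times the [N] of [mu_comps]. The
    one-term composition is kept in the sum. *)
Theorem inversion v : S v -> (0 < N)%N ->
  \sum_(I <- comps N) m_coef R I *: op_comp P I v = (N.-1)`!%:R ^+ 2 *: mu N v.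
Proof.
move=> Sv N0; rewrite mu_comps // scalerA scaler_sumr big_seq [RHS]big_seq.
apply: eq_bigr => I; rewrite mem_comps => /andP[aI /eqP sI].
have aN : all (fun k => 0 < k <= N)%N I.
  apply/allP => k kI; rewrite (allP aI) // -sI.
  exact: leq_sumn_mem.
have [_ ->] := op_comp_rho Sv aN.
rewrite !scalerA /m_coef sI; congr (_ *: _); rewrite -/(adjprod I).
have -> : N`!%:R = N%:R * (N.-1)`!%:R :> R by rewrite -natrM -[in LHS](prednK N0) factS prednK.
ring.
Qed.

Theorem inversion_tuple v : S v -> (0 < N)%N ->
  P N v = - (\sum_(l < N.+1) \sum_(I : l.-tuple 'I_N.+1 |
     is_composition N (map val I) && (map val I != [:: N]))
       m_coef R (map val I) *: op_comp P (map val I) v) + (N.-1)`!%:R ^+ 2 *: mu N v.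
Proof.
move=> Sv N0; rewrite -inversion //.
rewrite (big_tuple_comps N (fun I => I != [:: N]) (fun I => m_coef R I *: op_comp P I v)).
have Nc : [:: N] \in comps N by rewrite mem_comps /is_composition /= N0 addn0 eqxx.
rewrite [in RHS](bigD1_seq [:: N]) ?uniq_comps //= [RHS]addrC addrK.
(* The one-term composition has coefficient 1: the factorials cancel and the sign is [(-1)^2]. *)
rewrite /m_coef /= addn0 big_seq1 big_ord0 mulr1 sqrrN expr1n mul1r mulfV ?scale1r //.
Qed.

End Inversion.

(** * GJMS operators on the manifold *)

Section Signature.
Variables (R : realType) (n p q : nat).

Lemma has_signature_sym (A : 'M[R]_n) : has_signature p q A -> A^T = A.
Proof.
move=> [_ [B Bu E]].
have E' : B *m A^T *m B^T = B *m A *m B^T.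
  by have := congr1 trmx E; rewrite !trmx_mul trmxK mulmxA tr_diag_mx E.
apply: (can_inj (mulKmx Bu)).
have BTu : B^T \in unitmx by rewrite unitmx_tr.
exact: (can_inj (mulmxK BTu)).
Qed.

(** Congruence multiplies the determinant by a positive square, so its sign depends on the signature
    alone. *)
Lemma has_signature_det (A : 'M[R]_n) : has_signature p q A ->
  exists2 b : R, 0 < b & \det A = b * \prod_(i < n) (if (i < p)%N then 1 else -1).
Proof.
move=> [_ [B Bu E]].
have b0 : \det B != 0 by move: Bu; rewrite unitmxE unitfE.
exists ((\det B ^+ 2)^-1); first by rewrite invr_gt0 exprn_even_gt0.
have := congr1 determinant E; rewrite !det_mulmx det_tr det_diag.
under [in X in _ = X -> _]eq_bigr => i _ do rewrite mxE.
by move=> <-; field.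
Qed.

Lemma sign_prod_neq0 : \prod_(i < n) (if (i < p)%N then 1 else -1) != 0 :> R.
Proof.
by apply/prodf_neq0 => i _; case: ifP => _; rewrite ?oppr_eq0 oner_eq0.
Qed.

Lemma has_signature_unit (A : 'M[R]_n) : has_signature p q A -> A \in unitmx.
Proof.
move=> /has_signature_det [b b0 dA]; rewrite unitmxE unitfE dA.
by apply: mulf_neq0; [rewrite gt_eqF|exact: sign_prod_neq0].
Qed.

Lemma has_signature_ratio (A B : 'M[R]_n) : has_signature p q A -> has_signature p q B ->
  0 < \det A / \det B.
Proof.
move=> /has_signature_det [a a0 ->] /has_signature_det [b b0 ->].
rewrite -mulf_div mulfV ?mulr1 ?divr_gt0 //; exact: sign_prod_neq0.
Qed.

End Signature.

(** * Linearity of [M(r)] over functions of [rho] *)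

Section MtLinear.
Variables (R : realType) (n : nat) (gr : R -> 'rV[R]_n -> 'M[R]_n).
Variables (g : 'rV[R]_n -> 'M[R]_n) (U0 : set 'rV[R]_n) (eps : R).
Hypothesis reg : regular_family gr g U0 eps.
Local Notation U := (cyldom U0 eps).
Let oU0 := rf_open reg.
Let eps0 := rf_eps reg.
Let oU : open U := @open_cyldom _ _ _ eps oU0.

Lemma gradD F H i z : smooth_on U F -> smooth_on U H -> U z ->
  grad gr (fun z => F z + H z) i z = grad gr F i z + grad gr H i z.
Proof.
move=> Fs Hs Uz; rewrite /grad -big_split; apply: eq_bigr => j _ /=.
by rewrite (partialD _ Fs Hs Uz) mulrDr.
Qed.

Lemma LopD F H z : smooth_on U F -> smooth_on U H -> U z ->
  Lop gr g (fun z => F z + H z) z = Lop gr g F z + Lop gr g H z.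
Proof.
move=> Fs Hs Uz.
transitivity (\sum_i (partial (ix i) (grad gr F i) z + partial (ix i) (grad gr H i) z) +
   \sum_k (tau0 g z k * grad gr F k z + tau0 g z k * grad gr H k z)).
  apply: (congr2 +%R); apply: eq_bigr => i _.
    rewrite (partial_ext _ oU (fun y Uy => gradD i Fs Hs Uy) Uz).
    by rewrite (partialD _ (smooth_grad reg i Fs) (smooth_grad reg i Hs) Uz).
  by rewrite gradD // mulrDr.
rewrite big_split big_split; exact: addrACA.
Qed.

Lemma MtD F H z : smooth_on U F -> smooth_on U H -> U z ->
  Mt gr g (fun z => F z + H z) z = Mt gr g F z + Mt gr g H z.
Proof.
by move=> Fs Hs Uz; rewrite /Mt LopD // mulrDr opprD addrACA.
Qed.

(** [M(r)] differentiates tangentially only, so it commutes with multiplication by functions of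
    [rho], in particular by powers of [s]. *)
Lemma Mt_rhoM phi F z : (forall i y, U y -> partial (ix i) phi y = 0) ->
  smooth_on U phi -> smooth_on U F -> U z ->
  Mt gr g (fun z => phi z * F z) z = phi z * Mt gr g F z.
Proof.
move=> dphi ps Fs Uz.
have g0 i y : U y -> grad gr phi i y = 0.
  by move=> Uy; rewrite /grad big1 // => j _; rewrite dphi // mulr0.
have L0 : Lop gr g phi z = 0.
  rewrite /Lop big1 => [|i _].
    by rewrite add0r big1 // => k _; rewrite g0 // mulr0.
  by rewrite (partial_ext (v := fun=> 0) _ oU (g0 i) Uz) partial_cst.
have G0 : grad_pair gr phi F z = 0.
  by rewrite /grad_pair big1 // => i _; rewrite dphi // mul0r.
rewrite /Mt (LopM reg ps Fs Uz) L0 G0 !mulr0 !addr0 mulrBr; congr (_ - _).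
by rewrite mulrCA.
Qed.

Lemma dx_sX j i y : U y -> partial (ix i) (fun z => (- (cyl_s z / 2)) ^+ j) y = 0.
Proof.
have ss : smooth_on U (fun z : 'rV[R]_(n + 1) => - (cyl_s z / 2)) by exact: smooth_s.
have ds y' : U y' -> partial (ix i) (fun z => - (cyl_s z / 2)) y' = 0.
  move=> Uy'.
  transitivity (partial (ix i) (fun z : 'rV[R]_(n + 1) => - 2^-1 * z 0 (irho n)) y').
    by apply: (congr1 (fun u => partial (ix i) u y')); apply/funext => z';
       rewrite cyl_s_coord mulNr mulrC.
  rewrite (partialZ _ (@smooth_coord _ _ U _) Uy') partial_coord.
  by rewrite /ix /irho eq_lrshift mulr0.
elim: j y => [|j IH] y Uy.
  transitivity (partial (ix i) (fun=> 1) y); last exact: partial_cst.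
  by apply: (partial_ext _ oU _ Uy) => z _; rewrite expr0.
transitivity (partial (ix i) (fun z => - (cyl_s z / 2) * (- (cyl_s z / 2)) ^+ j) y).
  by apply: (partial_ext _ oU _ Uy) => z _; rewrite exprS.
by rewrite (partialM _ ss (smoothX oU j ss) Uy) ds // IH // mul0r mulr0 addr0.
Qed.

Lemma Mt_sum (I : Type) (r : seq I) (F : I -> 'rV[R]_(n + 1) -> R) z :
  (forall k, smooth_on U (F k)) -> U z ->
  Mt gr g (fun z => \sum_(k <- r) F k z) z = \sum_(k <- r) Mt gr g (F k) z.
Proof.
move=> Fs; elim: r z => [|k r IH] z Uz.
  have c0 : smooth_on U (fun=> 0 : R) by exact: smooth_cst.
  (* The zero function, written as a product with 0, falls under [Mt_rhoM]. *)
  transitivity (Mt gr g (fun z => (fun=> 0) z * (fun=> 0) z) z).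
    by apply: (congr1 (fun u => Mt gr g u z)); apply/funext => y; rewrite big_nil mul0r.
  rewrite (Mt_rhoM _ c0 c0 Uz) ?mul0r ?big_nil // => i y _; exact: partial_cst.
rewrite big_cons -IH // -MtD //; last exact: smooth_sum.
by apply: (congr1 (fun u => Mt gr g u z)); apply/funext => y; rewrite big_cons.
Qed.

End MtLinear.

(** * From charts to the manifold *)

Section Assembly.
Variables (R : realType) (n p q : nat) (M : manifold R n).
Variables (g : chart_index M -> 'rV[R]_n -> 'M[R]_n) (hg : is_metric p q g).
Variables (eps : R) (heps : 0 < eps).
Variable gr : chart_index M -> R -> 'rV[R]_n -> 'M[R]_n.
Hypothesis metric_gr : forall rho, - eps < rho < eps -> is_metric p q (fun a => gr a rho).
Hypothesis smooth_gr : forall a i j, smooth_on (cylinder a eps)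
        (fun z => gr a (cyl_s z) (cyl_x z) i j).
Hypothesis init_gr : forall a y, cod a y -> gr a 0 y = g a y.

Let ocod (a : chart_index M) : open (cod a). Proof. exact: open_cod. Qed.

Lemma cod_chart (a : chart_index M) x : dom a x -> cod a (chart a x).
Proof. by move=> ax; exists x. Qed.

Lemma cod_inv (a : chart_index M) y : cod a y -> dom a (chart_inv a y) /\ chart a (chart_inv a y) = y.
Proof. by move=> [x ax <-]; rewrite chartK. Qed.

Lemma reg a : regular_family (gr a) (g a) (cod a) eps.
Proof.
have sig z : cyldom (cod a) eps z -> has_signature p q (cylG (gr a) z).
  by move=> [Uz es]; have [H _ _] := metric_gr es; exact: H.
have [gsig gs _] := hg.
split=> //.
- by move=> i j; exact: smooth_gr.
- by move=> z Uz; exact: has_signature_unit (sig z Uz).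
- by move=> z Uz; exact: has_signature_sym (sig z Uz).
- by move=> y; exact: init_gr.
- by move=> z Uz; apply: has_signature_ratio (sig z Uz) (gsig a _ _); case: Uz.
Qed.

Local Notation U a := (cyldom (cod a) eps).
Let oU a : open (U a) := @open_cyldom _ _ _ eps (rf_open (reg a)).

Definition chart_of (x : M) : chart_index M := sval (cid (chart_cover x)).

Lemma dom_chart_of x : dom (chart_of x) x.
Proof. exact: (svalP (cid (chart_cover x))). Qed.

(** The extension fed to [is_gjms] must be a function on the manifold times an interval, so [w] is
    needed there and not just in charts; the chart used at each point is an arbitrary choice. *)
Definition wM (x : M) (s : R) : R :=
  Wcyl (gr (chart_of x)) (g (chart_of x)) (cpt (chart (chart_of x) x) s).

(** Both determinants change by the square of the same Jacobian, so their ratio does not depend on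
    the chart. *)
Lemma wME a x s : dom a x -> - eps < s < eps ->
  wM x s = Wcyl (gr a) (g a) (cpt (chart a x) s).
Proof.
move=> ax es; rewrite /wM; set b := chart_of x; have bx : dom b x := dom_chart_of x.
rewrite /Wcyl /cylG !cyl_xE !cyl_sE; congr (Num.sqrt (Num.sqrt _)).
have [_ _ gJ] := hg; have [_ _ hJ] := metric_gr es.
have := congr1 determinant (hJ b a x bx ax); have := congr1 determinant (gJ b a x bx ax).
have := detg0 (reg b) (cyldom0 heps (cod_chart bx)); rewrite cyl_xE.
have := detg0 (reg a) (cyldom0 heps (cod_chart ax)); rewrite cyl_xE.
rewrite /= !det_mulmx !det_tr; set J := \det (jacobian _ _).
move=> a0 b0 Eg ->; move: b0; rewrite Eg => b0.
have J0 : J != 0 by move: b0; rewrite !mulf_eq0 !negb_or => /andP[/andP[]].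
by field; rewrite a0 J0.
Qed.

Lemma smooth0 : smooth (0 : M -> R).
Proof. by move=> a; exact: smooth_cst. Qed.

Lemma smoothMD (u v : M -> R) : smooth u -> smooth v -> smooth (u + v).
Proof. by move=> us vs a; exact: (smoothD (@ocod a) (us a) (vs a)). Qed.

Lemma smoothMZ c (u : M -> R) : smooth u -> smooth (c *: u).
Proof.
move=> us a.
have cs : smooth_on (cod a) (fun=> c) by exact: smooth_cst.
exact: (smoothM (@ocod a) cs (us a)).
Qed.

Definition pull (a : chart_index M) (u : M -> R) (z : 'rV[R]_(n + 1)) : R :=
  u (chart_inv a (cyl_x z)).

Lemma smooth_pullM a u : smooth u -> smooth_on (U a) (pull a u).
Proof. by move=> us; exact: (@smooth_pull R n _ eps (fun y => u (chart_inv a y)) (us a)). Qed.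

Variable Mop : nat -> (M -> R) -> (M -> R).
Hypothesis hM : is_calM_coefficients g gr Mop.
Variable N : nat.
Hypothesis hN : admissible n N.

Lemma admissibleW k : (0 < k <= N)%N -> admissible n k.
Proof.
move=> /andP[k0 kN]; move: hN; rewrite /admissible k0 => /andP[_ H] /=.
by apply/implyP => nn; move/implyP: H => /(_ nn); exact: leq_trans.
Qed.

Definition mu (k : nat) (u : M -> R) : M -> R := ((k.-1)`!%:R ^+ 2)^-1 *: Mop k u.

(** Turns the pointwise asymptotic hypothesis on [Mop] into a Taylor coefficient of a smooth
    function; the smoothness and linearity of [mu k] follow from it. *)
Lemma mu_chart k u a x : (0 < k <= N)%N -> smooth u -> dom a x ->
  mu k u x = tcoef k.-1 (Mt (gr a) (g a) (pull a u)) (chart a x).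
Proof.
move=> kN us ax; have cx := cod_chart ax.
pose b i := mu i.+1 u x.
rewrite (@identify_tcoef _ _ _ _ (@ocod a) heps _ cx N _ b) //; first last.
- by lia.
- move=> K KN.
  have H := @hM u us a x ax K.+1 (admissibleW (_ : (0 < K.+1 <= N)%N)).
  apply/eqoP => e e0; have /eqoP/(_ e e0) := H KN.
  have Nr : \forall r \near 0^'+, 0 < r /\ r ^+ 2 / 2 < eps.
    near=> r; split; first by near: r; exact: nbhs_right_gt.
    have r0 : 0 < r by near: r; exact: nbhs_right_gt.
    have r1 : r < 1 by near: r; apply: nbhs_right_lt.
    have re : r < eps by near: r; apply: nbhs_right_lt.
    have rr : r ^+ 2 < r by rewrite expr2 gtr_pMl.
    by lra.
  move: Nr; apply: filterS2 => r [r0 re].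
  rewrite (calME (reg a) _ cx r0 re) => H1.
  move: H1; congr (`| _ - _ | <= _).
  rewrite big_add1 /= big_mkord; apply: eq_bigr => i _.
  by rewrite (_ : b i = (i`!%:R ^+ 2)^-1 * Mop i.+1 u x) // [in RHS](mulrC _ (Mop _ _ _)).
- by apply: (smooth_Mt (reg a)); exact: smooth_pullM.
by rewrite /b prednK //; case/andP: kN.
Unshelve. all: by end_near. Qed.

Lemma smooth_mu k u : (0 < k <= N)%N -> smooth u -> smooth (mu k u).
Proof.
move=> kN us a.
have ms := smooth_Mt (reg a) (@smooth_pullM a _ us).
apply: (smooth_on_ext (@ocod a) _ (smooth_tcoef (rf_open (reg a)) heps k.-1 ms)).
by move=> y /cod_inv [ay yE]; rewrite (mu_chart kN us ay) yE.
Qed.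

Lemma muMD k u v : (0 < k <= N)%N -> smooth u -> smooth v -> mu k (u + v) = mu k u + mu k v.
Proof.
move=> kN us vs; apply/funext => x; have ax := dom_chart_of x; set a := chart_of x in ax.
have cx := cod_chart ax.
rewrite -[RHS]/(mu k u x + mu k v x) (mu_chart kN (smoothMD us vs) ax).
rewrite (mu_chart kN us ax) (mu_chart kN vs ax).
have pu := @smooth_pullM a _ us; have pv := @smooth_pullM a _ vs.
rewrite -(tcoefD (rf_open (reg a)) heps _ (smooth_Mt (reg a) pu) (smooth_Mt (reg a) pv) cx).
apply: (tcoef_ext (rf_open (reg a)) heps _ _ cx) => z Uz.
exact: (MtD (reg a) pu pv Uz).
Qed.

Lemma muMZ k c u : (0 < k <= N)%N -> smooth u -> mu k (c *: u) = c *: mu k u.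
Proof.
move=> kN us; apply/funext => x; have ax := dom_chart_of x; set a := chart_of x in ax.
have cx := cod_chart ax.
rewrite -[RHS]/(c * mu k u x) (mu_chart kN (smoothMZ c us) ax) (mu_chart kN us ax).
have pu := @smooth_pullM a _ us.
rewrite -(tcoefZ (rf_open (reg a)) heps _ _ (smooth_Mt (reg a) pu) cx).
apply: (tcoef_ext (rf_open (reg a)) heps _ _ cx) => z Uz.
apply: (Mt_rhoM (reg a) (phi := fun=> c) _ _ pu Uz); last exact: smooth_cst.
by move=> i y _; exact: partial_cst.
Qed.

Local Notation Fs := (Fsol mu).

Lemma smooth_Fs lam j u : smooth u -> (j <= N)%N -> smooth (Fs lam j u).
Proof. exact: (S_Fsol smooth0 smoothMD smoothMZ smooth_mu). Qed.

Section GJMS.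
Variables (k : nat) (u : M -> R).
Hypotheses (kN : (0 < k <= N)%N) (us : smooth u).

(** The extension adapted to the weight [k - n / 2]: the sum stops before index [k], where the
    recursion at [lam = k] breaks down. [Hext] is its numerator in a chart. *)
Definition extension (x : M) (s : R) : R :=
  (\sum_(j < k) (- (s / 2)) ^+ j * Fs k%:R j u x) * (wM x s)^-1.

Definition Hext (a : chart_index M) (z : 'rV[R]_(n + 1)) : R :=
  \sum_(j < k) (- (cyl_s z / 2)) ^+ j * pull a (Fs k%:R j u) z.

Let smoothF (j : 'I_k) : smooth (Fs k%:R j u).
Proof. by apply: smooth_Fs => //; have := ltn_ord j; case/andP: kN; lia. Qed.

Let smooth_pF a (j : 'I_k) : smooth_on (U a) (pull a (Fs k%:R j u)).
Proof. exact: smooth_pullM. Qed.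

Let smooth_sX (a : chart_index M) j : smooth_on (U a) (fun z : 'rV[R]_(n + 1) => (- (cyl_s z / 2)) ^+ j).
Proof. by apply: (smoothX (@oU a)); exact: (@smooth_s R n _ eps (@ocod a)). Qed.

Let smooth_sF a (j : 'I_k) :
  smooth_on (U a) (fun z => (- (cyl_s z / 2)) ^+ j * pull a (Fs k%:R j u) z).
Proof. exact: (smoothM (@oU a)). Qed.

Lemma smooth_Hext a : smooth_on (U a) (Hext a).
Proof. exact: (smooth_sum (@oU a)). Qed.

Lemma extensionE a z : U a z ->
  extension (chart_inv a (cyl_x z)) (cyl_s z) = Hext a z * (Wcyl (gr a) (g a) z)^-1.
Proof.
move=> [Uz es]; have [ax xz] := cod_inv Uz.
by rewrite /extension (wME ax es) xz cptE.
Qed.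

Lemma smooth_extension : smooth_cyl eps extension.
Proof.
move=> a.
have HW := smoothM (@oU a) (@smooth_Hext a) (smooth_Wcyl_inv (reg a)).
by apply: (smooth_on_ext (@oU a) _ HW) => z Uz; rewrite extensionE.
Qed.

Lemma extension0 x : extension x 0 = u x.
Proof.
have ax := dom_chart_of x.
rewrite /extension (wME ax); last by rewrite oppr_lt0 heps.
rewrite (w0 (reg (chart_of x)) (cod_chart ax)) invr1 mulr1 mul0r oppr0.
case/andP: kN; case: (k) => // k' _ _.
rewrite big_ord_recl expr0 mul1r big1 ?addr0 // => i _.
by rewrite expr0n /= mul0r.
Qed.

Lemma tcoef_Hext a x j : dom a x ->
  tcoef j (Hext a) (chart a x) = if (j < k)%N then Fs k%:R j u x else 0.
Proof.
move=> ax; have cx := cod_chart ax.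
rewrite (tcoef_sum (@ocod a) heps _ _ (@smooth_sF a) cx).
have E (i : 'I_k) : tcoef j (fun z => (- (cyl_s z / 2)) ^+ i * pull a (Fs k%:R i u) z) (chart a x)
    = if i == j :> nat then Fs k%:R j u x else 0.
  rewrite (tcoef_sXM (@ocod a) heps _ _ (@smooth_pF a i) cx).
  rewrite (tcoef_pull _ (fun y => Fs k%:R i u (chart_inv a y)) cx) chartK //.
  case: ltngtP => [ij|//|->]; first by rewrite -(subnSK ij).
  by rewrite subnn.
under eq_bigr => i _ do rewrite E.
rewrite -big_mkcond; case: ltnP => jk.
  by rewrite (big_pred1 (Ordinal jk)).
by rewrite big_pred0 // => i; have := ltn_ord i; lia.
Qed.

(** The Cauchy product of the expansions of [M(r)] and [Hext]; truncating [Hext] at [j < k] does not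
    affect orders [e < k]. *)
Lemma tcoef_Mt_Hext a x e : dom a x -> (e < k)%N ->
  tcoef e (Mt (gr a) (g a) (Hext a)) (chart a x) =
  (\sum_(1 <= i < e.+2) mu i (Fs k%:R (e.+1 - i) u)) x.
Proof.
move=> ax ek; have cx := cod_chart ax; have rg := reg a.
have Ms (j : 'I_k) : smooth_on (U a) (Mt (gr a) (g a) (pull a (Fs k%:R j u))).
  exact: (smooth_Mt rg).
have sMs (j : 'I_k) : smooth_on (U a) (fun z =>
    (- (cyl_s z / 2)) ^+ j * Mt (gr a) (g a) (pull a (Fs k%:R j u)) z).
  exact: (smoothM (@oU a)).
transitivity (tcoef e (fun z => \sum_(j < k) (- (cyl_s z / 2)) ^+ j *
     Mt (gr a) (g a) (pull a (Fs k%:R j u)) z) (chart a x)).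
  apply: (tcoef_ext (@ocod a) heps _ _ cx) => z Uz.
  rewrite (Mt_sum rg _ (@smooth_sF a) Uz); apply: eq_bigr => j _.
  apply: (Mt_rhoM rg _ _ _ Uz) => // i y Uy.
  exact: (dx_sX rg).
rewrite (tcoef_sum (@ocod a) heps _ _ sMs cx).
transitivity (\sum_(j < k | (j <= e)%N) mu (e - j).+1 (Fs k%:R j u) x).
  rewrite [RHS]big_mkcond; apply: eq_bigr => j _.
  rewrite (tcoef_sXM (@ocod a) heps _ _ (Ms j) cx); case: leqP => // je.
  rewrite (mu_chart _ (smoothF j) ax) //=; case/andP: kN; lia.
rewrite -(big_ord_widen_cond k xpredT (fun j => mu (e - j).+1 (Fs k%:R j u) x) ek).
rewrite fct_sumE big_add1 /= big_mkord [RHS](reindex_inj rev_ord_inj) /=.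
apply: eq_bigr => j _; have je := ltn_ord j.
by rewrite subSS (_ : e.+1 - (e - j).+1 = j)%N //; lia.
Qed.

Let gam : R := k%:R - n%:R / 2.

(** The indicial factor [(e + 1) (e + 1 - k)] is the negative of the factor in the recursion, so all
    orders below [k - 1] cancel; at [e = k - 1] it vanishes and [pi_op k] is left over. *)
Lemma tcoef_Dop_Hext a x e : dom a x -> (e < k)%N ->
  tcoef e (Diter (gr a) (g a) gam 1 (Hext a)) (chart a x) =
  if e == k.-1 then pi_op mu k u x else 0.
Proof.
move=> ax ek; have cx := cod_chart ax; have rg := reg a.
have Hs := @smooth_Hext a.
rewrite /= (tcoef_Dop rg _ _ Hs cx) (tcoef_Mt_Hext ax ek) (tcoef_Hext _ ax).
have cE : (2 * (gam - 2 * 0%:R) + n%:R - 2) / 2 = k%:R - 1 by rewrite /gam; field.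
rewrite cE; case: eqP => [eE|/eqP eE].
  have ke : k = e.+1 by rewrite eE prednK //; case/andP: kN.
  have -> : e%:R - (k%:R - 1) = 0 :> R by rewrite ke -natr1; ring.
  by rewrite mulr0 mul0r add0r /pi_op -ke.
have ek' : (e.+1 < k)%N by lia.
rewrite ek' (Fsol_rec mu _ _) //; last by rewrite eqr_nat; lia.
rewrite -[X in _ + X]/(e.+1%:R * (k%:R - e.+1%:R) * Fs k%:R e.+1 u x).
rewrite -mulrDl -mulrDr -natr1 (_ : e%:R - (k%:R - 1) + (k%:R - (e%:R + 1)) = 0) ?mulr0 ?mul0r //.
by ring.
Qed.

Variable P : (M -> R) -> (M -> R).
Hypothesis hP : is_gjms eps gr k P.

Lemma gjmsE : P u = (k.-1)`!%:R ^+ 2 *: pi_op mu k u.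
Proof.
apply/funext => x; have ax := dom_chart_of x; set a := chart_of x in ax.
have cx := cod_chart ax; have rg := reg a; have Hs := @smooth_Hext a.
have k0 : (0 < k)%N by case/andP: kN.
(* [is_gjms] speaks of every smooth extension of [u]; it is used for the one built from the
   recursion. *)
rewrite (hP us smooth_extension extension0 ax).
have uE Z : ambdom (U a) Z ->
    amb_t Z `^ gam * extension (chart_inv a (amb_x Z)) (amb_rho Z) =
    amb_t Z `^ gam * (Hext a (rsubmx Z) * (Wcyl (gr a) (g a) (rsubmx Z))^-1).
  by move=> [_ UZ]; rewrite /amb_x /amb_rho extensionE.
have Z0 : ambdom (U a) (amb_point 1 (chart a x) 0).
  rewrite /amb_point -/(cpt (chart a x) 0) -/(apt 1 (cpt (chart a x) 0)).
  by rewrite /ambdom /= amb_tE amb_zE; split=> //; exact: (cyldom0 heps).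
rewrite (iter_laplacian rg k Hs uE Z0).
have -> : rsubmx (amb_point 1 (chart a x) 0) = cpt (chart a x) 0 by exact: amb_zE.
have -> : amb_t (amb_point 1 (chart a x) 0) = 1 :> R by exact: amb_tE.
rewrite (w0 rg cx) invr1 mulr1 powR1 mul1r.
rewrite (tcoef_Diter_top rg _ Hs cx k0) //; last first.
  move=> j jk y Uy; have [ay yE] := cod_inv Uy.
  rewrite -yE tcoef_Dop_Hext //; last by lia.
  by rewrite ifF //; apply/eqP; lia.
rewrite tcoef_Dop_Hext ?eqxx //; by rewrite prednK.
Qed.

End GJMS.

Lemma mu_scale k u : (k.-1)`!%:R ^+ 2 *: mu k u = Mop k u.
Proof.
rewrite /mu scalerA mulfV ?scale1r // expf_neq0 // pnatr_eq0 -lt0n.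
Qed.

Variable P : nat -> (M -> R) -> (M -> R).
Hypothesis hP : forall k : nat, admissible n k -> is_gjms eps gr k (P k).

(** The abstract inversion for the space of all functions on [M], with smoothness as [S].
    Admissibility passes from [N] to every smaller positive index, which provides the operators
    occurring in the compositions. *)
Lemma juhl_formula (u : M -> R) : smooth u ->
  P N u = - (\sum_(l < N.+1) \sum_(I : l.-tuple 'I_N.+1 |
     is_composition N (map val I) && (map val I != [:: N]))
       m_coef R (map val I) *: op_comp P (map val I) u) + Mop N u.
Proof.
move=> us; rewrite -mu_scale.
apply: (inversion_tuple smooth0 smoothMD smoothMZ smooth_mu muMD muMZ _ us).
  by move=> k v kN vs; apply: (gjmsE kN vs); apply: hP; exact: admissibleW.
by case/andP: hN.
Qed.

End Assembly.

Local Close Scope classical_set_scope.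

Theorem theorem1p2 (R : realType) (n p q : nat) (hn : (3 <= n)%N)
    (M : manifold R n)
    (g : chart_index M -> 'rV[R]_n -> 'M[R]_n) (hg : is_metric p q g)
    (eps : R) (heps : 0 < eps)
    (gr : chart_index M -> R -> 'rV[R]_n -> 'M[R]_n)
    (hgr : is_poincare_family p q g eps gr)
    (P : nat -> (M -> R) -> (M -> R))
    (hP : forall k : nat, admissible n k -> is_gjms eps gr k (P k))
    (Mop : nat -> (M -> R) -> (M -> R))
    (hM : is_calM_coefficients g gr Mop)
    (N : nat) (hN : admissible n N) (f : M -> R) (hf : smooth f) (x : M) :
  P N f x =
    - (\sum_(l < N.+1)
         \sum_(I : l.-tuple 'I_N.+1 |
                 is_composition N (map val I) && (map val I != [:: N]))
           m_coef R (map val I) * op_comp P (map val I) f x)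
    + Mop N f x.
Proof.
have [metric_gr smooth_gr init_gr _] := hgr.
have := juhl_formula hg heps metric_gr smooth_gr init_gr hM hN hP hf.
move=> /(congr1 (fun v => v x)) ->.
congr (- _ + _); rewrite fct_sumE; apply: eq_bigr => l _.
by rewrite fct_sumE.
Qed.
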